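(* Let $d\ge 2$, let $0<a<b$ and let $G$ be a probability distribution supported on $\{a,b\}$. There exist constants $C>0$ and $h_0>0$ (depending only on $d$ and $G$) such that for all integers $n\ge 1$ and all integers $H\ge h_0 n$, $$\operatorname{Var}\big(\Phi([0,n]^{d-1}\times\{0\},H)\big)\le C\,\frac{n^{d-1}}{\log n},$$ where for $n=1$ the right-hand side is interpreted as $+\infty$.
   Context: Let $(\mathbb Z^d,\mathbb E^d)$ be the graph with vertex set $\mathbb Z^d$ and (non-oriented) edges between nearest neighbours. To each edge $e\in\mathbb E^d$ is attached a capacity $t_e$; the family $(t_e)_{e\in\mathbb E^d}$ is i.i.d. with distribution $G$. For integers $n,H\ge 1$ consider the cylinder $[0,n]^{d-1}\times[0,H]$; its bottom is $B=([0,n]^{d-1}\times\{0\})\cap\mathbb Z^d$ and its top is $T=([0,n]^{d-1}\times\{H\})\cap\mathbb Z^d$. A set of edges $E\subset\mathbb E^d$ is a cutset of the cylinder if every nearest-neighbour path from $B$ to $T$ staying in the cylinder uses at least one edge of $E$. The capacity of $E$ is $\sum_{e\in E}t_e$. The maximal flow $\Phi([0,n]^{d-1}\times\{0\},H)$ is the minimum of the capacities of all cutsets of the cylinder. *)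

(* Defs.v *)
From mathcomp Require Import all_boot all_order all_algebra finmap.
From mathcomp Require Import all_classical all_reals all_analysis.

Set Implicit Arguments.
Unset Strict Implicit.
Unset Printing Implicit Defensive.

Import Order.TTheory GRing.Theory Num.Theory.

Local Open Scope classical_set_scope.
Local Open Scope ring_scope.

Notation vertex d := 'rV[int]_d.

Definition neighbours (d : nat) : rel (vertex d) :=
  [rel x y : vertex d | \sum_i `|x 0 i - y 0 i| == 1].

(* The pair (x, i) stands for the non-oriented edge {x, x + e_i}, where e_i is
   the i-th canonical basis vector; lemma [neighboursP] shows that every
   non-oriented nearest-neighbour edge is represented exactly once. *)
Definition edge (d : nat) : Type := (vertex d * 'I_d)%type.

Definition edge_joins (d : nat) (e : edge d) (x y : vertex d) : Prop :=
  (x = e.1 /\ y = e.1 + delta_mx 0 e.2) \/ (y = e.1 /\ x = e.1 + delta_mx 0 e.2).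

Lemma neighbours_delta (d : nat) (x : vertex d) (i : 'I_d) :
  neighbours x (x + delta_mx 0 i).
Proof.
rewrite /neighbours /= (bigD1 i) //= big1 ?addr0.
  by rewrite !mxE !eqxx opprD addNKr normrN1.
by move=> j ji; rewrite !mxE eqxx (negbTE ji) addr0 subrr normr0.
Qed.

Lemma neighbours_sym (d : nat) : symmetric (@neighbours d).
Proof.
by move=> x y; rewrite /neighbours /=; under eq_bigr do rewrite distrC.
Qed.

Lemma neighboursP (d : nat) (x y : vertex d) :
  neighbours x y <-> exists! e : edge d, edge_joins e x y.
Proof.
split; last first.
  case=> -[z i] [/= [[-> ->]|[-> ->]] _]; first exact: neighbours_delta.
  by rewrite neighbours_sym; exact: neighbours_delta.
move=> xy.
have delta_neq0 (k : 'I_d) : delta_mx 0 k != 0 :> vertex d.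
  by apply/eqP => /rowP/(_ k); rewrite !mxE !eqxx.
have delta_inj (k l : 'I_d) :
    delta_mx 0 k = delta_mx 0 l :> vertex d -> k = l.
  by move=> /rowP/(_ k); rewrite !mxE !eqxx /=; case: eqP.
have delta_opp (k l : 'I_d) : delta_mx 0 k + delta_mx 0 l != 0 :> vertex d.
  by apply/eqP => /rowP/(_ k); rewrite !mxE !eqxx /=; case: eqP.
have [e exy] : exists e : edge d, edge_joins e x y.
  move: xy; rewrite /neighbours /= => /eqP xy.
  have [i xyi] : exists i, x 0 i - y 0 i != 0.
    apply: contrapT => /forallNP xy0; move: xy; rewrite big1 // => i _.
    by apply/eqP; rewrite normr_eq0; apply/negPn/negP; exact: xy0.
  have rest0 : \sum_(j | j != i) `|x 0 j - y 0 j| = 0.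
    apply/eqP; rewrite eq_le sumr_ge0 ?andbT //.
    move: xy; rewrite (bigD1 i) //= => xy.
    by rewrite -(lerD2l `|x 0 i - y 0 i|) xy addr0 -gtz0_ge1 normr_gt0.
  have eq0 j : j != i -> x 0 j = y 0 j.
    move=> ji; apply/eqP; rewrite -subr_eq0 -normr_eq0.
    by move/eqP: rest0; rewrite psumr_eq0 // => /allP/(_ j (mem_index_enum j))/implyP; apply.
  move: xy; rewrite (bigD1 i) //= rest0 addr0 => /eqP.
  rewrite eqr_norml ler01 andbT => /orP[] /eqP xi.
    exists (y, i); right; split=> //=; apply/rowP => j; rewrite !mxE eqxx /=.
    case: eqVneq => [->|/eq0->]; last by rewrite addr0.
    by move/eqP: xi; rewrite subr_eq addrC => /eqP.
  exists (x, i); left; split=> //=; apply/rowP => j; rewrite !mxE eqxx /=.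
  case: eqVneq => [->|/eq0->]; last by rewrite addr0.
  by move/eqP: xi; rewrite subr_eq => /eqP ->; rewrite addrAC addNr add0r.
exists e; split=> // -[z k]; case: e exy => u i.
rewrite /edge_joins /= => -[[xu yu]|[yu xu]] [[xz yz]|[yz xz]]; subst x y.
- by rewrite -xz in yz *; move/addrI/delta_inj: yz => ->.
- move: xz => /eqP; rewrite -yz -addrA -{1}[u]addr0 (inj_eq (addrI u)) eq_sym.
  by rewrite (negbTE (delta_opp _ _)).
- move: yz => /eqP; rewrite -xz -addrA -{1}[u]addr0 (inj_eq (addrI u)) eq_sym.
  by rewrite (negbTE (delta_opp _ _)).
- by rewrite -yz in xz *; move/addrI/delta_inj: xz => ->.
Qed.

Section Cylinder.
Variables (d n H : nat).

(* The vertical direction is the last coordinate, of index d - 1. *)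
Definition cylinder : set (vertex d) :=
  [set x | forall i : 'I_d,
     0 <= x 0 i <= (if (i : nat) == d.-1 then H else n)%:Z].

Definition bottom : set (vertex d) :=
  [set x | cylinder x /\ forall i : 'I_d, (i : nat) = d.-1 -> x 0 i = 0].

Definition top : set (vertex d) :=
  [set x | cylinder x /\ forall i : 'I_d, (i : nat) = d.-1 -> x 0 i = H%:Z].

(* The path visits the vertices x, p_0, p_1, ..., in this order. *)
Definition crossing_path (x : vertex d) (p : seq (vertex d)) : Prop :=
  [/\ path (@neighbours d) x p, bottom x, top (last x p) &
      forall y, y \in x :: p -> cylinder y].

Definition path_uses (x : vertex d) (p : seq (vertex d)) (e : edge d) : Prop :=
  exists2 k, (k < size p)%N & edge_joins e (nth x (x :: p) k) (nth x p k).

Definition cutset (E : set (edge d)) : Prop :=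
  forall x p, crossing_path x p -> exists2 e, E e & path_uses x p e.

End Cylinder.

(* Cutsets may be infinite, so capacities live in [\bar R]. [esum] is the
   supremum of the finite partial sums, i.e. the sum when t is nonnegative. *)
Definition capacity (R : realType) (d : nat) (t : edge d -> R)
  (E : set (edge d)) : \bar R := (\esum_(e in E) (t e)%:E)%E.

(* For nonnegative t the infimum is a finite minimum: intersecting a cutset with
   the finitely many edges of the cylinder gives a cutset of smaller capacity. *)
Definition max_flow (R : realType) (d n H : nat) (t : edge d -> R) : R :=
  fine (ereal_inf [set capacity t E | E in @cutset d n H]).

Definition mutually_independent (R : realType) (disp : measure_display)
    (Omega : measurableType disp) (P : probability Omega R) (I : choiceType)
    (X : I -> {RV P >-> R}) : Prop :=
  forall (J : {fset I}) (A : I -> set R), (forall i, measurable (A i)) ->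
    P (\bigcap_(i in [set` J]) (X i @^-1` A i)) =
    (\prod_(i <- J) P (X i @^-1` A i))%E.

Definition iid_with_law (R : realType) (disp : measure_display)
    (Omega : measurableType disp) (P : probability Omega R) (I : choiceType)
    (X : I -> {RV P >-> R}) (G : probability R R) : Prop :=
  mutually_independent X /\
  forall i (A : set R), measurable A -> distribution P (X i) A = G A.

(* Main.v *)
(* Write D = d - 1 and encode a capacity configuration by bits, "true" standing
   for the capacity a. By duality with vertex sets, the maximal flow is the
   minimal cost of a cut separating the bottom of the cylinder from its top.

   By isoperimetry, an optimal cut of a cylinder of width N and height at least
   ch * N lives in a window of height ch * N. Hence, at small cost in L^2, the
   flow can be replaced by its average over m vertical translations, for which
   the influence of an edge is at most 1 / m times the expected number q of edges
   of its column that belong to the optimal cut. The L^1-L^2 variance inequality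
   of Talagrand, a consequence of the two-point logarithmic Sobolev inequality,
   gains a factor ln n on all the columns except the bad ones, where
   q > m / k ^ 2, the scale k being a small power of n.

   The bad columns carry a mass O(n^D ln n / k). Cut the cylinder into tiles of
   side r = 4 k ^ 3. The flow is at least the sum of the flows through the tiles
   free of bad columns plus a times the mass of the cut in the bad columns. It is
   at most the sum over the tiles of their flows with a prescribed lateral trace,
   because cuts with the same trace up to reflection can be glued together. Few
   traces occur near the lateral boundary of a tile, and the flow through a tile
   has Gaussian lower tails, so that some trace costs little on average.
   Comparing the two bounds controls the mass of the bad columns. *)

Require Import Defs.
From HB Require Import structures.
From mathcomp Require Import all_boot all_order all_algebra finmap zify ring lra.
From mathcomp Require Import all_classical all_reals all_analysis.
From mathcomp Require Import measurable_realfun.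

Set Implicit Arguments.
Unset Strict Implicit.
Unset Printing Implicit Defensive.

Import Order.TTheory GRing.Theory Num.Theory.

Local Open Scope ring_scope.

(** * Functions of independent bits *)

Section Averages.
Variables (R : realType) (I : eqType) (p : R).
Hypotheses (p0 : 0 <= p) (p1 : p <= 1).
Implicit Types (w : I -> bool) (F G : (I -> bool) -> R) (s : seq I) (e : I).

Definition upd w e v : I -> bool := fun i => if i == e then v else w i.

Definition av e F : (I -> bool) -> R :=
  fun w => p * F (upd w e true) + (1 - p) * F (upd w e false).

(* Expectation over the coordinates in s, which are independent and true with
   probability p; the other coordinates are those of w. *)
Fixpoint avs s F : (I -> bool) -> R :=
  if s is e :: s' then avs s' (av e F) else F.

Definition dif e F : (I -> bool) -> R :=
  fun w => F (upd w e true) - F (upd w e false).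

Let q0 : 0 <= 1 - p. Proof. by rewrite subr_ge0. Qed.

Lemma upd_same w e u v : upd (upd w e u) e v = upd w e v.
Proof. by apply/funext => i; rewrite /upd; case: eqP. Qed.

Lemma upd_comm w e f u v : e != f ->
  upd (upd w e u) f v = upd (upd w f v) e u.
Proof.
move=> ef; apply/funext => i; rewrite /upd.
by case: eqVneq => // ->; rewrite eq_sym (negbTE ef).
Qed.

Lemma upd_id w e : upd w e (w e) = w.
Proof. by apply/funext => i; rewrite /upd; case: eqP => [->|]. Qed.

Lemma av_comm e f F : av e (av f F) = av f (av e F).
Proof.
have [->//|ef] := eqVneq e f; apply/funext => w; rewrite /av.
rewrite !(upd_comm _ _ _ ef); ring.
Qed.

Lemma av_idem e F : av e (av e F) = av e F.
Proof. by apply/funext => w; rewrite /av !upd_same; ring. Qed.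

Lemma dif_av_comm e f F : e != f -> dif e (av f F) = av f (dif e F).
Proof.
move=> ef; apply/funext => w; rewrite /dif /av.
rewrite !(upd_comm _ _ _ ef); ring.
Qed.

Lemma avs_abs s e F : e \in s -> avs s (av e F) = avs s F.
Proof.
elim: s F => //= f s IH F; rewrite inE => /orP[/eqP ->|/IH H].
  by rewrite av_idem.
by rewrite av_comm H.
Qed.

Lemma le_av e F G : (forall w, F w <= G w) -> forall w, av e F w <= av e G w.
Proof. by move=> h w; apply: lerD; apply: ler_wpM2l. Qed.

Lemma le_avs s F G : (forall w, F w <= G w) -> forall w, avs s F w <= avs s G w.
Proof. by elim: s F G => //= e s IH F G h; apply: IH; apply: le_av. Qed.

Lemma eq_avs s F G : (forall w, F w = G w) -> avs s F = avs s G.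
Proof. by move=> h; congr avs; apply/funext. Qed.

Lemma avD e F G : av e (fun w => F w + G w) = fun w => av e F w + av e G w.
Proof. by apply/funext => w; rewrite /av; ring. Qed.

Lemma avsD s F G w :
  avs s (fun w => F w + G w) w = avs s F w + avs s G w.
Proof. by elim: s F G => //= e s IH F G; rewrite avD IH. Qed.

Lemma avZ e c F : av e (fun w => c * F w) = fun w => c * av e F w.
Proof. by apply/funext => w; rewrite /av; ring. Qed.

Lemma avsZ s c F w : avs s (fun w => c * F w) w = c * avs s F w.
Proof. by elim: s F => //= e s IH F; rewrite avZ IH. Qed.

Lemma avC e c : av e (fun=> c) = fun=> c.
Proof. by apply/funext => w; rewrite /av; ring. Qed.

Lemma avsC s c w : avs s (fun=> c) w = c.
Proof. by elim: s => //= e s IH; rewrite avC. Qed.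

Lemma avsN s F w : avs s (fun w => - F w) w = - avs s F w.
Proof.
have -> : (fun w => - F w) = fun w => (-1) * F w.
  by apply/funext => v; rewrite mulN1r.
by rewrite avsZ mulN1r.
Qed.

Lemma avsB s F G w : avs s (fun w => F w - G w) w = avs s F w - avs s G w.
Proof. by rewrite avsD avsN. Qed.

Lemma avs_sum (J : Type) (r : seq J) (P : pred J) s (F : J -> (I -> bool) -> R) w :
  avs s (fun w => \sum_(j <- r | P j) F j w) w =
  \sum_(j <- r | P j) avs s (F j) w.
Proof.
elim: r => [|j r IH].
  under eq_avs do rewrite big_nil.
  by rewrite avsC big_nil.
under eq_avs do rewrite big_cons.
rewrite big_cons -IH; case: (P j) => //.
by rewrite avsD.
Qed.

Lemma avs_ge0 s F : (forall w, 0 <= F w) -> forall w, 0 <= avs s F w.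
Proof. by move=> h w; have := le_avs s h w; rewrite avsC. Qed.

Lemma ler_norm_avs s F w : `|avs s F w| <= avs s (fun w => `|F w|) w.
Proof.
rewrite ler_norml; apply/andP; split.
  have := @le_avs s (fun w => - `|F w|) F (fun w => lerNnormlW (lexx _)) w.
  by rewrite avsN.
by apply: le_avs => v; apply: ler_norm.
Qed.

Lemma sqr_avs s F w : (avs s F w) ^+ 2 <= avs s (fun w => F w ^+ 2) w.
Proof.
have := @avs_ge0 s (fun v => (F v - avs s F w) ^+ 2) (fun v => sqr_ge0 _) w.
set c := avs s F w.
have -> : (fun v => (F v - c) ^+ 2) =
   (fun v => F v ^+ 2 + ((- (2 * c)) * F v + c ^+ 2)).
  by apply/funext => v; ring.
by rewrite !avsD avsZ avsC -/c; lra.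
Qed.

Definition depends s F :=
  forall w w', (forall i, i \in s -> w i = w' i) -> F w = F w'.

Lemma depends_av_rem e s F : depends (e :: s) F -> depends s (av e F).
Proof.
move=> h w w' ww'; rewrite /av.
congr (_ * _ + _ * _); apply: h => i; rewrite inE /upd;
  by case: eqP => //= _ /ww'.
Qed.

Lemma avs_const s F : depends s F -> forall w w', avs s F w = avs s F w'.
Proof.
elim: s F => [|e s IH] F h w w' /=; first exact: h.
by apply: IH; apply: depends_av_rem.
Qed.

Lemma avs_sub s s' F : depends s F -> {subset s <= s'} -> avs s' F = avs s F.
Proof.
move=> h ss'.
have E : avs s' (avs s F) = avs s F.
  have : forall w w', avs s F w = avs s F w' by exact: avs_const.
  move=> c; apply/funext => w.
  have -> : avs s F = fun=> avs s F w by apply/funext => v; apply: c.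
  by rewrite avsC.
rewrite -E; clear E h; elim: s ss' F => //= e s IH ss' F.
rewrite -IH; last by move=> i is_; apply: ss'; rewrite inE is_ orbT.
by rewrite avs_abs // ss' // mem_head.
Qed.

End Averages.

Section Relabelling.
Variables (R : realType) (I I' : eqType) (p : R).
Hypotheses (p0 : 0 <= p) (p1 : p <= 1).

Lemma avs_relabel (f : I -> I') (s : seq I) (F : (I -> bool) -> R) w :
  uniq s -> {in s &, injective f} -> depends s F ->
  avs p (map f s) (fun w => F (w \o f)) w = avs p s F (w \o f).
Proof.
elim: s F => [|e s IH] F //= /andP[es us] finj dF.
rewrite -IH //; last 2 first.
- by move=> x y xs ys; apply: finj; rewrite inE ?xs ?ys orbT.
- exact: depends_av_rem.
congr (avs _ _ _ _); apply/funext => v; rewrite /av.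
congr (_ * _ + _ * _); apply: dF => i ies; rewrite /upd /=.
all: by rewrite (inj_in_eq finj) // mem_head.
Qed.

Lemma avs_relabel_sub (f : I -> I') (s L : seq I) (L' : seq I')
    (F : (I -> bool) -> R) w w' :
  uniq s -> {in s &, injective f} -> depends s F ->
  {subset s <= L} -> {subset map f s <= L'} ->
  avs p L' (fun w => F (w \o f)) w' = avs p L F w.
Proof.
move=> us finj dF sL sL'.
rewrite (avs_sub p dF sL) (@avs_sub _ _ p (map f s)) //.
  by rewrite avs_relabel //; apply: avs_const.
by move=> v v' vv'; apply: dF => i is_ /=; apply: vv'; apply: map_f.
Qed.

End Relabelling.

Section Inequalities.
Variables (R : realType) (I : eqType) (p : R).
Hypotheses (p0 : 0 <= p) (p1 : p <= 1).
Implicit Types (w : I -> bool) (F G X : (I -> bool) -> R) (s : seq I) (e : I).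

Local Notation av := (av p).
Local Notation avs := (avs p).

Let q0 : 0 <= 1 - p. Proof. by rewrite subr_ge0. Qed.

Definition var s F w := avs s (fun v => F v ^+ 2) w - (avs s F w) ^+ 2.

Definition energy s F w := \sum_(e <- s) avs s (fun v => dif e F v ^+ 2) w.

Lemma av_var e F w :
  av e (fun v => F v ^+ 2) w - (av e F w) ^+ 2 = p * (1 - p) * dif e F w ^+ 2.
Proof. by rewrite /av /dif; ring. Qed.

Lemma sqr_av e F w : (av e F w) ^+ 2 <= av e (fun v => F v ^+ 2) w.
Proof. exact: (sqr_avs p0 p1 [:: e]). Qed.

Lemma var_cons e s F w :
  var (e :: s) F w =
  p * (1 - p) * avs s (fun v => dif e F v ^+ 2) w + var s (av e F) w.
Proof.
rewrite /var /= -avsZ.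
have -> : av e (fun v => F v ^+ 2) =
    fun v => p * (1 - p) * dif e F v ^+ 2 + (av e F v) ^+ 2.
  by apply/funext => v; rewrite -av_var; ring.
by rewrite avsD; ring.
Qed.

Lemma av_dif_comp (h : R -> R) e F : av e (fun w => h (dif e F w)) = fun w => h (dif e F w).
Proof. by apply/funext => w; rewrite /av /dif !upd_same; ring. Qed.

Lemma le_energy_av s e F w : e \notin s ->
  \sum_(f <- s) avs s (fun v => dif f (av e F) v ^+ 2) w <=
  \sum_(f <- s) avs (e :: s) (fun v => dif f F v ^+ 2) w.
Proof.
move=> es; rewrite !big_seq; apply: ler_sum => f fs /=.
apply: (le_avs p0 p1) => v; rewrite dif_av_comm ?sqr_av //.
by apply: contraNneq es => <-.
Qed.

Theorem efron_stein s F w : uniq s -> var s F w <= p * (1 - p) * energy s F w.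
Proof.
elim: s F => [|e s IH] F /=; first by rewrite /var /energy /= big_nil subrr mulr0.
move=> /andP[es us]; rewrite var_cons /energy big_cons (mulrDr (p * (1 - p))) /= (av_dif_comp (fun x => x ^+ 2)).
rewrite lerD2l (le_trans (IH _ us)) // ler_wpM2l ?mulr_ge0 //.
exact: le_energy_av.
Qed.

Definition xlnx (x : R) := x * ln x.

Definition ent s F w := avs s (fun v => xlnx (F v)) w - xlnx (avs s F w).

Lemma ent_cons e s F w :
  ent (e :: s) F w =
  avs s (fun v => av e (fun v => xlnx (F v)) v - xlnx (av e F v)) w
  + ent s (av e F) w.
Proof. by rewrite /ent /= avsB; ring. Qed.

Lemma ln_le_subr1 (x : R) : 0 < x -> ln x <= x - 1.
Proof.
move=> x0; rewrite -[X in ln X](subrK 1) addrC le_ln1Dx //.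
by rewrite ltrBrDr addrC subrr.
Qed.

Lemma xlnx_tangent (m u : R) : 0 < m -> 0 <= u ->
  xlnx u <= u * ln m + u * (u / m - 1).
Proof.
move=> m0; rewrite le_eqVlt => /orP[/eqP <-|u0]; first by rewrite /xlnx !mul0r addr0.
rewrite /xlnx -mulrDr ler_wpM2l ?(ltW u0) //.
have : ln (u / m) <= u / m - 1.
  by rewrite ln_le_subr1 // divr_gt0.
by rewrite ln_div ?posrE // => h; lra.
Qed.

(* With ln u <= u - 1, the entropy of a two-point variable is at most its
   variance over its mean. *)
Lemma two_point_ent (x y : R) :
  p * xlnx (x ^+ 2) + (1 - p) * xlnx (y ^+ 2)
  - xlnx (p * x ^+ 2 + (1 - p) * y ^+ 2) <= 2 * (x - y) ^+ 2.
Proof.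
set m := p * x ^+ 2 + _.
have px0 : 0 <= p * x ^+ 2 by rewrite mulr_ge0 ?sqr_ge0.
have qy0 : 0 <= (1 - p) * y ^+ 2 by rewrite mulr_ge0 ?sqr_ge0.
have m0 : 0 <= m by rewrite addr_ge0.
have [m_eq0|m_neq0] := eqVneq m 0.
  have x0 : p * x ^+ 2 = 0 by rewrite /m in m_eq0; lra.
  have y0 : (1 - p) * y ^+ 2 = 0 by rewrite /m in m_eq0; lra.
  rewrite m_eq0 /xlnx (mulrA p (x ^+ 2)) (mulrA (1 - p) (y ^+ 2)) x0 y0 !mul0r.
  rewrite addr0 subr0.
  by rewrite mulr_ge0 ?sqr_ge0.
have {m_neq0} {}m0 : 0 < m by rewrite lt_def m_neq0.
have hx := ler_wpM2l p0 (xlnx_tangent m0 (sqr_ge0 x)).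
have hy := ler_wpM2l q0 (xlnx_tangent m0 (sqr_ge0 y)).
apply: (@le_trans _ _ (p * (1 - p) * (x ^+ 2 - y ^+ 2) ^+ 2 / m)).
  have -> : p * (1 - p) * (x ^+ 2 - y ^+ 2) ^+ 2 / m =
    p * (x ^+ 2 * ln m + x ^+ 2 * (x ^+ 2 / m - 1)) +
    (1 - p) * (y ^+ 2 * ln m + y ^+ 2 * (y ^+ 2 / m - 1)) - m * ln m.
    rewrite /m; field; rewrite -/m; exact: lt0r_neq0.
  by rewrite {3}/xlnx; lra.
rewrite ler_pdivrMr //.
have -> : p * (1 - p) * (x ^+ 2 - y ^+ 2) ^+ 2 =
  (x - y) ^+ 2 * (p * (1 - p) * (x + y) ^+ 2) by ring.
rewrite [X in _ <= X]mulrAC [2 * m * _]mulrC ler_wpM2l ?sqr_ge0 // /m.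
have h1 : p * (1 - p) * (x + y) ^+ 2 <= p * (1 - p) * (2 * (x ^+ 2 + y ^+ 2)).
  apply: ler_wpM2l; first exact: mulr_ge0.
  by have := sqr_ge0 (x - y); lra.
apply: le_trans h1 _.
have : 0 <= p ^+ 2 * x ^+ 2 by rewrite mulr_ge0 ?sqr_ge0.
have : 0 <= (1 - p) ^+ 2 * y ^+ 2 by rewrite mulr_ge0 ?sqr_ge0.
by move=> *; lra.
Qed.

Lemma two_point_minkowski (x1 x0 y1 y0 : R) :
  (Num.sqrt (p * x1 ^+ 2 + (1 - p) * x0 ^+ 2)
   - Num.sqrt (p * y1 ^+ 2 + (1 - p) * y0 ^+ 2)) ^+ 2
  <= p * (x1 - y1) ^+ 2 + (1 - p) * (x0 - y0) ^+ 2.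
Proof.
set a := p * x1 ^+ 2 + _; set b := p * y1 ^+ 2 + _.
have a0 : 0 <= a by rewrite addr_ge0 // mulr_ge0 ?sqr_ge0.
have b0 : 0 <= b by rewrite addr_ge0 // mulr_ge0 ?sqr_ge0.
have sa := sqr_sqrtr a0; have sb := sqr_sqrtr b0.
suff : p * (x1 * y1) + (1 - p) * (x0 * y0) <= Num.sqrt a * Num.sqrt b.
  move: sa sb; rewrite /a /b; set u := Num.sqrt _; set v := Num.sqrt _ => *.
  nra.
rewrite -sqrtrM // (le_trans (ler_norm _)) // -sqrtr_sqr ler_wsqrtr // /a /b.
have : 0 <= p * (1 - p) * (x1 * y0 - x0 * y1) ^+ 2.
  by rewrite mulr_ge0 ?sqr_ge0 // mulr_ge0.
by move=> *; lra.
Qed.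

Theorem log_sobolev s F w : uniq s -> (forall v, 0 <= F v) ->
  ent s (fun v => F v ^+ 2) w <= 2 * energy s F w.
Proof.
elim: s F => [|e s IH] F /=.
  by rewrite /ent /energy /= big_nil subrr mulr0.
move=> /andP[es us] F0; rewrite ent_cons /energy big_cons (mulrDr 2) /= (av_dif_comp (fun x => x ^+ 2)).
apply: lerD.
  rewrite -avsZ; apply: (le_avs p0 p1) => v; exact: two_point_ent.
pose G := fun v => Num.sqrt (av e (fun v => F v ^+ 2) v).
have G2 : (fun v => G v ^+ 2) = av e (fun v => F v ^+ 2).
  apply/funext => v; rewrite /G sqr_sqrtr //.
  by rewrite addr_ge0 // mulr_ge0 ?sqr_ge0.
rewrite -G2 (le_trans (IH _ us _)) //; first by move=> v; exact: sqrtr_ge0.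
rewrite ler_wpM2l // /energy !big_seq; apply: ler_sum => f fs /=.
apply: (le_avs p0 p1) => v.
have ef : f != e by apply: contraNneq es => <-.
rewrite /dif /G /av !(upd_comm _ _ _ ef).
exact: two_point_minkowski.
Qed.

Lemma ent_ge s F w (c m : R) : 0 < c -> (forall v, 0 <= F v) ->
  m = avs s (fun v => F v ^+ 2) w ->
  2 * m * ln c + 2 * (m - c * Num.sqrt m * avs s F w) <= ent s (fun v => F v ^+ 2) w.
Proof.
move=> c0 F0 mE.
have m0 : 0 <= m by rewrite mE; apply: (avs_ge0 p0 p1) => v; exact: sqr_ge0.
have AF0 : 0 <= avs s F w by exact: (avs_ge0 p0 p1).
have [m_eq0|m_neq0] := eqVneq m 0.
  have AF : avs s F w = 0.
    have := sqr_avs p0 p1 s F w; rewrite -mE m_eq0 => h.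
    by apply/eqP; rewrite -sqrf_eq0 eq_le h sqr_ge0.
  rewrite /ent -mE m_eq0 AF /xlnx !(mulr0, mul0r) subrr mulr0 addr0 subr0.
  rewrite (_ : 0 = avs s (fun=> 0) w); last by rewrite avsC.
  have : avs s (fun v => 2 * F v ^+ 2 - 2 * F v) w <= avs s (fun v => F v ^+ 2 * ln (F v ^+ 2)) w.
    apply: (le_avs p0 p1) => v.
    have [->|Fv] := eqVneq (F v) 0; first by rewrite expr0n /= !(mul0r, mulr0) subrr.
    have {}Fv : 0 < F v by rewrite lt_def Fv F0.
    have : ln ((F v)^-1) <= (F v)^-1 - 1.
      by rewrite ln_le_subr1 // invr_gt0.
    rewrite lnV ?posrE // lnXn // -(ler_pM2l (exprn_gt0 2 Fv)).
    have -> : F v ^+ 2 * ((F v)^-1 - 1) = F v - F v ^+ 2.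
      by field; rewrite gt_eqF.
    have -> : F v ^+ 2 * (ln (F v) *+ 2) = 2 * (F v ^+ 2 * ln (F v)).
      by rewrite -mulr_natr; ring.
    by have := sqr_ge0 (F v); have := F0 v; lra.
  by rewrite avsB !avsZ AF -mE m_eq0 mulr0 subrr avsC.
have {m_neq0} {}m0 : 0 < m by rewrite lt_def m_neq0.
pose r := Num.sqrt m; have r0 : 0 < r by rewrite sqrtr_gt0.
have rr : r ^+ 2 = m by rewrite sqr_sqrtr // ltW.
suff : avs s (fun v => (ln m + 2 * ln c + 2) * F v ^+ 2 + (- (2 * c * r)) * F v) w
     <= avs s (fun v => xlnx (F v ^+ 2)) w.
  rewrite avsD !avsZ /ent -mE -/r /xlnx => h; lra.
apply: (le_avs p0 p1) => v; rewrite /xlnx.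
have [->|Fv] := eqVneq (F v) 0; first by rewrite expr0n /= !(mul0r, mulr0) addr0.
have {}Fv : 0 < F v by rewrite lt_def Fv F0.
have : ln (c * r / F v) <= c * r / F v - 1.
  by rewrite ln_le_subr1 // divr_gt0 // mulr_gt0.
have lm : ln m = 2 * ln r by rewrite -rr lnXn // mulr_natl.
rewrite ln_div ?posrE ?mulr_gt0 // lnM ?posrE // lnXn //.
have Fne : F v != 0 by rewrite gt_eqF.
rewrite -(ler_pM2l (exprn_gt0 2 Fv)).
have -> : F v ^+ 2 * (c * r / F v - 1) = c * r * F v - F v ^+ 2 by field.
have -> : F v ^+ 2 * (ln (F v) *+ 2) = 2 * (F v ^+ 2 * ln (F v)) by rewrite -mulr_natr; ring.
rewrite lm => h; lra.
Qed.

End Inequalities.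

Section Concentration.
Variables (R : realType) (I : eqType) (p : R).
Hypotheses (p0 : 0 <= p) (p1 : p <= 1).
Implicit Types (w : I -> bool) (F G X : (I -> bool) -> R) (s : seq I) (e : I).

Local Notation av := (av p).
Local Notation avs := (avs p).
Local Notation ent := (ent p).
Local Notation var := (var p).
Local Notation energy := (energy p).

Let q0 : 0 <= 1 - p. Proof. by rewrite subr_ge0. Qed.
Let pq0 : 0 <= p * (1 - p). Proof. exact: mulr_ge0. Qed.

Lemma sqr_dif_norm e F w :
  dif e (fun v => `|F v|) w ^+ 2 <= dif e F w ^+ 2.
Proof.
rewrite /dif -[leLHS]real_normK ?num_real // -[leRHS]real_normK ?num_real //.
by rewrite lerXn2r ?nnegrE // ler_dist_dist.
Qed.

Lemma log_sobolev_norm s F w : uniq s ->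
  ent s (fun v => F v ^+ 2) w <= 2 * energy s F w.
Proof.
move=> us; have := log_sobolev p0 p1 w us (fun v => normr_ge0 (F v)).
have -> : (fun v => `|F v| ^+ 2) = (fun v => F v ^+ 2).
  by apply/funext => v; rewrite real_normK ?num_real.
move/le_trans; apply; rewrite ler_wpM2l // ler_sum // => e _.
by apply: (le_avs p0 p1) => v; exact: sqr_dif_norm.
Qed.

Lemma ent_ge_norm s F w (c m : R) : 0 < c ->
  m = avs s (fun v => F v ^+ 2) w ->
  2 * m * ln c + 2 * (m - c * Num.sqrt m * avs s (fun v => `|F v|) w)
  <= ent s (fun v => F v ^+ 2) w.
Proof.
move=> c0 mE; have F2 : (fun v => `|F v| ^+ 2) = (fun v => F v ^+ 2).
  by apply/funext => v; rewrite real_normK ?num_real.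
rewrite -F2 in mE *; exact: ent_ge.
Qed.

Lemma ent_ge0 s F w : 0 <= ent s (fun v => F v ^+ 2) w.
Proof.
have := @ent_ge_norm s F w 1 _ ltr01 erefl; rewrite ln1 mulr0 add0r mul1r.
apply: le_trans; set m := avs s _ w.
rewrite mulr_ge0 // subr_ge0 -[leRHS]sqr_sqrtr; last first.
  by apply: (avs_ge0 p0 p1) => v; exact: sqr_ge0.
rewrite expr2 ler_wpM2l ?sqrtr_ge0 // -[leLHS]ger0_norm; last first.
  exact: (avs_ge0 p0 p1).
rewrite -sqrtr_sqr ler_wsqrtr // (le_trans (sqr_avs p0 p1 _ _ _)) //.
by apply: (le_avs p0 p1) => v; rewrite real_normK ?num_real.
Qed.

(* Either the increment is concentrated enough for its entropy to dominate its
   second moment, or its second moment is controlled by its first one. *)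
Lemma second_moment_le s F w (Lam : R) : 0 <= Lam ->
  Lam * avs s (fun v => F v ^+ 2) w <= ent s (fun v => F v ^+ 2) w / 2 +
    Lam * (expR (2 * Lam) * avs s (fun v => `|F v|) w ^+ 2).
Proof.
move=> Lam0; set m := avs s (fun v => F v ^+ 2) w; set i := avs s _ w.
have i0 : 0 <= i by apply: (avs_ge0 p0 p1).
have m0 : 0 <= m by apply: (avs_ge0 p0 p1) => v; exact: sqr_ge0.
have [h|h] := leP (expR Lam * i) (Num.sqrt m).
  have := @ent_ge_norm s F w (expR Lam) m (expR_gt0 _) erefl.
  rewrite expRK -/i => E.
  have h2 : expR Lam * Num.sqrt m * i <= m.
    by rewrite mulrAC -[leRHS]sqr_sqrtr // expr2 ler_wpM2r // ?sqrtr_ge0.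
  have : 0 <= Lam * (expR (2 * Lam) * i ^+ 2).
    by rewrite mulr_ge0 // mulr_ge0 ?expR_ge0 ?sqr_ge0.
  lra.
have := ent_ge0 s F w.
suff : Lam * m <= Lam * (expR (2 * Lam) * i ^+ 2) by lra.
rewrite ler_wpM2l // mulr_natl mulr2n expRD -expr2 -exprMn -[leLHS]sqr_sqrtr //.
by rewrite lerXn2r ?nnegrE ?sqrtr_ge0 ?mulr_ge0 ?expR_ge0 // ltW.
Qed.

Definition influence_cost (bad : pred I) (Lam : R) s F w e : R :=
  if bad e then p * (1 - p) * avs s (fun v => dif e F v ^+ 2) w
  else expR (2 * Lam) * (2 * (p * (1 - p)) * avs s (fun v => `|dif e F v|) w) ^+ 2.

Lemma influence_cost_av bad Lam e s F w f : f != e ->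
  influence_cost bad Lam s (av e F) w f <= influence_cost bad Lam (e :: s) F w f.
Proof.
move=> fe; rewrite /influence_cost dif_av_comm //; case: ifP => _ /=.
  rewrite ler_wpM2l // (le_avs p0 p1) // => v; exact: sqr_av.
rewrite ler_wpM2l ?expR_ge0 // lerXn2r ?nnegrE ?mulr_ge0 //.
- by apply: (avs_ge0 p0 p1).
- by apply: (avs_ge0 p0 p1) => v; apply: (@avs_ge0 _ _ _ p0 p1 [:: e]).
rewrite ler_wpM2l ?mulr_ge0 // (le_avs p0 p1) // => v.
exact: (ler_norm_avs p0 p1 [:: e]).
Qed.

Theorem talagrand (bad : pred I) (Lam : R) s F w : 0 <= Lam -> uniq s ->
  Lam * var s F w <=
  energy s F w + Lam * \sum_(e <- s) influence_cost bad Lam s F w e.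
Proof.
move=> Lam0; elim: s F => [|e s IH] F /=.
  by rewrite /var /energy /= !big_nil subrr !mulr0 addr0.
move=> /andP[es us]; rewrite var_cons mulrDr big_cons mulrDr.
have cost_le : Lam * (\sum_(f <- s) influence_cost bad Lam s (av e F) w f) <=
    Lam * \sum_(f <- s) influence_cost bad Lam (e :: s) F w f.
  rewrite ler_wpM2l // !big_seq; apply: ler_sum => f fs.
  by apply: influence_cost_av; apply: contraNneq es => <-.
have IHF := IH (av e F) us.
have [bade|good] := boolP (bad e).
  rewrite {1}/influence_cost bade /= (av_dif_comp p (fun x => x ^+ 2)).
  suff : energy s (av e F) w <= energy (e :: s) F w by lra.
  rewrite /energy big_cons -[leLHS]add0r lerD ?le_energy_av //.
  by apply: (avs_ge0 p0 p1) => v; exact: sqr_ge0.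
rewrite {1}/influence_cost (negbTE good) /= (av_dif_comp p (fun x => `|x|)).
pose d v := F v - av e F v.
have dif_d : dif e d = dif e F.
  by apply/funext => v; rewrite /dif /d /av !upd_same; ring.
have d2 : avs (e :: s) (fun v => d v ^+ 2) w =
    p * (1 - p) * avs s (fun v => dif e F v ^+ 2) w.
  rewrite -avsZ /=; congr (avs s _ w); apply/funext => v.
  by rewrite /dif /d /av !upd_same; ring.
have d1 : avs (e :: s) (fun v => `|d v|) w =
    2 * (p * (1 - p)) * avs s (fun v => `|dif e F v|) w.
  rewrite -avsZ /=; congr (avs s _ w); apply/funext => v.
  rewrite {1}/av /d /av !upd_same -/(av e).
  set x := F _; set y := F _.
  have -> : x - (p * x + (1 - p) * y) = (1 - p) * (x - y) by ring.
  have -> : y - (p * x + (1 - p) * y) = - (p * (x - y)) by ring.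
  rewrite normrN !normrM (ger0_norm p0) (ger0_norm q0) /dif -/x -/y; ring.
have := @second_moment_le (e :: s) d w Lam Lam0; rewrite d2 d1.
have us' : uniq (e :: s) by rewrite /= es.
have := @log_sobolev_norm (e :: s) d w us'.
have -> : energy (e :: s) d w = energy (e :: s) F w - energy s (av e F) w.
  rewrite /energy !big_cons dif_d -addrA; congr (_ + _).
  rewrite -sumrB !big_seq; apply: eq_bigr => f fs.
  have fe : f != e by apply: contraNneq es => <-.
  rewrite /= -avsB; congr (avs s _ w); apply/funext => v.
  rewrite dif_av_comm //.
  have -> : dif f d = fun v => dif f F v - av e (dif f F) v.
    apply/funext => u; rewrite -dif_av_comm // /dif /d; ring.
  by rewrite /av !upd_same; ring.
by lra.
Qed.

Section Gaussian.
Variables (X : (I -> bool) -> R) (s : seq I) (v B : R).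
Hypothesis (pgt0 : 0 < p).
Hypothesis (us : uniq s).
Hypothesis (X0 : forall w, 0 <= X w <= B).
Hypothesis dif_le0 : forall w e, dif e X w <= 0.
Hypothesis dif_le : forall w, \sum_(e <- s | w e) dif e X w ^+ 2 <= v.

Let M (l : R) w := avs s (fun u => expR (- l * X u)) w.

Lemma energy_exp_le (l : R) w : 0 <= l ->
  energy s (fun u => expR (- (l / 2) * X u)) w <= l ^+ 2 * v / (4 * p) * M l w.
Proof.
move=> l0; set g := fun u => _.
have g2 u : g u ^+ 2 = expR (- l * X u).
  by rewrite expr2 -expRD; congr expR; field.
have step e u : dif e g u ^+ 2 =
    p^-1 * av e (fun u => if u e then dif e g u ^+ 2 else 0) u.
  have U b : upd u e b e = b by rewrite /upd eqxx.
  rewrite /av /= !U /dif !upd_same mulr0 addr0.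
  by rewrite mulrA mulVf ?mul1r // gt_eqF.
have dif_g e (u : I -> bool) : u e -> dif e g u ^+ 2 <= (l / 2) ^+ 2 * (g u ^+ 2 * dif e X u ^+ 2).
  move=> ue; have uE : upd u e true = u by rewrite -[in RHS](upd_id u e) ue.
  have D0 := dif_le0 u e; rewrite /dif uE /= in D0 *.
  set x := X u in D0 *; set y := X _ in D0 *.
  rewrite /g -/x -/y.
  have -> : expR (- (l / 2) * y) = expR (- (l / 2) * x) * expR (l / 2 * (x - y)).
    by rewrite -expRD; congr expR; field.
  have h := expR_ge1Dx (l / 2 * (x - y)).
  have t0 : l / 2 * (x - y) <= 0 by rewrite mulr_ge0_le0 // divr_ge0.
  have h1 : expR (l / 2 * (x - y)) <= 1 by rewrite -[leRHS]expR0 ler_expR.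
  set E := expR (- (l / 2) * x); set z := expR _ in h h1 *.
  have -> : (E - E * z) ^+ 2 = E ^+ 2 * (1 - z) ^+ 2 by ring.
  have -> : (l / 2) ^+ 2 * (E ^+ 2 * (x - y) ^+ 2) = E ^+ 2 * (l / 2 * (x - y)) ^+ 2 by ring.
  rewrite ler_wpM2l ?sqr_ge0 // -(sqrrN (l / 2 * _)) lerXn2r ?nnegrE //; lra.
apply: (@le_trans _ _ (p^-1 * avs s (fun u => \sum_(e <- s | u e) dif e g u ^+ 2) w)).
  rewrite /energy; under [X in _ <= _ * avs _ X _]eq_fun do rewrite big_mkcond.
  rewrite avs_sum mulr_sumr !big_seq; apply: ler_sum => e es.
  rewrite -avsZ.
  have -> : avs s (fun u => dif e g u ^+ 2) w =
     avs s (av e (fun u => p^-1 * (if u e then dif e g u ^+ 2 else 0))) w.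
    by congr (avs s _ w); apply/funext => u; rewrite avZ -step.
  by rewrite avs_abs.
have -> : l ^+ 2 * v / (4 * p) * M l w = p^-1 * avs s (fun u => (l / 2) ^+ 2 * v * g u ^+ 2) w.
  rewrite avsZ /M; under [X in _ = _ * (_ * avs _ X _)]eq_fun do rewrite g2.
  by field; rewrite gt_eqF.
rewrite ler_wpM2l ?invr_ge0 // (le_avs p0 p1) // => u.
apply: (@le_trans _ _ (\sum_(e <- s | u e) (l / 2) ^+ 2 * (g u ^+ 2 * dif e X u ^+ 2))).
  by apply: ler_sum => e; exact: dif_g.
rewrite -mulr_sumr -mulr_sumr -mulrA ler_wpM2l ?sqr_ge0 // mulrC ler_wpM2r ?sqr_ge0 //.
Qed.

Let M_gt0 l w : 0 < M l w.
Proof.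
have h : forall u, expR (- `|l| * B) <= expR (- l * X u).
  move=> u; have /andP[x0 xB] := X0 u.
  rewrite ler_expR !mulNr lerN2 (le_trans (ler_norm _)) // normrM.
  by rewrite (ger0_norm x0) ler_wpM2l.
apply: lt_le_trans (le_avs p0 p1 s h w); rewrite avsC; exact: expR_gt0.
Qed.

(* The entropy of g^2 for g = exp (- l X / 2) compares M l with (M (l/2))^2. *)
Lemma laplace_halving (l : R) w : 0 <= l ->
  M l w <= M (l / 2) w ^+ 2 * expR (v / (2 * p) * l ^+ 2).
Proof.
move=> l0; set g := fun u => expR (- (l / 2) * X u).
have g2 : (fun u => g u ^+ 2) = (fun u => expR (- l * X u)).
  by apply/funext => u; rewrite expr2 -expRD; congr expR; field.
have m0 := M_gt0 l w; have m20 := M_gt0 (l / 2) w.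
have r0 : 0 < Num.sqrt (M l w) by rewrite sqrtr_gt0.
have mE : M l w = avs s (fun u => g u ^+ 2) w by rewrite g2.
have c0 : 0 < Num.sqrt (M l w) / M (l / 2) w by rewrite divr_gt0.
have := ent_ge p0 p1 c0 (fun u => expR_ge0 (- (l / 2) * X u)) mE.
have := log_sobolev p0 p1 w us (fun u => expR_ge0 (- (l / 2) * X u)).
have := energy_exp_le w l0.
rewrite -/g -/(M (l / 2) w) => h1 h2 h3.
have rr : Num.sqrt (M l w) ^+ 2 = M l w by rewrite sqr_sqrtr // ltW.
have E0 : Num.sqrt (M l w) / M (l / 2) w * Num.sqrt (M l w) * M (l / 2) w = M l w.
  rewrite -[RHS]rr; field; exact: lt0r_neq0.
have E1 : avs s (fun u : I -> bool => expR (- (l / 2) * X u)) w = M (l / 2) w by [].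
rewrite ?E1 E0 subrr mulr0 addr0 in h3.
have h4 : 2 * M l w * ln (Num.sqrt (M l w) / M (l / 2) w) <= 2 * (l ^+ 2 * v / (4 * p) * M l w).
  by apply: le_trans h3 (le_trans h2 _); rewrite ler_wpM2l.
have h5 : 2 * ln (Num.sqrt (M l w) / M (l / 2) w) <= v / (2 * p) * l ^+ 2.
  rewrite -(ler_pM2l m0).
  have -> : M l w * (v / (2 * p) * l ^+ 2) = 2 * (l ^+ 2 * v / (4 * p) * M l w).
    by field; rewrite gt_eqF.
  by apply: le_trans h4; lra.
have M2 : M (l / 2) w ^+ 2 = expR (2 * ln (M (l / 2) w)).
  by rewrite mulr_natl mulr2n expRD lnK ?posrE.
rewrite M2 -expRD -[leLHS](@lnK _ (M l w)) ?posrE // ler_expR.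
have := h5; rewrite ln_div ?posrE //.
have -> : ln (M l w) = 2 * ln (Num.sqrt (M l w)).
  by rewrite -{1}rr lnXn // mulr_natl.
lra.
Qed.

Lemma laplace_iter (k : nat) (l : R) w : 0 <= l ->
  M l w <= M (l / 2 ^+ k) w ^+ (2 ^ k) * expR (v / p * l ^+ 2).
Proof.
have v0 : 0 <= v.
  by apply: le_trans (dif_le w); apply: sumr_ge0 => e _; exact: sqr_ge0.
move=> l0.
suff : M l w <= M (l / 2 ^+ k) w ^+ (2 ^ k) *
    expR (v / p * l ^+ 2 * (1 - (2 ^+ k)^-1)).
  move/le_trans; apply; rewrite ler_wpM2l ?exprn_ge0 ?(ltW (M_gt0 _ _)) // ler_expR.
  by rewrite ler_piMr ?mulr_ge0 ?sqr_ge0 ?invr_ge0 // lerBlDr lerDl invr_ge0 ?exprn_ge0.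
elim: k l l0 => [|k IH] l l0.
  by rewrite expr0 divr1 expn0 expr1 invr1 subrr mulr0 expR0 mulr1.
apply: le_trans (laplace_halving w l0) _.
have l20 : 0 <= l / 2 by rewrite divr_ge0.
have := IH (l / 2) l20.
set a := M (l / 2) w; set N := M (l / 2 / 2 ^+ k) w; set c := expR _ => h.
have -> : M (l / 2 ^+ k.+1) w = N by rewrite /N exprS invfM mulrA.
have h2 : a ^+ 2 <= (N ^+ (2 ^ k) * c) ^+ 2.
  by rewrite lerXn2r ?nnegrE ?(ltW (M_gt0 _ _)) // mulr_ge0 ?expR_ge0 ?exprn_ge0 ?(ltW (M_gt0 _ _)).
apply: le_trans (ler_wpM2r (expR_ge0 _) h2) _.
have -> : (N ^+ (2 ^ k) * c) ^+ 2 = N ^+ (2 ^ k.+1) * c ^+ 2.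
  by rewrite exprMn -exprM -expnSr.
rewrite -(mulrA (N ^+ _)) ler_wpM2l ?exprn_ge0 ?(ltW (M_gt0 _ _)) //.
rewrite /c (expr2 (expR _)) -!expRD ler_expR (exprS 2 k) le_eqVlt; apply/orP; left; apply/eqP.
have : (2 : R) ^+ k != 0 by rewrite expf_neq0 ?pnatr_eq0.
by move=> h0; field; rewrite h0 gt_eqF.
Qed.

Theorem laplace_le (l : R) w : 0 <= l ->
  M l w <= expR (- l * avs s X w + v / p * l ^+ 2).
Proof.
move=> l0.
have key (k : nat) : M l w <= expR (- l * avs s X w + v / p * l ^+ 2 + l ^+ 2 * B ^+ 2 / 2 ^+ k).
  apply: le_trans (laplace_iter k w l0) _.
  set mu := l / 2 ^+ k.
  have k0 : (2 : R) ^+ k != 0 by rewrite expf_neq0 ?pnatr_eq0.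
  have mu0 : 0 <= mu by rewrite divr_ge0 // exprn_ge0.
  have hM : M mu w <= expR (- mu * avs s X w + mu ^+ 2 * B ^+ 2).
    apply: (@le_trans _ _ (1 + (- mu * avs s X w + mu ^+ 2 * B ^+ 2))); last exact: expR_ge1Dx.
    apply: (@le_trans _ _ (avs s (fun u => 1 + ((- mu) * X u + mu ^+ 2 * B ^+ 2)) w)); last first.
      by rewrite !avsD (avsZ p s (- mu) X) !avsC.
    apply: (le_avs p0 p1) => u; have /andP[x0 xB] := X0 u.
    have t0 : 0 <= mu * X u by rewrite mulr_ge0.
    have tB : (mu * X u) ^+ 2 <= mu ^+ 2 * B ^+ 2.
      rewrite -exprMn; apply: lerXn2r; rewrite ?nnegrE //.
        by rewrite mulr_ge0 // (le_trans x0 xB).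
      exact: ler_wpM2l.
    rewrite mulNr; set t := mu * X u in t0 tB *.
    have h := expR_ge1Dx t.
    have : expR (- t) <= (1 + t)^-1.
      rewrite expRN lef_pV2 ?posrE //; last by rewrite ltr_wpDr.
      exact: expR_gt0.
    move/le_trans; apply.
    rewrite -[leLHS]mul1r ler_pdivrMr; last by rewrite ltr_wpDr.
    nra.
  have : M mu w ^+ (2 ^ k) <= expR (- l * avs s X w + l ^+ 2 * B ^+ 2 / 2 ^+ k).
    have -> : - l * avs s X w + l ^+ 2 * B ^+ 2 / 2 ^+ k =
        (- mu * avs s X w + mu ^+ 2 * B ^+ 2) * (2 ^ k)%:R.
      rewrite natrX /mu; field; exact: k0.
    rewrite expRM_natr lerXn2r ?nnegrE ?expR_ge0 //; exact/ltW/M_gt0.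
  move=> h; apply: le_trans (ler_wpM2r (expR_ge0 _) h) _.
  by rewrite -expRD ler_expR; lra.
rewrite -[leLHS](@lnK _ (M l w)) ?posrE ?M_gt0 // ler_expR; apply/ler_addgt0Pr => eps eps0.
pose K := Num.bound (l ^+ 2 * B ^+ 2 / eps).
have := key K; rewrite -[leLHS](@lnK _ (M l w)) ?posrE ?M_gt0 // ler_expR.
move/le_trans; apply; rewrite lerD2l ler_pdivrMr ?exprn_gt0 //.
have : l ^+ 2 * B ^+ 2 / eps <= 2 ^+ K.
  apply: (@le_trans _ _ K%:R).
    by apply/ltW/archi_boundP; rewrite divr_ge0 ?(ltW eps0) // mulr_ge0 ?sqr_ge0.
  by rewrite -natrX ler_nat ltnW // ltn_expl.
by rewrite ler_pdivrMr // [eps * _]mulrC.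
Qed.

End Gaussian.

Lemma seq_argmin (J : eqType) (r : seq J) (f : J -> R) (j0 : J) : j0 \in r ->
  exists2 j, j \in r & forall i, i \in r -> f j <= f i.
Proof.
elim: r j0 => // i r IH j0 _; case: r IH => [|i' r] IH.
  by exists i; rewrite ?mem_head // => j; rewrite inE => /eqP ->.
have [j jr jm] := IH i' (mem_head _ _).
have [h|h] := leP (f i) (f j).
  exists i; rewrite ?mem_head // => k; rewrite inE => /orP[/eqP -> //|/jm].
  exact: le_trans.
exists j; first by rewrite inE jr orbT.
by move=> k; rewrite inE => /orP[/eqP ->|/jm //]; exact: ltW.
Qed.

Lemma exists_mean_le (J : eqType) (r : seq J) (Y : J -> (I -> bool) -> R) X s
    (v B l : R) w :
  0 < p -> 0 < l -> uniq s ->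
  (forall j u, j \in r -> 0 <= Y j u <= B) ->
  (forall j u e, j \in r -> dif e (Y j) u <= 0) ->
  (forall j u, j \in r -> \sum_(e <- s | u e) dif e (Y j) u ^+ 2 <= v) ->
  avs s (fun u => expR (- l * X u)) w <=
    \sum_(j <- r) avs s (fun u => expR (- l * Y j u)) w ->
  exists2 j, j \in r &
    avs s (Y j) w <= avs s X w + ln (size r)%:R / l + v / p * l.
Proof.
move=> pgt0 l0 us YB Yd Yv XY; pose A := avs s X w.
have hX : expR (- l * A) <= avs s (fun u => expR (- l * X u)) w.
  have : avs s (fun u => expR (- l * A) * (1 + (- l * X u + l * A))) w
     <= avs s (fun u => expR (- l * X u)) w.
    apply: (le_avs p0 p1) => u.
    apply: le_trans (ler_wpM2l (expR_ge0 _) (expR_ge1Dx _)) _.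
    by rewrite -expRD ler_expR; lra.
  by rewrite avsZ !avsD (avsZ p s (- l) X) !avsC mulNr addNr addr0 mulr1.
have [j0 j0r] : exists j0, j0 \in r.
  case: r XY {YB Yd Yv} => [|j0 r _]; last by exists j0; exact: mem_head.
  rewrite big_nil => XY.
  by have := lt_le_trans (expR_gt0 _) (le_trans hX XY); rewrite ltxx.
have [j jr jm] := seq_argmin (fun j => avs s (Y j) w) j0r.
exists j => //; set Aj := avs s (Y j) w in jm *.
have r0 : (0 < size r)%N by case: (r) jr.
have : expR (- l * A) <= expR (ln (size r)%:R + (- l * Aj + v / p * l ^+ 2)).
  apply: le_trans (le_trans hX XY) _.
  apply: (@le_trans _ _ (\sum_(i <- r) expR (- l * Aj + v / p * l ^+ 2))).
    rewrite !big_seq; apply: ler_sum => i ir.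
    apply: le_trans (laplace_le pgt0 us (fun u => YB i u ir) (fun u e => Yd i u e ir)
      (fun u => Yv i u ir) w (ltW l0)) _.
    by rewrite ler_expR lerD2r !mulNr lerN2 ler_pM2l // jm.
  rewrite expRD lnK ?posrE ?ltr0n // big_const_seq count_predT iter_addr_0.
  by rewrite mulr_natl.
rewrite ler_expR => h; rewrite -(ler_pM2l l0) !mulrDr -/A.
have -> : l * (ln (size r)%:R / l) = ln (size r)%:R by field; rewrite gt_eqF.
lra.
Qed.
End Concentration.

Lemma ler_sum_subset (R : numDomainType) (J : eqType) (s1 s2 : seq J) (F : J -> R) :
  uniq s1 -> {subset s1 <= s2} -> (forall j, 0 <= F j) ->
  \sum_(j <- s1) F j <= \sum_(j <- s2) F j.
Proof.
move=> us1 s12 F0; elim: s1 s2 us1 s12 => [|j s1 IH] s2 /=.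
  by rewrite big_nil sumr_ge0.
move=> /andP[js1 us1] s12; have js2 := s12 j (mem_head _ _).
rewrite big_cons (perm_big _ (perm_to_rem js2)) big_cons lerD2l IH //.
move=> i is1; apply: rem_mem; first by apply: contraNneq js1 => <-.
by apply: s12; rewrite inE is1 orbT.
Qed.

(** * Minimal cuts *)

Section MinCut.
Variables (R : realType) (V : Type) (I : eqType) (src tgt : I -> V) (a b : R).
Hypotheses (a0 : 0 < a) (ab : a < b).
Implicit Types (S : V -> bool) (w : I -> bool) (L : seq I) (ok : (V -> bool) -> Prop).

Definition cutb S e := S (src e) != S (tgt e).

Definition tau w e : R := if w e then a else b.

Definition cost L w S : R := \sum_(e <- L | cutb S e) tau w e.

Definition ncut L S : nat := count (cutb S) L.

Definition opt L ok w : V -> bool :=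
  xget (fun=> false) [set S | ok S /\ forall S', ok S' -> cost L w S <= cost L w S'].

Definition mincut L ok w : R := cost L w (opt L ok w).

Lemma tau_ge w e : a <= tau w e.
Proof. by rewrite /tau; case: ifP => // _; exact: ltW. Qed.

Lemma tau_le w e : tau w e <= b.
Proof. by rewrite /tau; case: ifP => // _; exact: ltW. Qed.

Lemma tau_ge0 w e : 0 <= tau w e.
Proof. exact: le_trans (ltW a0) (tau_ge _ _). Qed.

Lemma cost_ge0 L w S : 0 <= cost L w S.
Proof. by apply: sumr_ge0 => e _; exact: tau_ge0. Qed.

Lemma natr_count (P : pred I) L : (count P L)%:R = \sum_(e <- L | P e) (1 : R).
Proof. by rewrite -sum1_count natr_sum. Qed.

Lemma cost_ge_ncut L w S : a * (ncut L S)%:R <= cost L w S.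
Proof.
rewrite natr_count mulr_sumr; apply: ler_sum => e _.
by rewrite mulr1 tau_ge.
Qed.

Lemma cost_le_ncut L w S : cost L w S <= b * (ncut L S)%:R.
Proof.
rewrite natr_count mulr_sumr; apply: ler_sum => e _.
by rewrite mulr1 tau_le.
Qed.

Lemma opt_exists L ok w : (exists S, ok S) ->
  exists S, ok S /\ forall S', ok S' -> cost L w S <= cost L w S'.
Proof.
move=> [S0 okS0].
pose c (m : bitseq) := \sum_(e <- mask m L) tau w e.
have costE S : cost L w S = c (map (cutb S) L) by rewrite /c -filter_mask big_filter.
pose r := [seq m <- map val (enum {: (size L).-tuple bool}) |
  `[< exists2 S, ok S & map (cutb S) L = m >]].
have inr S : ok S -> map (cutb S) L \in r.
  move=> okS; rewrite mem_filter; apply/andP; split; first by apply/asboolP; exists S.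
  have sz : size (map (cutb S) L) == size L by rewrite size_map.
  by apply/mapP; exists (Tuple sz); rewrite ?mem_enum.
have [m mr mmin] := seq_argmin c (inr _ okS0).
move: mr; rewrite mem_filter => /andP[/asboolP[S okS SE] _].
exists S; split=> // S' /inr /mmin.
by rewrite !costE SE.
Qed.

Lemma opt_spec L ok w : (exists S, ok S) ->
  ok (opt L ok w) /\ forall S', ok S' -> mincut L ok w <= cost L w S'.
Proof. by move=> /(opt_exists L w) ex; exact: (xgetPex (fun=> false) ex). Qed.

Section Fixed.
Variables (L : seq I) (ok : (V -> bool) -> Prop) (S0 : V -> bool).
Hypotheses (uL : uniq L) (okS0 : ok S0).

Let ex : exists S, ok S. Proof. by exists S0. Qed.

Lemma opt_ok w : ok (opt L ok w). Proof. by have [] := opt_spec L w ex. Qed.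

Lemma mincut_le w S : ok S -> mincut L ok w <= cost L w S.
Proof. by have [_] := opt_spec L w ex; apply. Qed.

Lemma mincut_ge0 w : 0 <= mincut L ok w. Proof. exact: cost_ge0. Qed.

Lemma mincut_le_ncut w : mincut L ok w <= b * (ncut L S0)%:R.
Proof. exact: le_trans (mincut_le w okS0) (cost_le_ncut _ _ _). Qed.

Lemma ncut_opt_le w : (ncut L (opt L ok w))%:R <= b / a * (ncut L S0)%:R.
Proof.
rewrite -(ler_pM2l a0) (le_trans (cost_ge_ncut _ w _)) //.
rewrite (le_trans (mincut_le_ncut w)) // mulrA [a * _]mulrC divfK //.
exact: lt0r_neq0.
Qed.

Lemma mincut_depends : depends L (mincut L ok).
Proof.
suff h w w' : (forall i, i \in L -> w i = w' i) -> mincut L ok w <= mincut L ok w'.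
  by move=> w w' ww'; apply/eqP; rewrite eq_le !h // => i /ww' ->.
move=> ww'; apply: le_trans (mincut_le w (opt_ok w')) _.
rewrite /mincut /cost [leLHS]big_seq_cond [leRHS]big_seq_cond; apply: ler_sum => e /andP[eL _].
by rewrite /tau ww'.
Qed.

Lemma cost_upd S w e : w e ->
  cost L (upd w e false) S = cost L w S + (b - a) * ((e \in L) && cutb S e)%:R.
Proof.
move=> we; have updE f : tau (upd w e false) f = tau w f + (b - a) * (f == e)%:R.
  rewrite /tau /upd; case: eqVneq => [->|]; last by rewrite mulr0 addr0.
  by rewrite we mulr1 addrCA subrr addr0.
rewrite /cost (eq_bigr _ (fun f _ => updE f)) big_split /= -mulr_sumr; congr (_ + _ * _).
case: (boolP (e \in L)) => eL /=; last first.
  rewrite big_seq_cond big1 // => f /andP[fL _]; case: eqP => // fe.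
  by rewrite -fe fL in eL.
rewrite big_mkcond (bigD1_seq e) //= eqxx big1 ?addr0; first by case: ifP.
by move=> f /negbTE ->; case: ifP.
Qed.

Lemma upd_true w e : w e -> upd w e true = w.
Proof. by move=> we; rewrite -[RHS](upd_id w e) we. Qed.

Lemma dif_mincut_ge w e : w e ->
  - ((b - a) * ((e \in L) && cutb (opt L ok w) e)%:R) <= dif e (mincut L ok) w.
Proof.
move=> we; rewrite /dif upd_true // lerNl opprB lerBlDl.
by rewrite (le_trans (mincut_le _ (opt_ok w))) // cost_upd.
Qed.

Lemma dif_mincut_le0 w e : dif e (mincut L ok) w <= 0.
Proof.
rewrite /dif subr_le0; set w1 := upd w e true; set w0 := upd w e false.
apply: le_trans (mincut_le w1 (opt_ok w0)) _.
have we : w1 e by rewrite /w1 /upd eqxx.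
have -> : w0 = upd w1 e false by rewrite upd_same.
rewrite /mincut cost_upd // lerDl mulr_ge0 ?ler0n // subr_ge0; exact: ltW.
Qed.

Lemma norm_dif_mincut w e : w e ->
  `|dif e (mincut L ok) w| <= (b - a) * ((e \in L) && cutb (opt L ok w) e)%:R.
Proof.
by move=> we; rewrite ler0_norm ?dif_mincut_le0 // lerNl; exact: dif_mincut_ge.
Qed.

Lemma sum_cut_le (s : seq I) S : uniq s ->
  \sum_(e <- s) ((e \in L) && cutb S e)%:R <= (ncut L S)%:R :> R.
Proof.
move=> us; rewrite natr_count -[leRHS]big_filter.
have -> : \sum_(e <- s) ((e \in L) && cutb S e)%:R =
    \sum_(e <- [seq e <- s | (e \in L) && cutb S e]) (1 : R).
  by rewrite big_filter [RHS]big_mkcond; apply: eq_bigr => e _; case: ifP.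
apply: ler_sum_subset; rewrite ?filter_uniq // => e.
by rewrite !mem_filter andbC => /andP[_ /andP[-> ->]].
Qed.

Lemma sum_sqr_dif_mincut (s : seq I) w : uniq s ->
  \sum_(e <- s | w e) dif e (mincut L ok) w ^+ 2 <=
  (b - a) ^+ 2 * (ncut L (opt L ok w))%:R.
Proof.
move=> us; apply: (@le_trans _ _ (\sum_(e <- s | w e) (b - a) ^+ 2 *
    ((e \in L) && cutb (opt L ok w) e)%:R)).
  apply: ler_sum => e we; rewrite -real_normK ?num_real //.
  have := norm_dif_mincut we; case: (_ && _); rewrite ?mulr1 ?mulr0 => h.
    by rewrite lerXn2r ?nnegrE // subr_ge0 ltW.
  have -> : `|dif e (mincut L ok) w| = 0 by apply/eqP; rewrite eq_le h normr_ge0.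
  by rewrite expr0n.
rewrite -mulr_sumr ler_wpM2l ?sqr_ge0 //.
apply: le_trans (sum_cut_le (opt L ok w) us).
rewrite [leLHS]big_mkcond; apply: ler_sum => e _; case: ifP => // _; exact: ler0n.
Qed.

End Fixed.
End MinCut.

(** * Isoperimetry in the grid *)

Section Grid.
Variable N : nat.
Implicit Types (A : seq nat -> bool) (x : seq nat).

Fixpoint pts (D : nat) : seq (seq nat) :=
  if D is D'.+1 then [seq c :: x | c <- iota 0 N, x <- pts D'] else [:: [::]].

Lemma mem_pts D x : (x \in pts D) = (size x == D) && all (fun c => c < N)%N x.
Proof.
elim: D x => [|D IH] [|c x] //=.
  by apply/negbTE/negP => /allpairsP[[? ?] [_ _ ]].
apply/allpairsP/idP => [[[c' x'] /= [c'N x'D [-> ->]]]|].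
  by move: c'N x'D; rewrite mem_iota IH eqSS => /andP[_ ->] /andP[-> ->].
rewrite eqSS => /and3P[sx cN xN]; exists (c, x).
by rewrite mem_iota IH sx xN add0n cN.
Qed.

Lemma uniq_pts D : uniq (pts D).
Proof.
elim: D => //= D IH; apply: allpairs_uniq; rewrite ?iota_uniq //.
by move=> [c x] [c' x'] _ _ [-> ->].
Qed.

Lemma size_pts D : size (pts D) = (N ^ D)%N.
Proof. by elim: D => //= D IH; rewrite size_allpairs size_iota IH expnS. Qed.

Definition vol D A : nat := count A (pts D).

Fixpoint per D A : nat :=
  if D is D'.+1 then
    (\sum_(c <- iota 0 N) per D' (fun x => A (c :: x)) +
     \sum_(x <- pts D') \sum_(c <- iota 0 N.-1) (A (c :: x) != A (c.+1 :: x)))%N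
  else 0%N.

Lemma vol_sum D A : vol D A = (\sum_(x <- pts D) A x)%N.
Proof. by rewrite /vol -sum1_count big_mkcond; apply: eq_bigr => x _; case: (A x). Qed.

Lemma volS D A : vol D.+1 A = (\sum_(c <- iota 0 N) vol D (fun x => A (c :: x)))%N.
Proof.
rewrite vol_sum /= big_allpairs_dep; apply: eq_bigr => c _.
by rewrite vol_sum.
Qed.

Lemma vol_le D A : (vol D A <= N ^ D)%N.
Proof. by rewrite -size_pts count_size. Qed.

Lemma line_le (f : nat -> bool) c c' : (c < N)%N -> (c' < N)%N ->
  (f c <= f c' + \sum_(k <- iota 0 N.-1) (f k != f k.+1))%N.
Proof.
move=> cN c'N; have [/hasP[k kN fk]|/hasPn h] :=
    boolP (has (fun k => f k != f k.+1) (iota 0 N.-1)).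
  rewrite (bigD1_seq k) ?iota_uniq //= fk.
  by case: (f c) => //; rewrite addnCA.
have fE : forall k, (k < N)%N -> f k = f 0%N.
  elim=> // k IH kN; rewrite -IH; last by lia.
  by have /negPn/eqP -> // : ~~ (f k != f k.+1) by apply: h; rewrite mem_iota; lia.
by rewrite (fE _ cN) (fE _ c'N) leq_addr.
Qed.

Definition lines D A : nat :=
  (\sum_(x <- pts D) \sum_(c <- iota 0 N.-1) (A (c :: x) != A (c.+1 :: x)))%N.

Lemma vol_slice_le D A c c' : (c < N)%N -> (c' < N)%N ->
  (vol D (fun x => A (c :: x)) <= vol D (fun x => A (c' :: x)) + lines D A)%N.
Proof.
move=> cN c'N; rewrite !vol_sum /lines -big_split /=.
by apply: leq_sum => x _; apply: (line_le (fun c => A (c :: x))).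
Qed.

Lemma vol_slice_avg D A c : (c < N)%N ->
  (N * vol D (fun x => A (c :: x)) <= vol D.+1 A + N * lines D A)%N.
Proof.
move=> cN; rewrite volS.
have : (\sum_(c' <- iota 0 N) vol D (fun x => A (c :: x)) <=
    \sum_(c' <- iota 0 N) (vol D (fun x => A (c' :: x)) + lines D A))%N.
  rewrite !big_seq; apply: leq_sum => c'; rewrite mem_iota add0n => /andP[_ c'N].
  exact: vol_slice_le.
rewrite big_split /= !big_const_seq count_predT size_iota !iter_addn_0.
by rewrite mulnC [(lines _ _ * _)%N]mulnC.
Qed.

Lemma per_lines D A :
  per D.+1 A = (\sum_(c <- iota 0 N) per D (fun x => A (c :: x)) + lines D A)%N.
Proof. by []. Qed.

Lemma poincare D A : (vol D A * (N ^ D - vol D A) <= N ^ D * N * per D A)%N.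
Proof.
elim: D A => [|D IH] A.
  by rewrite /vol /=; case: (A [::]).
set v := fun c => vol D (fun x => A (c :: x)).
have vle c : (v c <= N ^ D)%N by exact: vol_le.
have key c c' : (c < N)%N -> (c' < N)%N ->
    (v c * (N ^ D - v c') <= N ^ D * N * per D (fun x => A (c :: x)) + N ^ D * lines D A)%N.
  move=> cN c'N.
  have h1 := IH (fun x => A (c :: x)); rewrite -/(v c) in h1.
  have h2 : (v c <= v c' + lines D A)%N by exact: vol_slice_le.
  have h3 : (v c * (N ^ D - v c') <= v c * (N ^ D - v c) + v c * lines D A)%N.
    by rewrite -mulnDr leq_mul2l; apply/orP; right; have := vle c; lia.
  apply: leq_trans h3 _; apply: leq_add => //.
  by rewrite leq_mul2r vle orbT.
have E : (vol D.+1 A * (N ^ D.+1 - vol D.+1 A) =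
    \sum_(c <- iota 0 N) \sum_(c' <- iota 0 N) v c * (N ^ D - v c'))%N.
  rewrite volS big_distrl /=; apply: eq_bigr => c _.
  rewrite -big_distrr /= -/(v c); congr (_ * _)%N.
  rewrite sumnB // big_const_seq count_predT size_iota iter_addn_0.
  by rewrite expnSr.
rewrite E per_lines.
have : (\sum_(c <- iota 0 N) \sum_(c' <- iota 0 N) v c * (N ^ D - v c') <=
  \sum_(c <- iota 0 N) \sum_(c' <- iota 0 N)
    (N ^ D * N * per D (fun x => A (c :: x)) + N ^ D * lines D A))%N.
  rewrite big_seq [leqRHS]big_seq; apply: leq_sum => c; rewrite mem_iota add0n => /andP[_ cN].
  rewrite big_seq [leqRHS]big_seq; apply: leq_sum => c'; rewrite mem_iota add0n => /andP[_ c'N].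
  exact: key.
move/leq_trans; apply; apply: eq_leq.
under eq_bigr do rewrite big_const_seq count_predT size_iota iter_addn_0.
rewrite -big_distrl big_split /= -big_distrr /= big_const_seq count_predT size_iota iter_addn_0.
rewrite expnSr; ring.
Qed.

End Grid.

Section Isoperimetry.
Variables (R : realType) (N : nat).
Hypothesis N0 : (0 < N)%N.

(* Loomis-Whitney in disguise: either some slice is large, and then many lines
   in the first direction meet the set, or one argues slice by slice. *)
Lemma isoperimetry D (A : seq nat -> bool) (l : R) : 0 < l ->
  (vol N D A)%:R < l ^+ D ->
  (vol N D A)%:R * (l^-1 - D%:R / N%:R) <= (per N D A)%:R.
Proof.
move=> l0; have NR : 0 < N%:R :> R by rewrite ltr0n.
elim: D A => [|D IH] A.
  rewrite expr0 -[1]/(1%:R) ltr_nat ltnS leqn0 => /eqP ->.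
  by rewrite mul0r ler0n.
move=> vA.
have volE : (vol N D.+1 A)%:R = \sum_(c <- iota 0 N) (vol N D (fun x => A (c :: x)))%:R :> R.
  by rewrite volS natr_sum.
have perE : (per N D.+1 A)%:R = \sum_(c <- iota 0 N) (per N D (fun x => A (c :: x)))%:R
    + (lines N D A)%:R :> R.
  by rewrite per_lines natrD natr_sum.
set v := (vol N D.+1 A)%:R in vA volE *.
have v0 : 0 <= v by exact: ler0n.
have [/hasP[c]|/hasPn h] := boolP (has (fun c => l ^+ D <= (vol N D (fun x => A (c :: x)))%:R) (iota 0 N)).
  rewrite mem_iota add0n => /andP[_ cN] big_slice.
  have h1 : v / l <= (vol N D (fun x => A (c :: x)))%:R.
    rewrite ler_pdivrMr // (le_trans (ltW vA)) // exprSr ler_wpM2r // ltW //.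
  have := vol_slice_avg D A cN.
  rewrite -(ler_nat R) natrM natrD natrM -/v => h2.
  have h3 : (vol N D (fun x => A (c :: x)))%:R <= v / N%:R + (lines N D A)%:R.
    by rewrite -(ler_pM2l NR) mulrDr [N%:R * (v / _)]mulrC divfK ?gt_eqF.
  have h4 : (lines N D A)%:R <= (per N D.+1 A)%:R :> R.
    by rewrite ler_nat per_lines leq_addl.
  have h5 : v / N%:R <= v * (D.+1%:R / N%:R).
    by rewrite ler_wpM2l // ler_pdivlMr // mulVf ?gt_eqF // ler1n.
  rewrite mulrBr; lra.
rewrite perE volE -[leLHS]addr0 lerD ?ler0n // mulr_suml !big_seq.
apply: ler_sum => c cN; have := h c cN; rewrite -ltNge => /IH.
apply: le_trans; rewrite ler_wpM2l ?ler0n // lerD2l lerN2.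
by rewrite ler_wpM2r ?invr_ge0 ?ler0n // ler_nat.
Qed.

End Isoperimetry.

Section Decay.
Variable R : realType.

Lemma root_exists (D : nat) (x : R) : (0 < D)%N -> 0 <= x ->
  exists2 y : R, 0 <= y & y ^+ D = x.
Proof.
move=> D0 x0; exists (x `^ (D%:R^-1)); first exact: powR_ge0.
by rewrite -powR_mulrn ?powR_ge0 // -powRrM mulVf ?powRr1 // pnatr_eq0 -lt0n.
Qed.

Lemma subXX_le (n : nat) (x y : R) : 0 <= y -> y <= x ->
  x ^+ n - y ^+ n <= n%:R * (x - y) * x ^+ n.-1.
Proof.
move=> y0 yx; have x0 := le_trans y0 yx; elim: n => [|n IH].
  by rewrite !expr0 subrr !mul0r.
have -> : x ^+ n.+1 - y ^+ n.+1 = x * (x ^+ n - y ^+ n) + (x - y) * y ^+ n.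
  by rewrite !exprS; ring.
have h1 : (x - y) * y ^+ n <= (x - y) * x ^+ n.
  by rewrite ler_wpM2l ?subr_ge0 // lerXn2r.
have h2 := ler_wpM2l x0 IH.
have h3 : x * (n%:R * (x - y) * x ^+ n.-1) = n%:R * (x - y) * x ^+ n.
  by case: n {IH h1 h2} => [|n]; rewrite ?mul0r ?mulr0 //= exprS; ring.
by rewrite -natr1 /=; lra.
Qed.

Variables (D N L z1 : nat) (K : R) (s pr vt : nat -> nat).
Hypotheses (D0 : (0 < D)%N) (N0 : (0 < N)%N) (K1 : 1 <= K).

Definition above (z : nat) : nat :=
  (\sum_(z <= y < L.+1) pr y + \sum_(z <= y < L) vt y)%N.

Hypothesis s_step : forall z, (z < L)%N -> (s z.+1 <= s z + vt z)%N.
Hypothesis iso : forall z (l : R), (z <= L)%N -> 0 < l -> (s z)%:R < l ^+ D ->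
  (s z)%:R * (l^-1 - D%:R / N%:R) <= (pr z)%:R.
Hypothesis above_le : forall z, (z1 <= z <= L)%N -> (above z)%:R <= K * (s z)%:R.
Hypothesis small : (4 * D%:R) ^+ D * (1 + K) * (s z1)%:R <= N%:R ^+ D.

Lemma aboveS z : (z < L)%N -> above z = (above z.+1 + pr z + vt z)%N.
Proof.
move=> zL; rewrite /above.
have -> : (\sum_(z <= y < L.+1) pr y = pr z + \sum_(z.+1 <= y < L.+1) pr y)%N.
  by rewrite big_ltn // ltnS ltnW.
have -> : (\sum_(z <= y < L) vt y = vt z + \sum_(z.+1 <= y < L) vt y)%N.
  by rewrite big_ltn.
by rewrite addnACA addnC addnA.
Qed.

Lemma s_le_above z : (z1 <= z <= L)%N -> (s z + above z <= s z1 + above z1)%N.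
Proof.
elim: z => [|z IH] /andP[z1z zL].
  by move: z1z; rewrite leqn0 => /eqP <-.
move: z1z; rewrite leq_eqVlt => /orP[/eqP <- //|z1z].
have := IH; rewrite -ltnS z1z (ltnW zL) => /(_ isT).
by rewrite (aboveS zL); have := s_step zL; lia.
Qed.

Let K0 : 0 < K. Proof. exact: lt_le_trans ltr01 K1. Qed.
Let DR : 0 < D%:R :> R. Proof. by rewrite ltr0n. Qed.
Let NR : 0 < N%:R :> R. Proof. by rewrite ltr0n. Qed.
Let c : R := (4 * D%:R * K ^+ D.-1)^-1.

Let c0 : 0 < c.
Proof. by rewrite invr_gt0 !mulr_gt0 // exprn_gt0. Qed.

Let c_lt1 : c < 1.
Proof.
have h1 : 1 <= D%:R :> R by rewrite ler1n.
have h2 : 1 <= K ^+ D.-1 by rewrite exprn_ege1.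
rewrite invf_lt1; first by nra.
by rewrite !mulr_gt0 // exprn_gt0.
Qed.

Let le_expD (x y : R) : 0 <= x -> 0 <= y -> x ^+ D <= y ^+ D -> x <= y.
Proof. by move=> x0 y0; rewrite ler_pXn2r. Qed.

Let K_le : K <= K ^+ D.
Proof. by rewrite -[leLHS]expr1 ler_weXn2l. Qed.

(* Since the surface above z is at most K times the section at z, the
   isoperimetric inequality makes its D-th root decrease linearly. *)
Lemma decay_step z (X : R) : (z1 <= z < L)%N -> 0 <= X ->
  (above z)%:R <= X ^+ D -> (above z.+1)%:R <= Num.max 0 (X - c) ^+ D.
Proof.
move=> /andP[z1z zL] X0 zX.
have [V0|V0] := posnP (above z).
  have -> : above z.+1 = 0%N by have := aboveS zL; rewrite V0; clear; lia.
  by rewrite exprn_ge0 // le_max lexx.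
have z1zL : (z1 <= z <= L)%N by rewrite z1z ltnW.
have [sg sg0 sgE] := root_exists D0 (ler0n R (s z)).
have [W W0 WE] := root_exists D0 (ler0n R (above z)).
have VK := above_le z1zL.
have sz0 : 0 < (s z)%:R :> R.
  have : 0 < (above z)%:R :> R by rewrite ltr0n.
  by move=> h; have := lt_le_trans h VK; rewrite pmulr_rgt0.
have {}sg0 : 0 < sg.
  rewrite lt_def sg0 andbT; apply/eqP => sg_eq0; move: sz0.
  by rewrite -sgE sg_eq0 expr0n gtn_eqF // ltxx.
have sg_small : 4 * D%:R * sg <= N%:R.
  apply: le_expD; rewrite ?ler0n ?mulr_ge0 ?ler0n ?(ltW sg0) //.
  rewrite exprMn sgE; apply: le_trans small; rewrite -mulrA ler_wpM2l //.
  apply: (@le_trans _ _ (s z1 + above z1)%:R).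
    by rewrite ler_nat; have := s_le_above z1zL; clear; lia.
  have z1L : (z1 <= z1 <= L)%N by rewrite leqnn (leq_trans z1z) // ltnW.
  by rewrite natrD mulrDl mul1r lerD2l above_le.
have pr_ge : sg ^+ D.-1 / 4 <= (pr z)%:R.
  have h2 : (s z)%:R < (2 * sg) ^+ D.
    rewrite -sgE ltr_pXn2r ?nnegrE ?mulr_ge0 ?(ltW sg0) //; lra.
  have := iso (ltnW zL) (mulr_gt0 _ sg0) h2 => /(_ (ltr0n _ 2)).
  apply: le_trans; rewrite -sgE -{2}(prednK D0) exprS.
  have h : D%:R / N%:R <= (4 * sg)^-1.
    rewrite ler_pdivrMr // ler_pdivlMl ?mulr_gt0 //; lra.
  have -> : sg ^+ D.-1 / 4 = sg * sg ^+ D.-1 * ((2 * sg)^-1 - (4 * sg)^-1).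
    by field; rewrite gt_eqF.
  by rewrite ler_wpM2l ?lerD2l ?lerN2 // mulr_ge0 ?exprn_ge0 ?(ltW sg0).
have WK : W <= K * sg.
  apply: le_expD => //; first by rewrite mulr_ge0 ?(ltW K0) ?(ltW sg0).
  rewrite WE exprMn sgE; apply: le_trans VK _; rewrite ler_wpM2r ?ler0n //.
have WX : W <= X by apply: le_expD => //; rewrite WE.
have cW : c <= W.
  rewrite leNgt; apply/negP => Wc.
  have W1 : W < 1 by exact: lt_trans Wc c_lt1.
  have : (above z)%:R < 1 :> R by rewrite -WE exprn_ilt1 // -lt0n.
  by rewrite -[1]/(1%:R) ltr_nat ltnNge V0.
apply: (@le_trans _ _ ((W - c) ^+ D)); last first.
  apply: lerXn2r; rewrite ?nnegrE ?subr_ge0 // le_max ?lexx //.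
  by rewrite lerD2r WX orbT.
have h1 := @subXX_le D W (W - c); rewrite subr_ge0 in h1.
have {h1} := h1 cW _; rewrite lerBlDr lerDl (ltW c0) => /(_ isT).
have -> : W - (W - c) = c by ring.
have hc : D%:R * c * W ^+ D.-1 <= sg ^+ D.-1 / 4.
  have h : W ^+ D.-1 <= K ^+ D.-1 * sg ^+ D.-1.
    by rewrite -exprMn lerXn2r ?nnegrE // mulr_ge0 ?(ltW K0) ?(ltW sg0).
  have Kp : 0 < K ^+ D.-1 by rewrite exprn_gt0.
  have -> : D%:R * c = (4 * K ^+ D.-1)^-1 by rewrite /c; field; rewrite !gt_eqF.
  rewrite mulrC ler_pdivrMr ?mulr_gt0 //; lra.
have : (above z)%:R = (above z.+1)%:R + (pr z)%:R + (vt z)%:R :> R.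
  by rewrite (aboveS zL) !natrD.
by have := ler0n R (vt z); rewrite WE; lra.
Qed.

Lemma decay z : (z <= L)%N -> z1%:R + 4 * D%:R * K ^+ D * N%:R <= z%:R :> R -> above z = 0%N.
Proof.
move=> zL hz.
have z1z : (z1 <= z)%N.
  rewrite -(ler_nat R); apply: le_trans hz; rewrite lerDl !mulr_ge0 ?ler0n //.
  by rewrite exprn_ge0 ?(ltW K0).
have iter t : (z1 + t <= L)%N ->
    (above (z1 + t))%:R <= Num.max 0 (K * N%:R - c * t%:R) ^+ D.
  elim: t => [|t IH] tL.
    rewrite mulr0 subr0 max_r ?mulr_ge0 ?(ltW K0) ?ler0n // addn0 in tL *.
    apply: le_trans (above_le _) _; first by rewrite leqnn.
    rewrite exprMn ler_pM ?(ltW K0) ?ler0n //.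
    apply: le_trans small; rewrite -[leLHS]mul1r ler_wpM2r ?ler0n //.
    have h4 : 1 <= (4 * D%:R) ^+ D :> R.
      by rewrite exprn_ege1 // -natrM ler1n muln_gt0.
    apply: le_trans h4 _; rewrite ler_peMr ?lerDl ?(ltW K0) //.
  have tL' : (z1 <= z1 + t < L)%N by rewrite leq_addr -addnS.
  have X0 : 0 <= Num.max 0 (K * N%:R - c * t%:R) by rewrite le_max lexx.
  have := decay_step tL' X0 (IH _); rewrite addnS => H.
  apply: le_trans (H _) _; first by case/andP: tL' => _ /ltnW.
  have max0 (y : R) : 0 <= Num.max 0 y by rewrite le_max lexx.
  apply: lerXn2r; rewrite ?nnegrE ?max0 // ge_max max0 /=.
  case: (leP 0 (K * N%:R - c * t%:R)) => h.
    rewrite le_max -natr1; apply/orP; right; lra.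
  by rewrite le_max sub0r oppr_le0 (ltW c0).
have := iter (z - z1)%N; rewrite subnKC // => /(_ zL).
rewrite max_l; first by rewrite expr0n gtn_eqF //= lern0 => /eqP.
rewrite subr_le0 natrB // mulrBr.
have : c * (4 * D%:R * K ^+ D * N%:R) = K * N%:R.
  have Kp : 0 < K ^+ D.-1 by rewrite exprn_gt0.
  rewrite -{2}(prednK D0) exprS /c; field.
  by rewrite (gt_eqF Kp) (gt_eqF DR).
have := ler_wpM2l (ltW c0) hz; rewrite mulrDr; lra.
Qed.

End Decay.

Definition gvertex : Type := (seq nat * nat)%type.
(* ((i, x), z) is the edge from (x, z) in the i-th horizontal direction if
   i < D and in the vertical direction if i = D. *)
Definition gedge : Type := ((nat * seq nat) * nat)%type.

HB.instance Definition _ := Choice.on gedge.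

(** * Cuts of cylinders *)

Section Cylinders.
Variable D : nat.
Implicit Types (N u v z : nat) (x : seq nat) (e : gedge) (S : gvertex -> bool).

Definition gsrc e : gvertex := (e.1.2, e.2).
Definition gtgt e : gvertex :=
  if (e.1.1 < D)%N then (incr_nth e.1.2 e.1.1, e.2) else (e.1.2, e.2.+1).

Definition hcols N : seq (nat * seq nat) :=
  [seq (i, x) | i <- iota 0 D, x <- [seq x <- pts N D | ((nth 0 x i).+1 < N)%N]].

Definition edges N u v : seq gedge :=
  [seq (ix, z) | ix <- hcols N, z <- index_iota u v.+1] ++
  [seq ((D, x), z) | x <- pts N D, z <- index_iota u v].

Definition crossing N u v S : Prop :=
  forall x, x \in pts N D -> S (x, u) /\ S (x, v) = false.

Local Notation cutb := (cutb gsrc gtgt).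

Lemma mem_hcols N i x : ((i, x) \in hcols N) =
  [&& (i < D)%N, x \in pts N D & ((nth 0 x i).+1 < N)%N].
Proof.
apply/allpairsPdep/and3P => [[j [y [/= jD]]]|[iD xN xi]].
  rewrite mem_filter => /andP[yj yN] [-> ->]; split=> //.
  by move: jD; rewrite mem_iota.
by exists i, x; rewrite mem_iota mem_filter xi xN.
Qed.

Lemma mem_edges N u v i x z : (((i, x), z) \in edges N u v) =
  ((i, x) \in hcols N) && (u <= z <= v)%N ||
  [&& i == D, x \in pts N D & (u <= z < v)%N].
Proof.
rewrite mem_cat; congr orb.
  apply/allpairsP/andP => [[[ix y] /= [ixN]]|[ixN]].
    by rewrite mem_index_iota ltnS => uyv [-> ->].
  by exists ((i, x), z); rewrite mem_index_iota ltnS.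
apply/allpairsP/and3P => [[[y z'] /= [yN]]|[/eqP -> xN uzv]].
  by rewrite mem_index_iota => uzv [-> -> ->].
by exists (x, z); rewrite mem_index_iota.
Qed.

Lemma uniq_hcols N : uniq (hcols N).
Proof.
apply: allpairs_uniq_dep; rewrite ?iota_uniq //.
  by move=> i _; rewrite filter_uniq ?uniq_pts.
by move=> [i x] [j y] _ _ [-> ->].
Qed.

Lemma uniq_edges N u v : uniq (edges N u v).
Proof.
rewrite cat_uniq; apply/and3P; split.
- apply: allpairs_uniq; rewrite ?uniq_hcols ?iota_uniq //.
  by move=> [? ?] [? ?] _ _ [-> ->].
- apply/hasPn => -[[i x] z] /allpairsP[[y z'] [_ _ [-> _ _]]].
  apply/negP => /allpairsP[[[j w] z''] [/= jw _ [jD _ _]]].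
  by move: jw; rewrite -jD mem_hcols ltnn.
- apply: allpairs_uniq; rewrite ?uniq_pts ?iota_uniq //.
  by move=> [? ?] [? ?] _ _ [-> ->].
Qed.

Lemma edges_sub N u v u' v' : (u' <= u)%N -> (v <= v')%N ->
  {subset edges N u v <= edges N u' v'}.
Proof.
move=> uu vv [[i x] z]; rewrite !mem_edges => /orP[/andP[-> /andP[uz zv]]|/and3P[-> -> /andP[uz zv]]].
  by rewrite (leq_trans uu) // (leq_trans zv).
by rewrite (leq_trans uu) // (leq_trans zv) ?orbT.
Qed.

Lemma incr_pts N x i : x \in pts N D -> (i < D)%N -> ((nth 0 x i).+1 < N)%N ->
  incr_nth x i \in pts N D.
Proof.
rewrite !mem_pts => /andP[/eqP sx /allP xN] iD xi.
rewrite size_incr_nth sx iD eqxx /=; apply/(all_nthP 0) => j.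
rewrite size_incr_nth sx iD nth_incr_nth => jD.
case: eqP => [<-|_]; first by rewrite add1n.
by rewrite add0n; apply: xN; rewrite mem_nth ?sx.
Qed.

Lemma edges_pts N u v e : e \in edges N u v ->
  (gsrc e).1 \in pts N D /\ (gtgt e).1 \in pts N D.
Proof.
case: e => [[i x] z]; rewrite mem_edges mem_hcols /gsrc /gtgt /=.
move=> /orP[/andP[/and3P[iD xN xi] _]|/and3P[/eqP -> xN _]].
  by rewrite iD; split=> //=; exact: incr_pts.
by rewrite ltnn.
Qed.

Lemma vedge N u v x z : x \in pts N D -> (u <= z < v)%N ->
  ((D, x), z) \in edges N u v.
Proof. by move=> xN uz; rewrite mem_edges eqxx xN uz orbT. Qed.

Definition vlines N S z : nat := (\sum_(x <- pts N D) (S (x, z) != S (x, z.+1)))%N.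

Lemma perE N A d : (\sum_(i <- iota 0 d) \sum_(x <- pts N d | ((nth 0 x i).+1 < N)%N)
   (A x != A (incr_nth x i)))%N = per N d A.
Proof.
elim: d A => [|d IH] A; first by rewrite big_nil.
rewrite [iota _ _]/= big_cons per_lines addnC; congr addn.
  rewrite -[1%N]addn0 iotaDl big_map.
  transitivity (\sum_(i <- iota 0 d) \sum_(c <- iota 0 N)
      \sum_(x <- pts N d | ((nth 0 x i).+1 < N)%N)
        (A (c :: x) != A (c :: incr_nth x i)))%N.
    by apply: eq_bigr => i _; rewrite /= big_mkcond big_allpairs_dep /=;
      apply: eq_bigr => c _; rewrite [RHS]big_mkcond; apply: eq_bigr.
  rewrite exchange_big /=; apply: eq_bigr => c _.
  exact: (IH (fun x => A (c :: x))).
rewrite /= big_mkcond big_allpairs_dep exchange_big /=; apply: eq_bigr => x _.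
rewrite -big_mkcond /=; clear IH; case: N => [|M]; first by rewrite !big_nil.
rewrite -[M.+1]addn1 iotaD big_cat /= big_cons big_nil addn1 add0n ltnn addn0 /=.
rewrite big_seq_cond [RHS]big_seq; apply: eq_bigl => c.
by rewrite mem_iota add0n ltnS andbC; case: (c < M)%N.
Qed.

Lemma sum_hcols N S z : (\sum_(ix <- hcols N) cutb S (ix, z))%N =
  per N D (fun x => S (x, z)).
Proof.
rewrite -perE big_allpairs_dep big_seq [RHS]big_seq; apply: eq_bigr => i.
rewrite mem_iota add0n => /andP[_ iD]; rewrite big_filter; apply: eq_bigr => x _.
by rewrite /cutb /gsrc /gtgt /= iD.
Qed.

Lemma ncutE N u v S : ncut gsrc gtgt (edges N u v) S =
  (\sum_(u <= z < v.+1) per N D (fun x => S (x, z)) +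
   \sum_(u <= z < v) vlines N S z)%N.
Proof.
rewrite /ncut -sum1_count big_mkcond /= big_cat /=; congr addn.
  rewrite big_allpairs_dep exchange_big /=; apply: eq_bigr => z _; rewrite -sum_hcols.
  by apply: eq_bigr => ix _; case: cutb.
rewrite big_allpairs_dep exchange_big /=; apply: eq_bigr => z _; apply: eq_bigr => x _.
rewrite /cutb /gsrc /gtgt /= ltnn; by case: (_ != _).
Qed.

Definition flat u : gvertex -> bool := fun xz => (xz.2 <= u)%N.

Lemma crossing_flat N u v : (u < v)%N -> crossing N u v (flat u).
Proof. by move=> uv x _; rewrite /flat /= leqnn leqNgt uv. Qed.

Lemma per_const N d (c : bool) : per N d (fun=> c) = 0%N.
Proof.
elim: d => //= d IH; rewrite big1 ?add0n; last by move=> i _; exact: IH.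
by rewrite big1 // => x _; rewrite big1 // => i _; rewrite eqxx.
Qed.

Lemma ncut_flat N u v : (u < v)%N ->
  ncut gsrc gtgt (edges N u v) (flat u) = (N ^ D)%N.
Proof.
move=> uv; rewrite ncutE big1 ?add0n; last by move=> z _; rewrite /flat per_const.
rewrite big_ltn // [X in (_ + X)%N]big1_seq; last first.
  move=> z /andP[_]; rewrite mem_index_iota => /andP[uz _]; rewrite /vlines big1 // => x _.
  by rewrite /flat /= (leqNgt z u) uz (ltnNge z u) (ltnW uz).
rewrite addn0 /vlines /flat /= leqnn ltnn /=.
by rewrite sum1_size size_pts.
Qed.

End Cylinders.

Section Flow.
Variables (R : realType) (D : nat) (a b : R).
Hypotheses (a0 : 0 < a) (ab : a < b).
Implicit Types (N u v z : nat) (x : seq nat) (e : gedge) (S : gvertex -> bool)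
  (w : gedge -> bool).

Local Notation gtgt := (gtgt D).
Local Notation edges := (edges D).
Local Notation crossing := (crossing D).
Local Notation cutb := (cutb gsrc gtgt).
Local Notation cost := (cost gsrc gtgt a b).
Local Notation ncut := (ncut gsrc gtgt).

Definition flow N u v w : R := mincut gsrc gtgt a b (edges N u v) (crossing N u v) w.
Definition optcut N u v w : gvertex -> bool := opt gsrc gtgt a b (edges N u v) (crossing N u v) w.

Lemma optcut_crossing N u v w : (u < v)%N -> crossing N u v (optcut N u v w).
Proof. by move=> uv; apply: opt_ok; exact: crossing_flat. Qed.

Lemma flow_le N u v w S : crossing N u v S -> flow N u v w <= cost (edges N u v) w S.
Proof. by move=> h; apply: (mincut_le gsrc gtgt a b _ h w h). Qed.

Lemma cost_surgery (L : seq gedge) (P Q : pred gedge) w S S' :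
  (forall e, e \in L -> cutb S' e -> cutb S e && ~~ P e || Q e) ->
  cost L w S' + a * (count (fun e => cutb S e && P e) L)%:R <=
  cost L w S + b * (count Q L)%:R.
Proof.
move=> h; rewrite !natr_count !mulr_sumr /cost.
rewrite [X in X + _]big_mkcond [X in _ + X <= _]big_mkcond.
rewrite [X in _ <= X + _]big_mkcond [X in _ <= _ + X]big_mkcond -!big_split /=.
rewrite big_seq [leRHS]big_seq; apply: ler_sum => e /h/implyP.
have t1 := tau_ge ab w e; have t2 := tau_le ab w e.
have b0 : 0 < b by exact: lt_trans ab.
have key (t : R) (s s' q r : bool) : a <= t -> t <= b -> s' ==> s && ~~ q || r ->
    (if s' then t else 0) + (if s && q then a * 1 else 0) <=
    (if s then t else 0) + (if r then b * 1 else 0).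
  by case: s; case: s'; case: q; case: r => /= t1' t2' h'; have t0 := lt_le_trans a0 t1'; lra.
exact: key.
Qed.

Lemma cost_le_subset (L L' : seq gedge) w S S' : uniq L ->
  (forall e, e \in L -> cutb S e -> e \in L' /\ cutb S' e) ->
  cost L w S <= cost L' w S'.
Proof.
move=> uL h; rewrite /cost -big_filter -[leRHS]big_filter.
apply: ler_sum_subset; rewrite ?filter_uniq //; last by move=> e; exact: tau_ge0.
move=> e; rewrite !mem_filter => /andP[cS eL].
by have [-> ->] := h e eL cS.
Qed.

Lemma flow_mono N u v u' v' w : (u' <= u)%N -> (u < v)%N -> (v <= v')%N ->
  flow N u' v' w <= flow N u v w.
Proof.
move=> uu uv vv; have cS := @optcut_crossing N u v w uv.
set S := optcut N u v w in cS.
pose S' : gvertex -> bool := fun xz => (xz.2 <= u)%N || (xz.2 < v)%N && S xz.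
have cS' : crossing N u' v' S'.
  move=> x xN; rewrite /S' /= uu; split=> //.
  by rewrite leqNgt (leq_trans uv) //= ltnNge vv.
apply: le_trans (flow_le w cS') _; rewrite /flow /mincut -/(optcut N u v w) -/S.
apply: cost_le_subset; first exact: uniq_edges.
move=> [[i x] z]; rewrite !mem_edges => /orP[/andP[ix /andP[uz zv]]|/and3P[/eqP -> xN /andP[uz zv]]].
  have iD : (i < D)%N by move: ix; rewrite mem_hcols => /and3P[].
  rewrite /cutb /gsrc /gtgt /= iD /S' /=.
  case: (leqP z u) => //= zu; case: (ltnP z v) => //= zv'.
  by rewrite ix (ltnW zu) (ltnW zv').
have [hu hv] := cS x xN.
rewrite /cutb /gsrc /gtgt /= ltnn /S' /= eqxx xN /=.
case: (ltngtP z u) => [zu|zu|->].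
- by [].
- rewrite /=; case: (ltnP z v) => zv' /=; last by rewrite (ltnNge z.+1) (leq_trans zv').
  case: (ltnP z.+1 v) => zv'' /=; first by rewrite orbT.
  have -> : z.+1 = v by apply/eqP; rewrite eqn_leq zv' zv''.
  by rewrite hv orbT.
- rewrite /=; case: (ltnP u.+1 v) => uv' /=.
    by rewrite uv hu orbT.
  have E : u.+1 = v by apply/eqP; rewrite eqn_leq uv uv'.
  by rewrite hu E hv leqnn orbT.
Qed.

Definition shift (j : nat) e : gedge := (e.1, (e.2 + j)%N).

Lemma shift_inj j : injective (shift j).
Proof. by move=> [ix z] [ix' z'] [-> /addIn ->]. Qed.

Lemma mem_shift N u v j e : (shift j e \in edges N (u + j) (v + j)) = (e \in edges N u v).
Proof.
by case: e => [[i x] z]; rewrite /shift /= !mem_edges !leq_add2r ltn_add2r.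
Qed.

Lemma flow_shift N u v j w : (u < v)%N ->
  flow N (u + j) (v + j) w = flow N u v (w \o shift j).
Proof.
move=> uv; have uvj : (u + j < v + j)%N by rewrite ltn_add2r.
apply/eqP; rewrite eq_le; apply/andP; split.
  have cS := @optcut_crossing N u v (w \o shift j) uv.
  set S := optcut _ _ _ _ in cS.
  pose S' : gvertex -> bool := fun xz => S (xz.1, (xz.2 - j)%N).
  have cS' : crossing N (u + j) (v + j) S'.
    by move=> x xN; rewrite /S' /= !addnK; exact: cS.
  apply: le_trans (flow_le w cS') _; rewrite /flow /mincut -/(optcut N u v _) -/S.
  have -> : cost (edges N u v) (w \o shift j) S = cost (map (shift j) (edges N u v)) w S'.
    rewrite /cost big_map; apply: eq_bigl => -[[i x] z].
    rewrite /cutb /gsrc /gtgt /S' /=.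
    by case: ifP => _ /=; rewrite -?addSn ?addnK.
  apply: cost_le_subset; first exact: uniq_edges.
  move=> [[i x] z] eL ->; split=> //.
  have jz : (j <= z)%N.
    by move: eL; rewrite mem_edges => /orP[/andP[_]|/and3P[_ _]] /andP[h _]; lia.
  have E : ((i, x), z) = shift j ((i, x), (z - j)%N) by rewrite /shift /= subnK.
  by rewrite E map_f // -(mem_shift N u v j) -E.
have cS := @optcut_crossing N (u + j) (v + j) w uvj.
set S := optcut _ _ _ _ in cS.
pose S' : gvertex -> bool := fun xz => S (xz.1, (xz.2 + j)%N).
have cS' : crossing N u v S' by move=> x xN; exact: cS.
apply: le_trans (flow_le _ cS') _; rewrite /flow /mincut -/(optcut N _ _ _) -/S.
have -> : cost (edges N u v) (w \o shift j) S' = cost (map (shift j) (edges N u v)) w S.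
  rewrite /cost big_map; apply: eq_bigl => -[[i x] z].
  rewrite /cutb /gsrc /gtgt /S' /=.
  by case: ifP.
apply: cost_le_subset; first by rewrite map_inj_uniq ?uniq_edges //; exact: shift_inj.
by move=> e /mapP[e' e'L ->]; rewrite mem_shift.
Qed.

End Flow.

Section Extent.
Variables (R : realType) (D : nat) (a b : R).
Hypotheses (a0 : 0 < a) (ab : a < b) (D0 : (0 < D)%N).
Implicit Types (N u v z L : nat) (x : seq nat) (e : gedge) (S : gvertex -> bool)
  (w : gedge -> bool).

Local Notation gtgt := (gtgt D).
Local Notation edges := (edges D).
Local Notation crossing := (crossing D).
Local Notation cutb := (cutb gsrc gtgt).
Local Notation cost := (cost gsrc gtgt a b).
Local Notation ncut := (ncut gsrc gtgt).
Local Notation flow := (flow D a b).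
Local Notation optcut := (optcut D a b).
Let K : R := b / a.

Lemma K_ge1 : 1 <= K.
Proof. by rewrite ler_pdivlMr // mul1r ltW. Qed.

Lemma K_gt0 : 0 < K. Proof. exact: lt_le_trans ltr01 K_ge1. Qed.

Lemma vlines_count_le N L (A : seq nat -> bool) y :
  (count (fun e => [&& e.1.1 == D, e.2 == y & A e.1.2]) (edges N 0 L) <= vol N D A)%N.
Proof.
rewrite -size_filter /vol -(size_filter A) -(size_map (fun x => ((D, x), y))).
apply: uniq_leq_size; first by rewrite filter_uniq ?uniq_edges.
move=> [[i x] z']; rewrite mem_filter /= mem_edges => /andP[/and3P[/eqP -> /eqP -> Ax]].
rewrite mem_hcols ltnn /= => /and3P[_ xN _].
by apply/mapP; exists x; rewrite ?mem_filter ?Ax.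
Qed.

Lemma ncut_le_count N u v L S : (v <= L)%N ->
  (ncut (edges N u v) S <= count (fun e => cutb S e && (e \in edges N u v)) (edges N 0 L))%N.
Proof.
move=> vL; rewrite /ncut -!size_filter.
apply: uniq_leq_size; first by rewrite filter_uniq ?uniq_edges.
move=> e; rewrite !mem_filter => /andP[-> eL]; rewrite eL /=.
exact: edges_sub (leq0n u) vL e eL.
Qed.

Lemma surgery_le N L w S S' (P Q : pred gedge) n m :
  cost (edges N 0 L) w S <= cost (edges N 0 L) w S' ->
  (forall e, e \in edges N 0 L -> cutb S' e -> cutb S e && ~~ P e || Q e) ->
  (n <= count (fun e => cutb S e && P e) (edges N 0 L))%N ->
  (count Q (edges N 0 L) <= m)%N -> n%:R <= K * m%:R.
Proof.
move=> opt h hn hm; have hc := cost_surgery a0 ab w h.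
rewrite -(ler_pM2l a0); have -> : a * (K * m%:R) = b * m%:R.
  by rewrite /K; field; rewrite gt_eqF.
have b0 : 0 <= b by rewrite ltW // (lt_trans a0).
apply: (@le_trans _ _ (a * (count (fun e => cutb S e && P e) (edges N 0 L))%:R)).
  by rewrite ler_pM2l // ler_nat.
apply: (@le_trans _ _ (b * (count Q (edges N 0 L))%:R)); first by lra.
by rewrite ler_wpM2l // ler_nat.
Qed.

Lemma above_bound N L w z : (0 < z <= L)%N ->
  (ncut (edges N z L) (optcut N 0 L w))%:R <= K * (vol N D (fun x => optcut N 0 L w (x, z)))%:R.
Proof.
move=> /andP[z0 zL]; have L0 : (0 < L)%N by exact: leq_trans zL.
have cS := @optcut_crossing R D a b N 0 L w L0; set S := optcut N 0 L w in cS *.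
pose S' : gvertex -> bool := fun xy => (xy.2 < z)%N && S xy.
have cS' : crossing N 0 L S'.
  by move=> x xN; have [h1 h2] := cS x xN; rewrite /S' /= z0 h1 h2 andbF.
pose P e := e \in edges N z L.
pose Q e := [&& e.1.1 == D, e.2 == z.-1 & S (e.1.2, z)].
apply: (@surgery_le N L w S S' P Q).
- exact: flow_le.
- move=> [[i x] y]; rewrite /P /Q !mem_edges /cutb /gsrc /gtgt /S' /= => /orP[].
    move=> /andP[ix yL]; rewrite ix yL andbT /=.
    have /and3P[iD _ _] : [&& (i < D)%N, x \in pts N D & ((nth 0 x i).+1 < N)%N] by rewrite -mem_hcols.
    by rewrite iD /= (ltn_eqF iD) /= !orbF -ltnNge; case: (y < z)%N => //= ->.
  move=> /and3P[/eqP -> xN yL]; rewrite mem_hcols ltnn eqxx xN yL /= andbT.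
  case: (ltngtP y.+1 z) => [yz|yz|yz] /=.
  + by rewrite -ltnNge (ltnW yz) andbT => ->.
  + by [].
  + rewrite -yz /= eqxx ltnn /= andbT.
    by case: (S (x, y)); case: (S _).
- exact: ncut_le_count.
- exact: vlines_count_le.
Qed.

Lemma below_bound N L w z : (z < L)%N ->
  (ncut (edges N 0 z) (optcut N 0 L w))%:R <= K * (vol N D (fun x => ~~ optcut N 0 L w (x, z)))%:R.
Proof.
move=> zL; have L0 : (0 < L)%N by exact: leq_trans zL.
have cS := @optcut_crossing R D a b N 0 L w L0; set S := optcut N 0 L w in cS *.
pose S' : gvertex -> bool := fun xy => (xy.2 <= z)%N || S xy.
have cS' : crossing N 0 L S'.
  by move=> x xN; have [h1 h2] := cS x xN; rewrite /S' /= h2 leqNgt zL.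
pose P e := e \in edges N 0 z.
pose Q e := [&& e.1.1 == D, e.2 == z & ~~ S (e.1.2, z)].
apply: (@surgery_le N L w S S' P Q).
- exact: flow_le.
- move=> [[i x] y]; rewrite /P /Q !mem_edges /cutb /gsrc /gtgt /S' /= => /orP[].
    move=> /andP[ix yL]; rewrite ix /=.
    have /and3P[iD _ _] : [&& (i < D)%N, x \in pts N D & ((nth 0 x i).+1 < N)%N] by rewrite -mem_hcols.
    by rewrite iD /= (ltn_eqF iD) /= !orbF; case: (y <= z)%N => //= ->.
  move=> /and3P[/eqP -> xN yL]; rewrite mem_hcols ltnn eqxx xN /=.
  case: (ltngtP y z) => [yz|yz|->] /=.
  + by [].
  + by rewrite orbF andbT.
  + by rewrite andbT; case: (S (x, z)); case: (S _).
- exact: ncut_le_count (ltnW zL).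
- exact: (vlines_count_le _ _ (fun x => ~~ S (x, z))).
Qed.

Definition vchange N (T : nat -> seq nat -> bool) z : nat :=
  (\sum_(x <- pts N D) (T z x != T z.+1 x))%N.

Lemma vol_step N (A B : seq nat -> bool) :
  (vol N D A <= vol N D B + \sum_(x <- pts N D) (B x != A x))%N.
Proof.
rewrite !vol_sum -big_split; apply: leq_sum => x _ /=.
by case: (A x); case: (B x).
Qed.

Lemma freeze N (T : nat -> seq nat -> bool) L z1 : (0 < N)%N ->
  (forall z, (z1 <= z <= L)%N ->
     (above L (fun z => per N D (T z)) (vchange N T) z)%:R <= K * (vol N D (T z))%:R) ->
  (4 * D%:R) ^+ D * (1 + K) * (vol N D (T z1))%:R <= N%:R ^+ D ->
  forall z, (z <= L)%N -> z1%:R + 4 * D%:R * K ^+ D * N%:R <= z%:R :> R ->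
  forall x, x \in pts N D -> T z x = T L x.
Proof.
move=> N0 hK small z zL hz x xN.
have step y : (y < L)%N -> (vol N D (T y.+1) <= vol N D (T y) + vchange N T y)%N.
  by move=> _; exact: vol_step.
have iso y (l : R) : (y <= L)%N -> 0 < l -> (vol N D (T y))%:R < l ^+ D ->
    (vol N D (T y))%:R * (l^-1 - D%:R / N%:R) <= (per N D (T y))%:R.
  by move=> _; exact: isoperimetry.
have /eqP := decay D0 N0 K_ge1 step iso hK small zL hz.
rewrite /above addn_eq0 => /andP[_]; rewrite sum_nat_seq_eq0 => /allP h.
have {}h y : (z <= y < L)%N -> T y x = T y.+1 x.
  rewrite -mem_index_iota => /h /=; rewrite /vchange sum_nat_seq_eq0 => /allP/(_ x xN) /=.
  by case: (T y x =P T y.+1 x).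
have {}h k : (z + k <= L)%N -> T z x = T (z + k)%N x.
  elim: k => [|k IH] kL; first by rewrite addn0.
  rewrite IH; last by lia.
  by rewrite h ?addnS //; lia.
by have := h (L - z)%N; rewrite subnKC //; apply.
Qed.

Lemma above_rev L (pr vt : nat -> nat) k : (k <= L)%N ->
  above L (fun y => pr (L - y)%N) (fun y => vt (L - y.+1)%N) (L - k) =
  (\sum_(0 <= y < k.+1) pr y + \sum_(0 <= y < k) vt y)%N.
Proof.
elim: k => [|k IH] kL.
  by rewrite /above subn0 !big_nat1 subnn !big_geq.
have kL' : (L - k.+1 < L)%N by lia.
rewrite (aboveS _ _ kL') subnSK // IH ?(ltnW kL) //.
have -> : (\sum_(0 <= y < k.+2) pr y = \sum_(0 <= y < k.+1) pr y + pr k.+1)%N.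
  by rewrite big_nat_recr.
have -> : (\sum_(0 <= y < k.+1) vt y = \sum_(0 <= y < k) vt y + vt k)%N.
  by rewrite big_nat_recr.
by rewrite subKn // subKn ?(ltnW kL) //; lia.
Qed.

Lemma vol_neg N A : vol N D (fun x => ~~ A x) = (N ^ D - vol N D A)%N.
Proof.
rewrite -(size_pts N D) /vol -(count_predC A) addnC addnK.
by apply: eq_count.
Qed.

Lemma per_neg N d A : per N d (fun x => ~~ A x) = per N d A.
Proof.
elim: d A => //= d IH A; congr (_ + _)%N; first by apply: eq_bigr => c _; exact: IH.
by apply: eq_bigr => x _; apply: eq_bigr => c _; case: (A _); case: (A _).
Qed.

Let eps : R := ((4 * D%:R) ^+ D * (1 + K))^-1.

Let eps0 : 0 < eps.
Proof.
by rewrite invr_gt0 mulr_gt0 ?exprn_gt0 ?mulr_gt0 ?ltr0n // addr_gt0 ?ltr01 ?K_gt0.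
Qed.

Let eps_half : eps <= 1 / 2.
Proof.
rewrite div1r lef_pV2 ?posrE ?ltr0n //; last by rewrite -invr_gt0.
have h1 : 1 <= (4 * D%:R) ^+ D :> R by rewrite exprn_ege1 // -natrM ler1n muln_gt0.
have h2 := K_ge1; nra.
Qed.

Definition c1 : nat := (Num.truncn (4 * D%:R * K ^+ D)).+1.
Definition c2 : nat := (Num.truncn (2 * K / eps)).+1.
Definition ch : nat := (c1 + c1 + c2 + 1)%N.

Lemma c1P : 4 * D%:R * K ^+ D <= c1%:R.
Proof. by rewrite ltW // truncnS_gt. Qed.

Lemma c2P : 2 * K / eps <= c2%:R.
Proof. by rewrite ltW // truncnS_gt. Qed.

Lemma level_set N L w : (0 < N)%N -> (0 < L)%N ->
  let S := optcut N 0 L w in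
  exists z2 z1, [/\ (z2 < z1 <= L)%N, (z1 <= z2 + c2 * N + 1)%N,
    (vol N D (fun x => S (x, z1)))%:R <= eps * N%:R ^+ D &
    (vol N D (fun x => ~~ S (x, z2)))%:R <= eps * N%:R ^+ D].
Proof.
move=> N0 L0 S; have cS : crossing N 0 L S by exact: optcut_crossing.
have NR : 0 < N%:R :> R by rewrite ltr0n.
pose s z := vol N D (fun x => S (x, z)).
have sL : s L = 0%N.
  rewrite /s vol_sum big1_seq // => x /andP[_ xN].
  by have [_ ->] := cS x xN.
have s0 : s 0%N = (N ^ D)%N.
  rewrite /s /vol -[RHS](size_pts N D); apply/eqP; rewrite -all_count.
  by apply/allP => x xN; have [] := cS x xN.
have ND0 : 0 < N%:R ^+ D :> R by rewrite exprn_gt0.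
pose lo z := (s z)%:R <= eps * N%:R ^+ D.
have exlo : exists z, lo z.
  by exists L; rewrite /lo sL mulr_ge0 ?(ltW eps0) ?(ltW ND0).
have [z1 z1lo z1min] := ex_minnP exlo.
have z1L : (z1 <= L)%N by apply: z1min; rewrite /lo sL mulr_ge0 ?(ltW eps0) ?(ltW ND0).
pose hi z := (z < z1)%N && ((vol N D (fun x => ~~ S (x, z)))%:R <= eps * N%:R ^+ D).
have z10 : (0 < z1)%N.
  rewrite lt0n; apply: contraTneq z1lo => ->; rewrite /lo s0 natrX -ltNge.
  rewrite gtr_pMl //; have := eps_half; lra.
have exhi : exists z, hi z.
  by exists 0%N; rewrite /hi z10 vol_neg -/(s 0) s0 subnn mulr_ge0 ?(ltW eps0) ?(ltW ND0).
have hib z : hi z -> (z <= z1)%N by move=> /andP[/ltnW].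
have [z2 /andP[z21 z2hi] z2max] := ex_maxnP exhi hib.
exists z2, z1; split=> //; first by rewrite z21.
have mid z : (z2 < z < z1)%N -> eps / 2 * N%:R ^+ D <= N%:R * (per N D (fun x => S (x, z)))%:R.
  move=> /andP[z2z zz1].
  have h1 : eps * N%:R ^+ D < (s z)%:R.
    by rewrite ltNge; apply/negP => /z1min; rewrite leqNgt zz1.
  have h2 : eps * N%:R ^+ D < N%:R ^+ D - (s z)%:R.
    rewrite ltNge; apply/negP => h; have : hi z.
      by rewrite /hi zz1 vol_neg -/(s z) natrB ?natrX // /s vol_le.
    by move/z2max; rewrite leqNgt z2z.
  have := poincare N D (fun x => S (x, z)); rewrite -/(s z) -(ler_nat R).
  rewrite !natrM natrB ?vol_le // natrX => h3.
  have : eps / 2 * (N%:R ^+ D * N%:R ^+ D) <= (s z)%:R * (N%:R ^+ D - (s z)%:R).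
    have m1 : 0 < ((s z)%:R - eps * N%:R ^+ D) * (N%:R ^+ D - (s z)%:R - eps * N%:R ^+ D).
      by rewrite mulr_gt0 ?subr_gt0.
    have m2 : 0 <= eps * (1 / 2 - eps) * (N%:R ^+ D * N%:R ^+ D).
      by rewrite !mulr_ge0 ?subr_ge0 ?(ltW eps0) ?(ltW ND0).
    lra.
  move/le_trans => /(_ _ h3) h4.
  rewrite -(ler_pM2l ND0); lra.
rewrite leqNgt; apply/negP => far.
have tot : (ncut (edges N 0 L) S)%:R <= K * N%:R ^+ D.
  have := ncut_opt_le gsrc gtgt a0 ab (edges N 0 L) (@crossing_flat D N 0 L L0) w.
  by rewrite ncut_flat // natrX.
have : N%:R * (\sum_(z2.+1 <= z < z1) per N D (fun x => S (x, z)))%:R <= N%:R * (K * N%:R ^+ D).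
  rewrite ler_pM2l //; apply: le_trans tot; rewrite ler_nat ncutE.
  apply: leq_trans (leq_addr _ _).
  rewrite (@big_cat_nat _ _ _ z2.+1 0 L.+1) //=; last by lia.
  rewrite (@big_cat_nat _ _ _ z1 z2.+1 L.+1) //=; last by lia.
  lia.
have : \sum_(z2.+1 <= z < z1) (eps / 2 * N%:R ^+ D) <=
    N%:R * (\sum_(z2.+1 <= z < z1) per N D (fun x => S (x, z)))%:R.
  rewrite natr_sum mulr_sumr big_seq [leRHS]big_seq; apply: ler_sum => z.
  by rewrite mem_index_iota; exact: mid.
rewrite sumr_const_nat -mulr_natr => h1 h2.
have h3 := le_trans h1 h2.
have h4 : (c2 * N)%:R < (z1 - z2.+1)%:R :> R.
  by rewrite ltr_nat; move: far; clear; lia.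
have h5 := c2P; rewrite ler_pdivrMr // in h5.
have h6 : eps / 2 * N%:R ^+ D * (c2 * N)%:R < eps / 2 * N%:R ^+ D * (z1 - z2.+1)%:R.
  by rewrite ltr_pM2l // mulr_gt0 // divr_gt0.
have h7 : N%:R * (K * N%:R ^+ D) <= eps / 2 * N%:R ^+ D * (c2 * N)%:R.
  have := ler_wpM2l (ltW (mulr_gt0 NR ND0)) h5; rewrite natrM; lra.
lra.
Qed.

Lemma flow_window N L w : (0 < N)%N -> (ch * N <= L)%N ->
  exists2 u, (u + ch * N <= L)%N & flow N u (u + ch * N) w <= flow N 0 L w.
Proof.
move=> N0 hL; have L0 : (0 < L)%N by apply: leq_trans hL; rewrite muln_gt0 N0 /ch addn1.
have cS := @optcut_crossing R D a b N 0 L w L0.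
have [z2 [z1 []]] := @level_set N L w N0 L0.
set S := optcut N 0 L w in cS *; move=> /andP[z21 z1L] z12 lo hi.
have smallE (n : nat) : n%:R <= eps * N%:R ^+ D ->
    (4 * D%:R) ^+ D * (1 + K) * n%:R <= N%:R ^+ D.
  have e0 : 0 < (4 * D%:R) ^+ D * (1 + K) by rewrite -invr_gt0.
  by rewrite /eps mulrC ler_pdivlMr // mulrC.
have c1N k : (k%:R + 4 * D%:R * K ^+ D * N%:R <= (k + c1 * N)%:R :> R).
  by rewrite natrD lerD2l natrM ler_wpM2r ?ler0n ?c1P.
have up z x : (z1 + c1 * N <= z <= L)%N -> x \in pts N D -> S (x, z) = false.
  move=> /andP[z1z zL] xN; have [_ <-] := cS x xN.
  apply: (@freeze N (fun z x => S (x, z)) L z1 N0 _ (smallE _ lo) z zL _ x xN).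
    move=> y /andP[z1y yL]; have y0 : (0 < y <= L)%N by lia.
    by have := above_bound N w y0; rewrite ncutE.
  by apply: le_trans (c1N _) _; rewrite ler_nat.
have down z x : (z + c1 * N <= z2)%N -> x \in pts N D -> S (x, z) = true.
  move=> zz2 xN; have [+ _] := cS x xN.
  have z2L : (z2 <= L)%N by lia.
  pose T := fun y x => ~~ S (x, (L - y)%N).
  suff : T (L - z)%N x = T L x by rewrite /T subnn subKn; [move/negb_inj=> -> | lia].
  apply: (@freeze N T L (L - z2)%N) => //.
  - move=> y /andP[y1 yL]; have y0 : (L - y < L)%N by lia.
    have := below_bound N w y0; rewrite -/S; apply: le_trans.
    rewrite ler_nat ncutE.
    rewrite -(@above_rev L (fun z => per N D (fun x => S (x, z))) (vlines D N S)) ?leq_subr //.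
    rewrite subKn //.
    rewrite /above leq_eqVlt; apply/orP; left; apply/eqP; congr addn.
      by apply: eq_bigr => k _; rewrite per_neg.
    rewrite big_seq [RHS]big_seq; apply: eq_bigr => k; rewrite mem_index_iota => /andP[_ kL].
    rewrite /vchange /vlines; apply: eq_bigr => x' _; rewrite /T.
    by rewrite subnSK //; case: (S _); case: (S _).
  - by rewrite /T subKn //; exact: smallE.
  - lia.
  - by apply: le_trans (c1N _) _; rewrite ler_nat; lia.
pose u := minn (z2 - c1 * N) (L - ch * N).
have uL : (u + ch * N <= L)%N by rewrite /u; lia.
exists u => //.
have cut : crossing N u (u + ch * N) S.
  move=> x xN; split.
    have [h|h] := leqP (u + c1 * N) z2; first exact: down.
    have -> : u = 0%N by rewrite /u in h *; lia.
    by have [] := cS x xN.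
  have [h|h] := leqP (z1 + c1 * N) (u + ch * N); first by apply: up => //; rewrite h.
  have -> : (u + ch * N)%N = L.
    have chE : (ch * N = c1 * N + c1 * N + c2 * N + N)%N by rewrite /ch; lia.
    by rewrite /u in h *; lia.
  by have [] := cS x xN.
apply: le_trans (flow_le a b w cut) _; rewrite /flow /mincut -/(optcut N 0 L w) -/S.
apply: (cost_le_subset a0 ab); first exact: uniq_edges.
by move=> e eL; split=> //; apply: edges_sub eL.
Qed.

End Extent.

(** * Averaging over vertical translations *)

Section ShiftError.
Variables (R : realType) (I : eqType) (p : R) (L : seq I) (w0 : I -> bool).
Hypotheses (p0 : 0 <= p) (p1 : p <= 1).
Local Notation E F := (avs p L F w0).
Variables (h H j q : nat) (Vb : R).

(* The flow through [0, H] can only be improved by extending the cylinder to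
   [0, H + j] if the best window uses the last levels; by stationarity this is
   no more likely than for the shorter cylinders, and the q successive
   improvements add up to at most one fluctuation. *)
Lemma extension_error (m : nat -> nat -> (I -> bool) -> R) :
  (forall u v u' v' w, (u' <= u)%N -> (u < v)%N -> (v <= v')%N -> (v' <= H + j)%N ->
     m u' v' w <= m u v w) ->
  (forall u v w, (u + h <= v)%N -> (v <= H + j)%N ->
     exists i, [/\ (u <= i)%N, (i + h <= v)%N & m i (i + h)%N w <= m u v w]) ->
  (forall u v u' v' k, (u < v)%N -> (u' < v')%N -> (v + k <= H + j)%N -> (v' + k <= H + j)%N ->
     E (fun w => (m (u + k)%N (v + k)%N w - m (u' + k)%N (v' + k)%N w) ^+ 2) =
     E (fun w => (m u v w - m u' v' w) ^+ 2)) ->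
  (forall u v u' v', (u < v <= H + j)%N -> (u' < v' <= H + j)%N -> (v - u = v' - u')%N ->
     E (fun w => (m u v w - m u' v' w) ^+ 2) <= Vb) ->
  (0 < h)%N -> (0 < q)%N -> (h + 2 * q * j <= H)%N ->
  q%:R * E (fun w => (m 0 H w - m 0 (H + j) w) ^+ 2) <= Vb.
Proof.
move=> mono win stat varb h0 q0 hH.
have jq s : (s < q)%N -> (s * j <= q * j)%N by move=> sq; rewrite leq_mul2r (ltnW sq) orbT.
pose dl s w := m 0 (H - s * j)%N w - m 0 (H - s * j + j)%N w.
have dl0 s w : (s < q)%N -> 0 <= dl s w.
  by move=> sq; have := jq s sq => sj; rewrite subr_ge0 mono //; lia.
have step s : (s < q)%N -> E (fun w => (m 0 H w - m 0 (H + j) w) ^+ 2) <= E (fun w => dl s w ^+ 2).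
  move=> sq; have sj := jq s sq.
  have lt1 : (0 < H - s * j)%N by lia.
  have lt2 : (0 < H - s * j + j)%N by lia.
  have le1 : (H - s * j + s * j <= H + j)%N by lia.
  have le2 : (H - s * j + j + s * j <= H + j)%N by lia.
  have := stat 0%N (H - s * j)%N 0%N (H - s * j + j)%N (s * j)%N lt1 lt2 le1 le2.
  have -> : (H - s * j + j + s * j = H + j)%N by lia.
  have -> : (H - s * j + s * j = H)%N by lia.
  rewrite !add0n => <-; apply: (le_avs p0 p1) => w.
  have D1 : 0 <= m (s * j)%N H w - m (s * j)%N (H + j)%N w by rewrite subr_ge0 mono //; lia.
  have D2 : 0 <= m 0%N H w - m 0%N (H + j)%N w by rewrite subr_ge0 mono //; lia.
  rewrite lerXn2r ?nnegrE //.
  have [i [_ iH mi]] := win 0%N (H + j)%N w ltac:(lia) (leqnn _).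
  have [iH'|iH'] := leqP (i + h) H.
    have : m 0%N H w <= m i (i + h)%N w by apply: mono => //; lia.
    lra.
  have h1 : m (s * j)%N (H + j)%N w <= m i (i + h)%N w by apply: mono => //; lia.
  have h2 : m 0%N H w <= m (s * j)%N H w by apply: mono => //; lia.
  lra.
pose Y := (H - q.-1 * j)%N.
have qj : (q * j = q.-1 * j + j)%N by rewrite -[in LHS](prednK q0) mulSn addnC.
have tel w : \sum_(s < q) dl s w = m 0%N Y w - m 0%N (H + j)%N w.
  rewrite /Y; elim: (q) q0 hH {jq dl0 step Y qj} => // k IH _ kH.
  case: k IH kH => [|k] IH kH.
    by rewrite big_ord_recl big_ord0 /dl /= mul0n subn0 addr0.
  rewrite big_ord_recr /= IH //; last by lia.
  rewrite /dl /=.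
  have -> : (H - k.+1 * j + j = H - k * j)%N by lia.
  by ring.
apply: (@le_trans _ _ (E (fun w => (m 0%N Y w - m (H + j - Y)%N (H + j)%N w) ^+ 2))); last first.
  by apply: varb; rewrite ?leqnn; lia.
apply: (@le_trans _ _ (\sum_(s < q) E (fun w => dl s w ^+ 2))).
  rewrite -[q%:R]/(q%:R) mulr_natl -[X in _ *+ X](card_ord q) -sumr_const.
  by apply: ler_sum => s _; apply: step.
rewrite -avs_sum; apply: (le_avs p0 p1) => w.
apply: (@le_trans _ _ ((m 0%N Y w - m 0%N (H + j)%N w) ^+ 2)).
  rewrite -tel.
  have : forall k, (k <= q)%N -> \sum_(s < k) dl s w ^+ 2 <= (\sum_(s < k) dl s w) ^+ 2.
    elim=> [|k IH] kq; first by rewrite !big_ord0 expr0n.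
    rewrite !big_ord_recr /=; have := IH (ltnW kq).
    have : 0 <= \sum_(s < k) dl s w.
      by apply: sumr_ge0 => s _; apply: dl0; exact: ltn_trans (ltn_ord s) kq.
    have := dl0 k w kq; nra.
  exact.
have D1 : 0 <= m 0%N Y w - m 0%N (H + j)%N w by rewrite subr_ge0 mono // /Y; lia.
have D3 : m 0%N (H + j)%N w <= m (H + j - Y)%N (H + j)%N w by apply: mono => //; rewrite /Y; lia.
have [i [_ iH mi]] := win 0%N (H + j)%N w ltac:(lia) (leqnn _).
have [iY|iY] := leqP (i + h) Y.
  have : m 0%N Y w <= m i (i + h)%N w by apply: mono => //; rewrite /Y; lia.
  move=> h1; have -> : m 0%N Y w - m 0%N (H + j)%N w = 0 by lra.
  by rewrite expr0n sqr_ge0.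
have : m (H + j - Y)%N (H + j)%N w <= m i (i + h)%N w by apply: mono => //; rewrite /Y in iY *; lia.
by move=> h1; have -> : m (H + j - Y)%N (H + j)%N w = m 0%N (H + j)%N w by lra.
Qed.

Lemma shift_error (m : nat -> nat -> (I -> bool) -> R) :
  (forall u v u' v' w, (u' <= u)%N -> (u < v)%N -> (v <= v')%N -> (v' <= H + j)%N ->
     m u' v' w <= m u v w) ->
  (forall u v w, (u + h <= v)%N -> (v <= H + j)%N ->
     exists i, [/\ (u <= i)%N, (i + h <= v)%N & m i (i + h)%N w <= m u v w]) ->
  (forall u v u' v' k, (u < v)%N -> (u' < v')%N -> (v + k <= H + j)%N -> (v' + k <= H + j)%N ->
     E (fun w => (m (u + k)%N (v + k)%N w - m (u' + k)%N (v' + k)%N w) ^+ 2) =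
     E (fun w => (m u v w - m u' v' w) ^+ 2)) ->
  (forall u v u' v', (u < v <= H + j)%N -> (u' < v' <= H + j)%N -> (v - u = v' - u')%N ->
     E (fun w => (m u v w - m u' v' w) ^+ 2) <= Vb) ->
  (0 < h)%N -> (0 < q)%N -> (h + 2 * q * j <= H)%N ->
  E (fun w => (m 0 H w - m j (H + j) w) ^+ 2) <= 4 * Vb / q%:R.
Proof.
move=> mono win stat varb h0 q0 hH.
have e1 := extension_error mono win stat varb h0 q0 hH.
pose Z := (H + j)%N.
have e2 : q%:R * E (fun w => (m j (H + j)%N w - m 0%N (H + j)%N w) ^+ 2) <= Vb.
  have := @extension_error (fun u v => m (Z - v)%N (Z - u)%N) _ _ _ _ h0 q0 hH.
  rewrite /Z subn0 subnn; have -> : (H + j - H = j)%N by lia.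
  apply.
  - by move=> u v u' v' w *; apply: mono; lia.
  - move=> u v w uv vH.
    have [i [iu iv mi]] := win (Z - v)%N (Z - u)%N w ltac:(rewrite /Z; lia) ltac:(rewrite /Z; lia).
    exists (Z - (i + h))%N; rewrite /Z in iu iv mi *; split; [lia|lia|].
    have -> : (H + j - (H + j - (i + h) + h) = i)%N by lia.
    by have -> : (H + j - (H + j - (i + h)) = i + h)%N by lia.
  - move=> u v u' v' k uv uv' vk vk'.
    rewrite -(stat (Z - (v + k))%N (Z - (u + k))%N (Z - (v' + k))%N (Z - (u' + k))%N k); rewrite /Z; try lia.
    have -> : (H + j - (v + k) + k = H + j - v)%N by lia.
    have -> : (H + j - (u + k) + k = H + j - u)%N by lia.
    have -> : (H + j - (v' + k) + k = H + j - v')%N by lia.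
    by have -> : (H + j - (u' + k) + k = H + j - u')%N by lia.
  - by move=> u v u' v' *; apply: varb; rewrite /Z; lia.
have q0R : 0 < q%:R :> R by rewrite ltr0n.
rewrite ler_pdivlMr // mulrC.
apply: (@le_trans _ _ (q%:R * E (fun w => 2 * (m 0%N H w - m 0%N (H + j)%N w) ^+ 2 +
    2 * (m j (H + j)%N w - m 0%N (H + j)%N w) ^+ 2))).
  rewrite ler_pM2l //; apply: (le_avs p0 p1) => w.
  have := sqr_ge0 ((m 0%N H w - m 0%N (H + j)%N w) + (m j (H + j)%N w - m 0%N (H + j)%N w)).
  lra.
rewrite avsD !avsZ; lra.
Qed.

End ShiftError.

Section Pivotal.
Variables (R : realType) (I : eqType) (p : R).
Hypotheses (p0 : 0 <= p) (p1 : p <= 1).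

Lemma avs_true (L : seq I) e (h : R -> R) (F : (I -> bool) -> R) w : e \in L ->
  p * avs p L (fun u => h (dif e F u)) w =
  avs p L (fun u => if u e then h (dif e F u) else 0) w.
Proof.
move=> eL; rewrite -avsZ -[in RHS](avs_abs _ _ eL); congr (avs p L _ w).
apply/funext => u; rewrite /av.
have U b : upd u e b e = b by rewrite /upd eqxx.
by rewrite !U /dif !upd_same mulr0 addr0.
Qed.

Lemma dif_relabel (J : eqType) (f : J -> I) e (F : (J -> bool) -> R) w : injective f ->
  dif (f e) (fun u => F (u \o f)) w = dif e F (w \o f).
Proof.
move=> finj; rewrite /dif; congr (F _ - F _); apply/funext => i;
by rewrite /upd /= (inj_eq finj).
Qed.

Lemma dif_indep e s (F : (I -> bool) -> R) w : depends s F -> e \notin s -> dif e F w = 0.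
Proof.
move=> dF es; apply/eqP; rewrite subr_eq0; apply/eqP; apply: dF => i is_.
by rewrite /upd; case: eqP => // ie; rewrite -ie is_ in es.
Qed.

Variables (V : Type) (src tgt : I -> V) (a b : R).
Hypotheses (a0 : 0 < a) (ab : a < b).
Variables (L : seq I) (ok : (V -> bool) -> Prop) (S0 : V -> bool).
Hypotheses (uL : uniq L) (okS0 : ok S0).
Let X := mincut src tgt a b L ok.
Let c w e : R := ((e \in L) && cutb src tgt (opt src tgt a b L ok w) e)%:R.

Lemma mean_norm_dif s e w : e \in s ->
  p * avs p s (fun u => `|dif e X u|) w <= (b - a) * avs p s (fun u => c u e) w.
Proof.
move=> es; rewrite (avs_true (fun x => `|x|)) // -avsZ; apply: (le_avs p0 p1) => u.
case: ifP => ue; first exact: (norm_dif_mincut src tgt ab uL okS0 ue).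
by rewrite mulr_ge0 ?ler0n // subr_ge0 ltW.
Qed.

Lemma energy_mincut (s : seq I) (M : R) w : uniq s ->
  (forall u, (ncut src tgt L (opt src tgt a b L ok u))%:R <= M) ->
  p * energy p s X w <= (b - a) ^+ 2 * M.
Proof.
move=> us hM; rewrite /energy mulr_sumr.
apply: (@le_trans _ _ (avs p s (fun u => \sum_(e <- s | u e) dif e X u ^+ 2) w)).
  have -> : (fun u => \sum_(e <- s | u e) dif e X u ^+ 2) =
      (fun u : I -> bool => \sum_(e <- s) if u e then dif e X u ^+ 2 else 0).
    by apply/funext => u; rewrite big_mkcond.
  rewrite avs_sum big_seq [leRHS]big_seq; apply: ler_sum => e es.
  by rewrite (avs_true (fun x => x ^+ 2)).
rewrite -[leRHS](avsC p s _ w); apply: (le_avs p0 p1) => u.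
apply: le_trans (sum_sqr_dif_mincut _ _ ab uL okS0 u us) _.
by rewrite ler_wpM2l ?sqr_ge0.
Qed.

Lemma var_mincut (s : seq I) (M : R) w : uniq s ->
  (forall u, (ncut src tgt L (opt src tgt a b L ok u))%:R <= M) ->
  var p s X w <= (b - a) ^+ 2 * M.
Proof.
move=> us hM; apply: le_trans (efron_stein p0 p1 _ _ us) _.
have h := energy_mincut w us hM; rewrite mulrAC mulrC.
have e0 : 0 <= energy p s X w.
  by apply: sumr_ge0 => e _; apply: (avs_ge0 p0 p1) => u; exact: sqr_ge0.
apply: le_trans h; rewrite ler_piMl ?mulr_ge0 //; have := p0; lra.
Qed.

End Pivotal.

Section FlowStatistics.
Variables (R : realType) (D : nat) (a b p : R).
Hypotheses (a0 : 0 < a) (ab : a < b) (D0 : (0 < D)%N) (p0 : 0 <= p) (p1 : p <= 1).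
Variables (N : nat) (Lg : seq gedge) (Z : nat) (w0 : gedge -> bool).
Hypotheses (N0 : (0 < N)%N) (uLg : uniq Lg) (subLg : {subset edges D N 0 Z <= Lg}).

Local Notation edges := (edges D).
Local Notation crossing := (crossing D).
Local Notation flow := (flow D a b N).
Local Notation optcut := (optcut D a b N).
Local Notation cutb := (cutb gsrc (gtgt D)).
Local Notation ncut := (ncut gsrc (gtgt D)).
Local Notation E F := (avs p Lg F w0).
Let K : R := b / a.
Let B : R := b - a.
Let A : R := N%:R ^+ D.

Lemma B_gt0 : 0 < B. Proof. by rewrite subr_gt0. Qed.

Lemma edges_Lg u v : (v <= Z)%N -> {subset edges N u v <= Lg}.
Proof. by move=> vZ e eE; apply: subLg; exact: edges_sub eE. Qed.

Lemma flow_depends u v : (u < v)%N -> depends (edges N u v) (flow u v).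
Proof. by move=> uv; apply: mincut_depends; exact: crossing_flat uv. Qed.

Lemma ncut_optcut u v w : (u < v)%N -> (ncut (edges N u v) (optcut u v w))%:R <= K * A.
Proof.
move=> uv; have := ncut_opt_le gsrc (gtgt D) a0 ab (edges N u v) (@crossing_flat D N u v uv) w.
by rewrite ncut_flat // natrX.
Qed.

Lemma mean_shift u v k (F : (gedge -> bool) -> R) :
  depends (edges N u v) F -> (v + k <= Z)%N ->
  E (fun w => F (w \o shift k)) = E F.
Proof.
move=> dF vk; apply: (@avs_relabel_sub _ _ _ _ _ (edges N u v)) => //.
- exact: uniq_edges.
- by move=> x y _ _; exact: shift_inj.
- by apply: edges_Lg; lia.
- move=> e /mapP[e' e'E ->]; apply: (@edges_Lg (u + k) (v + k)) => //.
  by rewrite mem_shift.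
Qed.

Lemma flow_var u v : (u < v)%N -> var p Lg (flow u v) w0 <= B ^+ 2 * (K * A).
Proof.
move=> uv; apply: (var_mincut p0 p1 ab _ (@crossing_flat D N u v uv)) => //.
  exact: uniq_edges.
by move=> w; exact: ncut_optcut.
Qed.

Lemma sqr_sub_mean (F : (gedge -> bool) -> R) c :
  E (fun w => (F w - c) ^+ 2) = var p Lg F w0 + (E F - c) ^+ 2.
Proof.
have -> : (fun w => (F w - c) ^+ 2) = fun w => F w ^+ 2 + ((- (2 * c)) * F w + c ^+ 2).
  by apply/funext => w; ring.
by rewrite !avsD avsZ avsC /var; ring.
Qed.

Lemma flow_two_copies u v u' v' : (u < v <= Z)%N -> (u' < v' <= Z)%N ->
  (v - u = v' - u')%N ->
  E (fun w => (flow u v w - flow u' v' w) ^+ 2) <= 4 * (B ^+ 2 * (K * A)).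
Proof.
move=> /andP[uv vZ] /andP[uv' vZ'] eqlen.
have mean x y : (x < y)%N -> (y <= Z)%N -> E (flow x y) = E (flow 0 (y - x)).
  move=> xy yZ; rewrite -(@mean_shift 0 (y - x) x (flow 0 (y - x))); last 2 first.
  - by apply: flow_depends; rewrite subn_gt0.
  - by rewrite subnK // ltnW.
  congr (avs _ _ _ _); apply/funext => w; rewrite -flow_shift ?subn_gt0 //.
  by rewrite add0n subnK // ltnW.
pose mu := E (flow u v).
have muE : E (flow u' v') = mu by rewrite /mu (mean _ _ uv vZ) (mean _ _ uv' vZ') eqlen.
apply: (@le_trans _ _ (E (fun w => 2 * (flow u v w - mu) ^+ 2 + 2 * (flow u' v' w - mu) ^+ 2))).
  apply: (le_avs p0 p1) => w.
  have := sqr_ge0 ((flow u v w - mu) + (flow u' v' w - mu)); lra.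
rewrite avsD !avsZ !sqr_sub_mean muE subrr expr0n /= !addr0.
have := flow_var uv; have := flow_var uv'; lra.
Qed.

Lemma flow_shift_error j q H : (0 < q)%N -> (H + j <= Z)%N ->
  (ch D a b * N + 2 * q * j <= H)%N ->
  E (fun w => (flow 0 H w - flow j (H + j) w) ^+ 2) <= 16 * (B ^+ 2 * (K * A)) / q%:R.
Proof.
move=> q0 HZ hH.
have h0 : (0 < ch D a b * N)%N by rewrite muln_gt0 N0 /ch addn1.
have -> : 16 * (B ^+ 2 * (K * A)) / q%:R = 4 * (4 * (B ^+ 2 * (K * A))) / q%:R by ring.
apply: (shift_error p0 p1 _ _ _ _ h0 q0 hH).
- by move=> u v u' v' w uu uv vv _; exact: flow_mono.
- move=> u v w uv vZ.
  have hL : (ch D a b * N <= v - u)%N by lia.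
  have uv' : (0 < v - u)%N by lia.
  have [i iu fi] := flow_window a0 ab D0 (w \o shift u) N0 hL.
  exists (i + u)%N; split; [lia|lia|].
  have -> : (i + u + ch D a b * N = i + ch D a b * N + u)%N by lia.
  rewrite flow_shift //; last by lia.
  apply: le_trans fi _; rewrite -flow_shift // add0n.
  by have -> : (v - u + u = v)%N by lia.
- move=> u v u' v' k uv uv' vk vk'.
  rewrite -(@mean_shift (minn u u') (maxn v v') k
    (fun w => (flow u v w - flow u' v' w) ^+ 2)); last 2 first.
  + move=> w w' ww'; rewrite (@flow_depends u v uv w w'); last first.
      by move=> e eE; apply: ww'; apply: edges_sub eE; lia.
    rewrite (@flow_depends u' v' uv' w w') // => e eE.
    by apply: ww'; apply: edges_sub eE; lia.
  + lia.
  by congr (avs _ _ _ _); apply/funext => w; rewrite !flow_shift.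
- move=> u v u' v' /andP[uv vZ] /andP[uv' vZ'] eqlen.
  by apply: flow_two_copies; lia.
Qed.

Section Averaged.
Variables (H m q : nat).
Hypotheses (pgt0 : 0 < p) (m0 : (0 < m)%N) (q0 : (0 < q)%N).
Hypotheses (hH : (ch D a b * N + 2 * q * m <= H)%N) (HZ : (H + m <= Z)%N).

Let H0 : (0 < H)%N.
Proof. by apply: leq_trans hH; rewrite ltn_addr // muln_gt0 N0 /ch addn1. Qed.

Definition kappa (e : gedge) : R :=
  E (fun w => ((e \in edges N 0 H) && cutb (optcut 0 H w) e)%:R).

Definition colmass (c : nat * seq nat) : R := \sum_(z <- iota 0 Z.+1) kappa (c, z).

Definition Favg (w : gedge -> bool) : R := m%:R^-1 * \sum_(j < m) flow j (H + j) w.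

Lemma kappa_ge0 e : 0 <= kappa e.
Proof. by apply: (avs_ge0 p0 p1) => w; exact: ler0n. Qed.

Lemma kappa_notin e : e \notin edges N 0 H -> kappa e = 0.
Proof. by move=> /negbTE eE; rewrite /kappa eE avsC. Qed.

Lemma sum_kappa_le : \sum_(e <- edges N 0 H) kappa e <= K * A.
Proof.
rewrite /kappa -avs_sum -[leRHS](avsC p Lg _ w0); apply: (le_avs p0 p1) => w.
apply: le_trans (ncut_optcut w H0); apply: sum_cut_le; exact: uniq_edges.
Qed.

Definition kshift (e : gedge) (j : nat) : R :=
  if (j <= e.2)%N then kappa (e.1, (e.2 - j)%N) else 0.

Lemma mean_dif_shift e j : (j < m)%N -> e \in Lg ->
  p * E (fun w => `|dif e (flow j (H + j)) w|) <= B * kshift e j.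
Proof.
move=> jm eL; have B0 : 0 <= B by exact: ltW B_gt0.
have jH : (j < H + j)%N by have := H0; lia.
rewrite /kshift; case: ifPn => je; last first.
  have eN : e \notin edges N j (H + j).
    case: e je {eL} => [[i x] z] /= je; rewrite mem_edges.
    by apply/negP => /orP[/andP[_]|/and3P[_ _]] /andP[h _]; lia.
  rewrite mulr0; under eq_avs do rewrite (dif_indep _ (flow_depends jH) eN) normr0.
  by rewrite avsC mulr0.
pose e' : gedge := (e.1, (e.2 - j)%N).
have eE : e = shift j e' by rewrite /shift /= subnK //; case: (e).
have flowE : flow j (H + j) = fun w => flow 0 H (w \o shift j).
  by apply/funext => w; rewrite -flow_shift ?H0 // add0n.
have -> : E (fun w => `|dif e (flow j (H + j)) w|) = E (fun w => `|dif e' (flow 0 H) w|).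
  rewrite -(@mean_shift 0 H j (fun w => `|dif e' (flow 0 H) w|)).
  - congr (avs _ _ _ _); apply/funext => w; rewrite flowE {1}eE.
    by rewrite (dif_relabel e' (flow 0 H) w (@shift_inj j)).
  - move=> w w' ww'; congr (`|_ - _|); apply: (flow_depends H0) => i iE;
      by rewrite /upd; case: eqP => // _; exact: ww'.
  - by have := HZ; lia.
have [eN|eN] := boolP (e' \in edges N 0 H); last first.
  under eq_avs do rewrite (dif_indep _ (flow_depends H0) eN) normr0.
  by rewrite avsC mulr0 mulr_ge0 // kappa_ge0.
apply: (mean_norm_dif p0 p1 gsrc (gtgt D) ab (@uniq_edges D N 0 H) (@crossing_flat D N 0 H H0)).
by apply: edges_Lg eN; have := HZ; lia.
Qed.

Lemma mR0 : 0 < m%:R :> R. Proof. by rewrite ltr0n. Qed.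

Lemma dif_Favg e w : dif e Favg w = m%:R^-1 * \sum_(j < m) dif e (flow j (H + j)) w.
Proof. by rewrite /Favg /dif -mulrBr -sumrB. Qed.

Lemma mean_dif_Favg e : e \in Lg ->
  p * E (fun w => `|dif e Favg w|) <= B / m%:R * \sum_(j < m) kshift e j.
Proof.
move=> eL; apply: (@le_trans _ _ (p * (m%:R^-1 * \sum_(j < m) E (fun w => `|dif e (flow j (H + j)) w|)))).
  rewrite ler_wpM2l // -avs_sum -avsZ; apply: (le_avs p0 p1) => w.
  rewrite dif_Favg normrM ger0_norm ?invr_ge0 ?ler0n // ler_wpM2l ?invr_ge0 ?ler0n //.
  exact: ler_norm_sum.
rewrite mulrCA -[B / _]mulrC -mulrA ler_wpM2l ?invr_ge0 ?ler0n // !mulr_sumr.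
by apply: ler_sum => j _; exact: mean_dif_shift.
Qed.

Lemma kshift_col e : \sum_(j < m) kshift e j <= colmass e.1.
Proof.
rewrite -(big_mkord xpredT (kshift e)) /index_iota subn0.
pose s := [seq j <- iota 0 m | (j <= e.2)%N && (e.2 - j <= Z)%N].
have -> : \sum_(j <- iota 0 m) kshift e j = \sum_(y <- map (fun j => (e.2 - j)%N) s) kappa (e.1, y).
  rewrite big_map big_filter [RHS]big_mkcond; apply: eq_bigr => j _.
  rewrite /kshift; case: ifP => //= je; case: ifPn => // jZ.
  apply: kappa_notin; case: (e) je jZ => [[i x] z] /= je jZ; rewrite mem_edges.
  by apply/negP => /orP[/andP[_]|/and3P[_ _]] /andP[_ h]; have := HZ; lia.
apply: ler_sum_subset; last by move=> y; exact: kappa_ge0.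
  rewrite map_inj_in_uniq ?filter_uniq ?iota_uniq // => x y.
  by rewrite !mem_filter => /andP[/andP[xe _] _] /andP[/andP[ye _] _]; lia.
move=> y /mapP[j]; rewrite mem_filter => /andP[/andP[_ jZ] _] ->.
by rewrite mem_iota; lia.
Qed.

Lemma sum_kshift (P : pred (nat * seq nat)) j :
  \sum_(e <- Lg | P e.1) kshift e j <= \sum_(e <- edges N 0 H | P e.1) kappa e.
Proof.
pose g (e : gedge) : gedge := (e.1, (e.2 - j)%N).
pose s := [seq e <- Lg | [&& P e.1, (j <= e.2)%N & g e \in edges N 0 H]].
have -> : \sum_(e <- Lg | P e.1) kshift e j = \sum_(e <- map g s) kappa e.
  rewrite big_map big_filter big_mkcond [RHS]big_mkcond; apply: eq_bigr => e _.
  case: ifP => //= _; rewrite /kshift; case: ifP => //= _.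
  by case: ifPn => // h; exact: kappa_notin.
rewrite -[leRHS]big_filter; apply: ler_sum_subset; last by move=> y; exact: kappa_ge0.
  rewrite map_inj_in_uniq ?filter_uniq // => -[c z] [c' z'].
  rewrite !mem_filter /g /= => /andP[/and3P[_ h _] _] /andP[/and3P[_ h' _] _] [-> hz].
  by congr (_, _); lia.
move=> y /mapP[e]; rewrite !mem_filter => /andP[/and3P[Pe _ eE] _] ->.
by rewrite eE andbT.
Qed.

Definition badmass (th : R) : R := \sum_(e <- edges N 0 H | th < colmass e.1) kappa e.

Lemma sum_mean_dif (P : pred (nat * seq nat)) :
  \sum_(e <- Lg | P e.1) p * E (fun w => `|dif e Favg w|) <=
  B * \sum_(e <- edges N 0 H | P e.1) kappa e.
Proof.
apply: (@le_trans _ _ (\sum_(e <- Lg | P e.1) B / m%:R * \sum_(j < m) kshift e j)).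
  rewrite big_seq_cond [leRHS]big_seq_cond; apply: ler_sum => e /andP[eL _].
  exact: mean_dif_Favg.
rewrite -mulr_sumr exchange_big /= -mulrA ler_wpM2l ?(ltW B_gt0) //.
rewrite ler_pdivrMl ?mR0 // mulr_natl -[X in _ *+ X](card_ord m) -sumr_const.
by apply: ler_sum => j _; exact: sum_kshift.
Qed.

Lemma norm_dif_Favg e w : `|dif e Favg w| <= B.
Proof.
have h (j : 'I_m) (v : gedge -> bool) : v e -> `|dif e (flow j (H + j)) v| <= B.
  move=> ve; have jH : (j < H + j)%N by have := H0; lia.
  have := norm_dif_mincut gsrc (gtgt D) ab (@uniq_edges D N j (H + j)) (@crossing_flat D N j _ jH) ve.
  by move/le_trans; apply; rewrite ler_piMr ?(ltW B_gt0) //; case: (_ && _).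
have -> : dif e Favg w = dif e Favg (upd w e true) by rewrite /dif !upd_same.
rewrite dif_Favg normrM ger0_norm ?invr_ge0 ?ler0n // ler_pdivrMl ?mR0 //.
apply: le_trans (ler_norm_sum _ _ _) _.
rewrite mulr_natl -[X in _ *+ X](card_ord m) -sumr_const.
by apply: ler_sum => j _; apply: h; rewrite /upd eqxx.
Qed.

Lemma mean_sqr_dif e : E (fun w => dif e Favg w ^+ 2) <= B * E (fun w => `|dif e Favg w|).
Proof.
rewrite -avsZ; apply: (le_avs p0 p1) => w.
by rewrite -real_normK ?num_real // expr2 ler_wpM2r ?normr_ge0 // norm_dif_Favg.
Qed.

Lemma energy_Favg : energy p Lg Favg w0 <= B ^+ 2 / p * (K * A).
Proof.
have h := sum_mean_dif xpredT; have hK := sum_kappa_le.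
have {hK}h : \sum_(e <- Lg) p * E (fun w => `|dif e Favg w|) <= B * (K * A).
  by apply: le_trans h _; rewrite ler_wpM2l ?(ltW B_gt0).
apply: (@le_trans _ _ (B / p * \sum_(e <- Lg) p * E (fun w => `|dif e Favg w|))).
  rewrite mulr_sumr; apply: ler_sum => e _; apply: le_trans (mean_sqr_dif e) _.
  by rewrite mulrA divfK // gt_eqF.
have Bp : 0 <= B / p by rewrite divr_ge0 ?(ltW B_gt0).
by apply: le_trans (ler_wpM2l Bp h) _; rewrite le_eqVlt; apply/orP; left; apply/eqP; ring.
Qed.

Lemma var_Favg (th Lam : R) : 0 <= th -> 0 <= Lam ->
  Lam * var p Lg Favg w0 <= B ^+ 2 / p * (K * A) +
    Lam * (4 * B ^+ 2 * expR (2 * Lam) * (th / m%:R) * (K * A) + B ^+ 2 * badmass th).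
Proof.
move=> th0 Lam0; pose bad (e : gedge) := th < colmass e.1.
have q0' : 0 <= 1 - p by rewrite subr_ge0.
have q1' : 1 - p <= 1 by rewrite lerBlDr lerDl.
have B0 := ltW B_gt0.
apply: le_trans (talagrand p0 p1 bad Favg w0 Lam0 uLg) _.
apply: lerD; first exact: energy_Favg.
rewrite ler_wpM2l // (bigID bad) /= addrC; apply: lerD; last first.
  apply: (@le_trans _ _ (B * \sum_(e <- Lg | bad e) p * E (fun w => `|dif e Favg w|))).
    rewrite mulr_sumr; apply: ler_sum => e be; rewrite /influence_cost be.
    apply: le_trans (ler_wpM2l _ (mean_sqr_dif e)) _; first by rewrite mulr_ge0.
    rewrite mulrCA ler_wpM2l // -mulrA ler_wpM2l // ler_piMl //.
    by apply: (avs_ge0 p0 p1) => w; exact: normr_ge0.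
  have := sum_mean_dif (fun c => th < colmass c).
  by rewrite expr2 -mulrA => h; rewrite ler_wpM2l.
have mth : 0 <= th / m%:R by rewrite divr_ge0 ?ler0n.
apply: (@le_trans _ _ (\sum_(e <- Lg | ~~ bad e) 4 * expR (2 * Lam) * (B * (th / m%:R)) *
    (p * E (fun w => `|dif e Favg w|)))).
  rewrite big_seq_cond [leRHS]big_seq_cond; apply: ler_sum => e /andP[eL /[dup] nb /negbTE be].
  rewrite /influence_cost be; set x := E _.
  have x0 : 0 <= x by apply: (avs_ge0 p0 p1) => w; exact: normr_ge0.
  have h1 : p * x <= B * (th / m%:R).
    apply: le_trans (mean_dif_Favg eL) _.
    have -> : B * (th / m%:R) = B / m%:R * th by ring.
    rewrite ler_wpM2l //; first by rewrite mulr_ge0 ?invr_ge0 ?ler0n.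
    by apply: le_trans (kshift_col e) _; rewrite leNgt.
  have -> : 4 * expR (2 * Lam) * (B * (th / m%:R)) * (p * x) =
      expR (2 * Lam) * (4 * (B * (th / m%:R) * (p * x))) by ring.
  rewrite ler_wpM2l ?expR_ge0 //.
  have h2 : 2 * (p * (1 - p)) * x <= 2 * (p * x).
    by rewrite -!mulrA ler_wpM2l // ler_wpM2l // ler_piMl.
  have px0 : 0 <= p * x by rewrite mulr_ge0.
  apply: (@le_trans _ _ ((2 * (p * x)) ^+ 2)).
    by rewrite lerXn2r ?nnegrE ?mulr_ge0.
  rewrite exprMn expr2 -natrM ler_wpM2l ?ler0n // expr2 ler_wpM2r //.
rewrite -mulr_sumr.
have hs : \sum_(e <- Lg | ~~ bad e) p * E (fun w => `|dif e Favg w|) <= B * (K * A).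
  apply: le_trans (sum_mean_dif (fun c => ~~ (th < colmass c))) _.
  rewrite ler_wpM2l // (le_trans _ sum_kappa_le) //.
  rewrite [leLHS]big_mkcond; apply: ler_sum => e _; case: ifP => // _; exact: kappa_ge0.
have c0 : 0 <= 4 * expR (2 * Lam) * (B * (th / m%:R)).
  by rewrite !mulr_ge0 ?expR_ge0 ?invr_ge0 ?ler0n.
apply: le_trans (ler_wpM2l c0 hs) _.
by rewrite le_eqVlt; apply/orP; left; apply/eqP; ring.
Qed.

Lemma var_sub_le (F G : (gedge -> bool) -> R) :
  var p Lg F w0 <= 2 * var p Lg G w0 + 2 * E (fun w => (F w - G w) ^+ 2).
Proof.
have EF : var p Lg F w0 <= E (fun w => (F w - E G) ^+ 2).
  by rewrite sqr_sub_mean lerDl sqr_ge0.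
have EG : var p Lg G w0 = E (fun w => (G w - E G) ^+ 2).
  by rewrite sqr_sub_mean subrr expr0n addr0.
apply: le_trans EF _; rewrite EG -!avsZ -avsD; apply: (le_avs p0 p1) => w.
have := sqr_ge0 ((F w - G w) - (G w - E G)); lra.
Qed.

Lemma var_flow_le (th Lam : R) : 0 <= th -> 0 < Lam ->
  var p Lg (flow 0 H) w0 <=
  2 * (B ^+ 2 / p * (K * A) / Lam +
    (4 * B ^+ 2 * expR (2 * Lam) * (th / m%:R) * (K * A) + B ^+ 2 * badmass th)) +
  32 * (B ^+ 2 * (K * A)) / q%:R.
Proof.
move=> th0 Lam0; apply: le_trans (var_sub_le _ Favg) _.
apply: lerD.
  rewrite ler_wpM2l // -(ler_pM2l Lam0); apply: le_trans (var_Favg th0 (ltW Lam0)) _.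
  by rewrite [leRHS]mulrDr lerD2r [leRHS]mulrC divfK // gt_eqF.
have -> : 32 * (B ^+ 2 * (K * A)) / q%:R = 2 * (16 * (B ^+ 2 * (K * A)) / q%:R) by ring.
rewrite ler_wpM2l //.
apply: (@le_trans _ _ (E (fun w => m%:R^-1 * \sum_(j < m) (flow 0 H w - flow j (H + j) w) ^+ 2))).
  apply: (le_avs p0 p1) => w.
  have -> : flow 0 H w - Favg w = m%:R^-1 * \sum_(j < m) (flow 0 H w - flow j (H + j) w).
    rewrite sumrB sumr_const card_ord mulrBr /Favg; congr (_ - _).
    by rewrite -(mulr_natr (flow 0 H w)) mulrCA mulVf ?mulr1 // gt_eqF ?mR0.
  set x := fun j : 'I_m => flow 0 H w - flow j (H + j) w.
  rewrite -(ler_pM2l (exprn_gt0 2 mR0)) -exprMn mulrA divff ?gt_eqF ?mR0 // mul1r.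
  rewrite mulrA expr2 mulfK ?gt_eqF ?mR0 // -/x.
  have : 0 <= \sum_(i < m) (m%:R * x i - \sum_(j < m) x j) ^+ 2.
    by apply: sumr_ge0 => i _; exact: sqr_ge0.
  set S := \sum_(j < m) x j.
  have -> : \sum_(i < m) (m%:R * x i - S) ^+ 2 = m%:R ^+ 2 * \sum_(i < m) x i ^+ 2 - m%:R * S ^+ 2.
    transitivity (\sum_(i < m) (m%:R ^+ 2 * x i ^+ 2 + ((- (2 * m%:R * S)) * x i + S ^+ 2))).
      by apply: eq_bigr => i _; ring.
    rewrite big_split /= -mulr_sumr big_split /= -mulr_sumr -/S sumr_const card_ord.
    by rewrite -mulr_natl; ring.
  by rewrite subr_ge0 [m%:R ^+ 2]expr2 -mulrA ler_pM2l ?mR0.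
rewrite avsZ ler_pdivrMl ?mR0 // avs_sum; set c := 16 * _ / _.
have -> : m%:R * c = \sum_(j < m) c by rewrite sumr_const card_ord mulr_natl.
apply: ler_sum => j _; apply: flow_shift_error => //.
  by have := HZ; have := ltn_ord j; lia.
by apply: leq_trans hH; rewrite leq_add2l leq_mul2l (ltnW (ltn_ord j)) orbT.
Qed.

End Averaged.
End FlowStatistics.

(** * Gluing reflected tiles *)

Section Folding.
Local Open Scope nat_scope.
Variables (D r : nat).
Hypothesis r0 : 0 < r.
Implicit Types (t x y : seq nat) (e : gedge) (S : gvertex -> bool).

Lemma pts_nthP N x : reflect (size x = D /\ forall i, i < D -> nth 0 x i < N) (x \in pts N D).
Proof.
rewrite mem_pts; apply: (iffP andP) => [[/eqP sx /(all_nthP 0) h]|[sx h]].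
  by split=> // i iD; apply: h; rewrite sx.
by split; [exact/eqP | apply/(all_nthP 0) => i; rewrite sx; exact: h].
Qed.

Lemma seq_eqP x y : size x = D -> size y = D ->
  (forall i, i < D -> nth 0 x i = nth 0 y i) -> x = y.
Proof. by move=> sx sy h; apply: (@eq_from_nth _ 0); rewrite sx // => i /h. Qed.

(* Tiles are glued along reflections: the tile with index t receives the box
   [0, r)^D, reversed in the directions where t is odd. *)
Definition flip (k c : nat) : nat := if odd k then r.-1 - c else c.

Definition place t x := mkseq (fun i => nth 0 t i * r + flip (nth 0 t i) (nth 0 x i)) D.
Definition tile y := mkseq (fun i => nth 0 y i %/ r) D.
Definition fold y := mkseq (fun i => flip (nth 0 y i %/ r) (nth 0 y i %% r)) D.

Definition tile_vertex t (v : gvertex) : gvertex := (place t v.1, v.2).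
Definition tile_edge t e : gedge :=
  ((e.1.1, place t (if (e.1.1 < D) && odd (nth 0 t e.1.1)
     then incr_nth e.1.2 e.1.1 else e.1.2)), e.2).

Lemma flip_lt k c : c < r -> flip k c < r.
Proof. by rewrite /flip; case: odd => //; lia. Qed.

Lemma flipK k c : c < r -> flip k (flip k c) = c.
Proof. by rewrite /flip; case: odd => //; lia. Qed.

Lemma tile_pts N T y : N <= T * r -> y \in pts N D -> tile y \in pts T D.
Proof.
move=> NT /pts_nthP[sy h]; apply/pts_nthP; rewrite size_mkseq; split=> // i iD.
by rewrite nth_mkseq // ltn_divLR // (leq_trans (h _ iD)).
Qed.

Lemma fold_pts y : fold y \in pts r D.
Proof.
apply/pts_nthP; rewrite size_mkseq; split=> // i iD.
by rewrite nth_mkseq // flip_lt // ltn_pmod.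
Qed.

Lemma place_pts N T t x : T * r <= N -> t \in pts T D -> x \in pts r D -> place t x \in pts N D.
Proof.
move=> TN /pts_nthP[st ht] /pts_nthP[sx hx].
apply/pts_nthP; rewrite size_mkseq; split=> // i iD; rewrite nth_mkseq //.
have := flip_lt (nth 0 t i) (hx i iD); have := ht i iD; nia.
Qed.

Lemma tile_place t x : size t = D -> x \in pts r D -> tile (place t x) = t.
Proof.
move=> st /pts_nthP[sx hx]; apply: seq_eqP; rewrite ?size_mkseq // => i iD.
by rewrite !nth_mkseq // divnMDl // divn_small ?addn0 // flip_lt // hx.
Qed.

Lemma fold_place t x : x \in pts r D -> fold (place t x) = x.
Proof.
move=> /pts_nthP[sx hx]; apply: seq_eqP; rewrite ?size_mkseq // => i iD.
rewrite !nth_mkseq // divnMDl // modnMDl divn_small ?modn_small ?addn0 ?flip_lt ?hx //.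
by rewrite flipK // hx.
Qed.

Lemma place_fold y : size y = D -> place (tile y) (fold y) = y.
Proof.
move=> sy; apply: seq_eqP; rewrite ?size_mkseq // => i iD.
by rewrite !nth_mkseq // flipK ?ltn_pmod // -divn_eq.
Qed.

Lemma place_incr t x i : size x = D -> i < D -> (nth 0 x i).+1 < r -> ~~ odd (nth 0 t i) ->
  incr_nth (place t x) i = place t (incr_nth x i).
Proof.
move=> sx iD xi od; apply: seq_eqP; rewrite ?size_incr_nth ?size_mkseq ?iD // => k kD.
rewrite nth_incr_nth !nth_mkseq // nth_incr_nth.
by case: eqVneq => // <-; rewrite /flip (negbTE od); lia.
Qed.

Lemma place_incr_odd t x i : size x = D -> i < D -> (nth 0 x i).+1 < r -> odd (nth 0 t i) ->
  incr_nth (place t (incr_nth x i)) i = place t x.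
Proof.
move=> sx iD xi od; apply: seq_eqP; rewrite ?size_incr_nth ?size_mkseq ?iD // => k kD.
rewrite nth_incr_nth !nth_mkseq // nth_incr_nth.
by case: eqVneq => // <-; rewrite /flip od; lia.
Qed.

Lemma cutb_tile S t e u v : e \in edges D r u v ->
  cutb gsrc (gtgt D) S (tile_edge t e) = cutb gsrc (gtgt D) (S \o tile_vertex t) e.
Proof.
case: e => [[i x] z]; rewrite mem_edges mem_hcols /cutb /gsrc /gtgt /tile_edge /=.
move=> /orP[/andP[/and3P[iD /pts_nthP[sx _] xi] _]|/and3P[/eqP -> xr _]]; last by rewrite ltnn.
rewrite iD /=; case: ifPn => od /=; last by rewrite place_incr.
by rewrite place_incr_odd // eq_sym.
Qed.

Lemma tile_edge_mem N T t e u v : T * r <= N -> t \in pts T D -> e \in edges D r u v ->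
  tile_edge t e \in edges D N u v.
Proof.
case: e => [[i x] z] TN tT; rewrite !mem_edges !mem_hcols /tile_edge /=.
move=> /orP[/andP[/and3P[iD xr xi] ->]|/and3P[/eqP -> xr ->]]; last first.
  by rewrite !ltnn eqxx /= (place_pts TN).
have xr' : incr_nth x i \in pts r D by exact: incr_pts.
have /pts_nthP[st ht] := tT; have /pts_nthP[sx hx] := xr.
have pN : place t (if odd (nth 0 t i) then incr_nth x i else x) \in pts N D.
  by apply: place_pts TN tT _; case: ifP.
rewrite iD /= pN /= andbT; apply/orP; left.
have := ht i iD; have := hx i iD => h1 h2.
by rewrite nth_mkseq // /flip; case: (odd _); rewrite ?nth_incr_nth ?eqxx; nia.
Qed.

Lemma tile_edge_tile t e u v : size t = D -> e \in edges D r u v ->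
  tile (tile_edge t e).1.2 = t.
Proof.
case: e => [[i x] z] st; rewrite mem_edges mem_hcols /tile_edge /=.
move=> /orP[/andP[/and3P[iD xr xi] _]|/and3P[/eqP -> xr _]]; rewrite tile_place //.
  by case: ifP => // _; exact: incr_pts.
by rewrite ltnn.
Qed.

Lemma incr_nth_inj x y i : size x = D -> size y = D -> i < D ->
  incr_nth x i = incr_nth y i -> x = y.
Proof.
move=> sx sy iD h; apply: seq_eqP => // k kD.
have := congr1 (fun s => nth 0 s k) h; rewrite !nth_incr_nth; lia.
Qed.

Lemma tile_edge_inj t u v : {in edges D r u v &, injective (tile_edge t)}.
Proof.
have key i x z : ((i, x), z) \in edges D r u v ->
    [/\ x \in pts r D, (i < D -> incr_nth x i \in pts r D) &
      fold (tile_edge t ((i, x), z)).1.2 =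
        (if (i < D) && odd (nth 0 t i) then incr_nth x i else x)].
  rewrite mem_edges mem_hcols /tile_edge /=.
  move=> /orP[/andP[/and3P[iD xr xi] _]|/and3P[/eqP -> xr _]].
    have xr' : incr_nth x i \in pts r D by exact: incr_pts.
    by split=> //; rewrite fold_place //; case: ifP.
  by rewrite ltnn fold_place.
move=> [[i x] z] [[i' x'] z'] /key[xr xri Ex] /key[xr' xri' Ex'] E.
move: (E); rewrite /tile_edge /= => -[ii _ zz]; rewrite -{}zz in E Ex' *; rewrite -{}ii in E Ex' xri' *.
congr (_, _, _); move: Ex'; rewrite -E Ex; case: ifP => // /andP[iD _] h.
have /pts_nthP[sx _] := xr; have /pts_nthP[sx' _] := xr'.
exact: incr_nth_inj iD h.
Qed.

(* An edge of the large box either lies inside a tile or joins two points of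
   the lateral boundary of neighbouring tiles with the same folding. *)
Definition lateral x := has (fun c => (c == 0) || (c.+1 == r)) x.

Lemma edges_tiles N T u v e : N <= T * r -> e \in edges D N u v ->
  (exists t e', [/\ t \in pts T D, e' \in edges D r u v & e = tile_edge t e']) \/
  (e.1.1 < D /\ (fold (gsrc e).1 = fold (gtgt D e).1 /\ lateral (fold (gsrc e).1))).
Proof.
case: e => [[i y] z] NT; rewrite mem_edges mem_hcols /gsrc /gtgt /=.
move=> /orP[/andP[/and3P[iD yN yi] uz]|/and3P[/eqP -> yN uz]]; last first.
  left; exists (tile y), ((D, fold y), z); split; first exact: tile_pts yN.
    by rewrite mem_edges eqxx fold_pts uz orbT.
  by rewrite /tile_edge /= ltnn place_fold //; case/pts_nthP: yN.
have y'N := incr_pts yN iD yi; rewrite iD /=.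
have /pts_nthP[sy hy] := yN; have /pts_nthP[sy' hy'] := y'N.
have nth_y' k : k < D -> k != i -> nth 0 (incr_nth y i) k = nth 0 y k.
  by move=> kD ki; rewrite nth_incr_nth eq_sym (negbTE ki).
have nth_yi : nth 0 (incr_nth y i) i = (nth 0 y i).+1 by rewrite nth_incr_nth eqxx.
have dm := divn_eq (nth 0 y i) r; have ltm := ltn_pmod (nth 0 y i) r0.
set q := nth 0 y i %/ r in dm; set c := nth 0 y i %% r in dm ltm.
have [cr|cr] := ltnP c.+1 r.
  left.
  have d' : (nth 0 y i).+1 %/ r = q by rewrite dm -addnS divnMDl // divn_small ?addn0.
  have m' : (nth 0 y i).+1 %% r = c.+1 by rewrite dm -addnS modnMDl modn_small.
  have tE : tile (incr_nth y i) = tile y.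
    apply: seq_eqP; rewrite ?size_mkseq // => k kD; rewrite !nth_mkseq //.
    by have [->|ki] := eqVneq k i; rewrite ?nth_yi ?d' ?nth_y'.
  have nthq : nth 0 (tile y) i = q by rewrite nth_mkseq.
  exists (tile y); case od : (odd q).
    exists ((i, fold (incr_nth y i)), z); split; first exact: tile_pts yN.
      rewrite mem_edges mem_hcols iD fold_pts nth_mkseq // nth_yi d' m' /flip od uz andbT /=.
      by apply/orP; left; lia.
    rewrite /tile_edge /= iD nthq od /=; congr (_, _, _).
    rewrite -{1}(place_fold sy); congr place; apply: seq_eqP.
    - by rewrite size_mkseq.
    - by rewrite size_incr_nth size_mkseq iD.
    move=> k kD; rewrite nth_incr_nth !nth_mkseq //.
    have [<-|ki] := eqVneq i k; last by rewrite nth_y' // eq_sym.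
    by rewrite nth_yi d' m' /flip -/q -/c od; lia.
  exists ((i, fold y), z); split; first exact: tile_pts yN.
    rewrite mem_edges mem_hcols iD fold_pts nth_mkseq // /flip -/q -/c od uz andbT /=.
    by rewrite cr.
  by rewrite /tile_edge /= iD nthq od /= place_fold.
right; split=> //.
have cE : c = r.-1 by lia.
have d' : (nth 0 y i).+1 %/ r = q.+1.
  by rewrite dm cE -addnS prednK // -mulSnr mulnK.
have m' : (nth 0 y i).+1 %% r = 0 by rewrite dm cE -addnS prednK // -mulSnr modnMl.
split.
  apply: seq_eqP; rewrite ?size_mkseq // => k kD; rewrite !nth_mkseq //.
  have [->|ki] := eqVneq k i; last by rewrite nth_y'.
  by rewrite nth_yi d' m' -/q -/c cE /flip /=; case: (odd q) => /=; lia.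
apply/hasP; exists (nth 0 (fold y) i); first by rewrite mem_nth // size_mkseq.
by rewrite nth_mkseq // -/q -/c cE /flip; case: (odd q); rewrite ?subnn ?prednK ?eqxx ?orbT.
Qed.

End Folding.

Section Tiling.
Variables (R : realType) (D : nat) (a b : R).
Hypotheses (a0 : 0 < a) (ab : a < b).
Implicit Types (N r s T H : nat) (t x y : seq nat) (e : gedge) (S zeta : gvertex -> bool)
  (w : gedge -> bool).

Local Notation gtgt := (gtgt D).
Local Notation edges := (edges D).
Local Notation crossing := (crossing D).
Local Notation cutb := (cutb gsrc gtgt).
Local Notation cost := (cost gsrc gtgt a b).
Local Notation ncut := (ncut gsrc gtgt).
Local Notation flow := (flow D a b).
Local Notation optcut := (optcut D a b).

Definition pinned s H zeta S : Prop :=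
  crossing s 0 H S /\
  forall x z, x \in pts s D -> lateral s x -> (z <= H)%N -> S (x, z) = zeta (x, z).

Definition pflow s H zeta w : R := mincut gsrc gtgt a b (edges s 0 H) (pinned s H zeta) w.

(* Reflected copies of a cut with prescribed lateral trace match along the
   common faces of the tiles. *)
Lemma flow_le_tiles N s T H zeta S0 w : (0 < s)%N -> (N <= T * s)%N ->
  pinned s H zeta S0 ->
  flow N 0 H w <= \sum_(t <- pts T D) pflow s H zeta (w \o tile_edge D s t).
Proof.
move=> s0 NT pin0.
pose So t := opt gsrc gtgt a b (edges s 0 H) (pinned s H zeta) (w \o tile_edge D s t).
have pinS t : pinned s H zeta (So t) by exact: (opt_ok gsrc gtgt a b _ pin0).
pose S : gvertex -> bool := fun v => So (tile D s v.1) (fold D s v.1, v.2).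
have cS : crossing N 0 H S.
  move=> y yN; have [c _] := pinS (tile D s y).
  exact: c (fold_pts D s0 y).
apply: le_trans (flow_le _ _ w cS) _.
rewrite /pflow /mincut -/(So _).
rewrite /cost -big_filter.
apply: (@le_trans _ _ (\sum_(e <- [seq tile_edge D s t e | t <- pts T D,
    e <- [seq e <- edges s 0 H | cutb (So t) e]]) tau a b w e)); last first.
  by rewrite big_allpairs_dep; apply: ler_sum => t _; rewrite big_filter.
apply: ler_sum_subset; last by move=> e; exact: tau_ge0.
  by rewrite filter_uniq // uniq_edges.
move=> e; rewrite mem_filter => /andP[cut eN].
have [[t [e' [tT e'E eE]]]|[iD [foldE lat]]] := edges_tiles s0 NT eN.
  apply/allpairsPdep; exists t, e'; split=> //; rewrite mem_filter e'E andbT.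
  move: cut; rewrite eE (cutb_tile s0 S t e'E).
  have st : size t = D by case/pts_nthP: tT.
  have Sx x z : x \in pts s D -> (S \o tile_vertex D s t) (x, z) = So t (x, z).
    by move=> xs; rewrite /S /= tile_place // fold_place.
  have [h1 h2] := edges_pts e'E.
  rewrite /cutb; case: (gsrc e') h1 => x1 z1 h1; case: (gtgt e') h2 => x2 z2 h2.
  by rewrite !Sx.
exfalso; move: cut; rewrite /cutb /S.
have zE : (gtgt e).2 = (gsrc e).2 by rewrite /gtgt iD.
have zH : ((gsrc e).2 <= H)%N.
  case: (e) eN => [[i x] z]; rewrite mem_edges /gsrc /=.
  by case/orP => [/andP[_]|/and3P[_ _ /ltnW]].
have [_ l1] := pinS (tile D s (gsrc e).1); have [_ l2] := pinS (tile D s (gtgt e).1).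
rewrite zE -foldE l1 ?fold_pts // l2 ?fold_pts //.
by rewrite eqxx.
Qed.

Definition cols N : seq (nat * seq nat) := hcols D N ++ [seq (D, x) | x <- pts N D].

Lemma uniq_cols N : uniq (cols N).
Proof.
rewrite cat_uniq uniq_hcols map_inj_uniq ?uniq_pts ?andbT /=; last by move=> x y [].
apply/hasPn => c /mapP[x _ ->]; by rewrite /= mem_hcols ltnn.
Qed.

Lemma edge_col N u v e : e \in edges N u v -> e.1 \in cols N.
Proof.
case: e => [[i x] z]; rewrite mem_edges /cols mem_cat /= => /orP[/andP[-> //]|/and3P[/eqP -> xN _]].
by rewrite map_f ?orbT.
Qed.

Definition good_tile N r (bad : pred (nat * seq nat)) t :=
  ~~ has (fun c => bad c && (tile D r c.2 == t)) (cols N).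

Lemma good_tiles_count N r T bad : (0 < r)%N ->
  (T ^ D <= count (good_tile N r bad) (pts T D) + count bad (cols N))%N.
Proof.
move=> r0; rewrite -(size_pts T D) -(count_predC (good_tile N r bad)) leq_add2l.
rewrite -!size_filter -(size_map (fun c => tile D r c.2)).
apply: uniq_leq_size; first by rewrite filter_uniq ?uniq_pts.
move=> t; rewrite mem_filter /= negbK => /andP[/hasP[c cN /andP[bc /eqP <-]] _].
by apply: map_f; rewrite mem_filter bc.
Qed.

Lemma flow_ge_tiles N r T H bad w : (0 < r)%N -> (T * r <= N)%N -> (0 < H)%N ->
  \sum_(t <- pts T D | good_tile N r bad t) flow r 0 H (w \o tile_edge D r t) +
  a * (count (fun e => cutb (optcut N 0 H w) e && bad e.1) (edges N 0 H))%:R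
  <= flow N 0 H w.
Proof.
move=> r0 TN H0; have cS := @optcut_crossing R D a b N 0 H w H0.
rewrite {2}/flow /mincut -/(optcut N 0 H w); set S := optcut N 0 H w in cS *.
pose Q := [seq tile_edge D r t e | t <- [seq t <- pts T D | good_tile N r bad t],
  e <- [seq e <- edges r 0 H | cutb (S \o tile_vertex D r t) e]].
pose P := [seq e <- edges N 0 H | cutb S e && bad e.1].
apply: (@le_trans _ _ (\sum_(e <- Q ++ P) tau a b w e)).
  rewrite big_cat /=; apply: lerD.
    rewrite big_allpairs_dep big_filter big_seq_cond [leRHS]big_seq_cond.
    apply: ler_sum => t /andP[tT _]; rewrite big_filter.
    apply: (flow_le a b (w \o tile_edge D r t)) => x xr.
    by have := cS (place D r t x) (place_pts r0 TN tT xr).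
  rewrite natr_count mulr_sumr /P big_filter; apply: ler_sum => e _.
  by rewrite mulr1 tau_ge.
rewrite /cost -[leRHS]big_filter; apply: ler_sum_subset; last by move=> e; exact: tau_ge0.
  rewrite cat_uniq; apply/and3P; split.
  - apply: allpairs_uniq_dep.
    + by rewrite filter_uniq ?uniq_pts.
    + by move=> t _; rewrite filter_uniq ?uniq_edges.
    + move=> [t e] [t' e'] /allpairsPdep[t1 [e1 [h1 h2 [E1 E2]]]] /allpairsPdep[t2 [e2 [h3 h4 [E3 E4]]]] /= h.
      subst t1 e1 t2 e2; move: h1 h2 h3 h4; rewrite !mem_filter.
      move=> /andP[_ /pts_nthP[st _]] /andP[_ eE] /andP[_ /pts_nthP[st' _]] /andP[_ eE'].
      have tt' : t = t'.
        by rewrite -(tile_edge_tile r0 st eE) h (tile_edge_tile r0 st' eE').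
      subst t'; by rewrite (tile_edge_inj r0 eE eE' h).
  - apply/hasPn => e; rewrite mem_filter => /andP[/andP[_ be] eN].
    apply/negP => /allpairsPdep[t [e' [+ + eE]]]; rewrite !mem_filter.
    move=> /andP[gt /pts_nthP[st _]] /andP[_ eE'].
    move/hasPn: gt => /(_ _ (edge_col eN)); rewrite be /=.
    by rewrite eE (tile_edge_tile r0 st eE') eqxx.
  - by rewrite filter_uniq ?uniq_edges.
move=> e; rewrite mem_cat !mem_filter => /orP[/allpairsPdep[t [e' [+ + ->]]]|/andP[/andP[-> _] ->] //].
rewrite !mem_filter => /andP[_ tT] /andP[ce eE'].
by rewrite (cutb_tile r0 S t eE') ce (tile_edge_mem r0 TN tT eE').
Qed.

End Tiling.

Section Words.
Variable T : eqType.

Fixpoint words (l : seq T) (M : nat) : seq (seq T) :=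
  if M is M'.+1 then [seq c :: x | c <- l, x <- words l M'] else [:: [::]].

Lemma size_words l M : size (words l M) = (size l ^ M)%N.
Proof. by elim: M => //= M IH; rewrite size_allpairs IH expnS. Qed.

Lemma mem_words l x : all (fun c => c \in l) x -> x \in words l (size x).
Proof.
elim: x => //= c x IH /andP[cl xl].
by apply/allpairsP; exists (c, x); rewrite /= cl IH.
Qed.

End Words.

Section Trace.
Variables (R : realType) (D : nat) (a b : R).
Hypotheses (a0 : 0 < a) (ab : a < b) (D0 : (0 < D)%N).
Implicit Types (N r s T H J M : nat) (t x y : seq nat) (e : gedge) (S zeta : gvertex -> bool)
  (w : gedge -> bool) (c : seq gvertex).

Local Notation gtgt := (gtgt D).
Local Notation edges := (edges D).
Local Notation crossing := (crossing D).
Local Notation cutb := (cutb gsrc gtgt).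
Local Notation cost := (cost gsrc gtgt a b).
Local Notation ncut := (ncut gsrc gtgt).
Local Notation flow := (flow D a b).
Local Notation optcut := (optcut D a b).
Local Notation pinned := (pinned D).
Local Notation pflow := (pflow D a b).
Let K : R := b / a.

Definition inner (j : nat) x := map (addn j) x.
Definition inner_vertex j (v : gvertex) : gvertex := (inner j v.1, v.2).
Definition inner_edge j e : gedge := ((e.1.1, inner j e.1.2), e.2).

Lemma inner_pts r j x : (2 * j <= r)%N -> x \in pts (r - 2 * j) D -> inner j x \in pts r D.
Proof.
move=> jr /pts_nthP[sx h]; apply/pts_nthP; rewrite size_map; split=> // i iD.
by rewrite (nth_map 0%N) ?sx //; have := h i iD; clear -jr; lia.
Qed.

Lemma inner_incr j x i : (i < size x)%N -> incr_nth (inner j x) i = inner j (incr_nth x i).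
Proof.
move=> ix; apply: (@seq_eqP (size x)); rewrite ?size_incr_nth ?size_map ?size_incr_nth ?ix //.
move=> k kD; rewrite nth_incr_nth !(nth_map 0%N) ?size_incr_nth ?ix // nth_incr_nth.
by rewrite addnCA.
Qed.

Lemma inner_edge_inj j : injective (inner_edge j).
Proof.
by move=> [[i x] z] [[i' x'] z'] [-> /(inj_map (@addnI j)) -> ->].
Qed.

Lemma cutb_inner S j e s u v : e \in edges s u v ->
  cutb S (inner_edge j e) = cutb (S \o inner_vertex j) e.
Proof.
case: e => [[i x] z]; rewrite mem_edges mem_hcols /cutb /gsrc /gtgt /inner_edge /=.
move=> /orP[/andP[/and3P[iD /pts_nthP[sx _] _] _]|/and3P[/eqP -> _ _]]; last by rewrite ltnn.
by rewrite iD /= inner_incr ?sx.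
Qed.

Lemma inner_edge_mem r j e u v : (2 * j <= r)%N -> e \in edges (r - 2 * j) u v ->
  inner_edge j e \in edges r u v.
Proof.
case: e => [[i x] z] jr; rewrite !mem_edges !mem_hcols /inner_edge /=.
move=> /orP[/andP[/and3P[iD xr xi] ->]|/and3P[/eqP -> xr ->]]; last first.
  by rewrite ltnn eqxx (inner_pts jr xr).
have /pts_nthP[sx _] := xr.
by rewrite iD (inner_pts jr xr) (nth_map 0%N) ?sx //=; apply/orP; left; clear -xi jr; lia.
Qed.

Definition positions r H : seq gvertex := ([::], 0%N) :: [seq (x, z) | x <- pts r D, z <- iota 0 H].

Lemma size_positions r H : size (positions r H) = (r ^ D * H).+1.
Proof. by rewrite /= size_allpairs size_pts size_iota. Qed.

(* A lateral trace is encoded by the positions where it changes along the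
   vertical lines. *)
Definition trace_of c : gvertex -> bool :=
  fun v => ~~ odd (count (fun z => (v.1, z) \in c) (iota 0 v.2)).

Definition traces r H J M : seq (nat * seq gvertex) :=
  [seq jc <- [seq (j, c) | j <- iota 0 J, c <- words (positions r H) M] |
    `[< exists S, pinned (r - 2 * jc.1) H (trace_of jc.2) S /\
          (ncut (edges (r - 2 * jc.1) 0 H) S)%:R <= K * r%:R ^+ D >]].

Lemma size_traces r H J M : (size (traces r H J M) <= J * (r ^ D * H).+1 ^ M)%N.
Proof.
rewrite size_filter; apply: leq_trans (count_size _ _) _.
by rewrite size_allpairs size_iota size_words size_positions.
Qed.

Lemma trace_exists r H J M w : (0 < J)%N -> (2 * J <= r)%N -> (0 < H)%N ->
  K * r%:R ^+ D < (J * M.+1)%:R ->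
  exists2 jc, jc \in traces r H J M &
    pflow (r - 2 * jc.1) H (trace_of jc.2) (w \o inner_edge jc.1) <= flow r 0 H w.
Proof.
move=> J0 Jr H0 hM; have r0 : (0 < r)%N by lia.
have cS := @optcut_crossing R D a b r 0 H w H0.
have nS : (ncut (edges r 0 H) (optcut r 0 H w))%:R <= K * r%:R ^+ D.
  exact: (@ncut_optcut R D a b a0 ab r 0 H w H0).
set S := optcut r 0 H w in cS nS *.
pose Sj j := S \o inner_vertex j.
pose ch j := [seq v <- [seq (x, z) | x <- [seq x <- pts (r - 2 * j) D | lateral (r - 2 * j) x],
  z <- iota 0 H] | Sj j v != Sj j (v.1, v.2.+1)].
have chP j x z : ((x, z) \in ch j) = [&& Sj j (x, z) != Sj j (x, z.+1), lateral (r - 2 * j) x,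
    x \in pts (r - 2 * j) D & (z < H)%N].
  rewrite mem_filter /=; congr andb.
  apply/allpairsP/and3P => [[[x' z'] [/= + + [-> ->]]]|[h1 h2 h3]].
    by rewrite mem_filter mem_iota => /andP[-> ->].
  by exists (x, z); rewrite mem_filter mem_iota h1 h2.
have [j jJ dj] : exists2 j, (j < J)%N & (size (ch j) <= M)%N.
  have [/hasP[j]|/hasPn h] := boolP (has (fun j => size (ch j) <= M)%N (iota 0 J)).
    by rewrite mem_iota add0n => /andP[_ jJ] dj; exists j.
  exfalso; move: hM; apply/negP; rewrite -leNgt; apply: le_trans nS; rewrite ler_nat.
  apply: (@leq_trans (\sum_(j <- iota 0 J) size (ch j))%N).
    rewrite -[X in (X * _)%N](size_iota 0 J) -sum1_size big_distrl /= big_seq [leqRHS]big_seq.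
    by apply: leq_sum => j /h; rewrite mul1n ltnNge.
  rewrite /ncut -size_filter.
  pose Q := [seq (((D, inner j v.1), v.2) : gedge) | j <- iota 0 J, v <- ch j].
  have <- : size Q = (\sum_(j <- iota 0 J) size (ch j))%N.
    rewrite /Q size_allpairs_dep sumnE big_map.
    by [].
  apply: uniq_leq_size.
    apply: allpairs_uniq_dep; first exact: iota_uniq.
      move=> j _; rewrite filter_uniq //; apply: allpairs_uniq; rewrite ?iota_uniq //.
        by rewrite filter_uniq ?uniq_pts.
      by move=> [? ?] [? ?] _ _ [-> ->].
    move=> [j [x z]] [j' [x' z']] /allpairsPdep[j1 [v1 [jJ h1 [E1 E2]]]].
    move=> /allpairsPdep[j2 [v2 [jJ' h2 [E1' E2']]]] [xx zz].
    subst j1 j2 v1 v2 z'; move: h1 h2 jJ jJ'; rewrite !chP !mem_iota !add0n.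
    move=> /and4P[_ lx /pts_nthP[sx hx] _] /and4P[_ lx' /pts_nthP[sx' hx'] _] /andP[_ jJ] /andP[_ jJ'].
    have nthx i : (i < D)%N -> (j + nth 0%N x i = j' + nth 0%N x' i)%N.
      move=> iD; have := congr1 (fun l : seq nat => nth 0%N l i) xx.
      by rewrite /inner !(nth_map 0%N) ?sx ?sx'.
    have jj' : j = j'.
      case: (ltngtP j j') => // jj.
        move/hasP: lx => [k /(nthP 0%N)[i]]; rewrite sx => iD <- /orP[/eqP hk|/eqP hk];
          move: (nthx i iD) (hx i iD) (hx' i iD) hk;
          move: (nth 0%N x i) (nth 0%N x' i) => c c'; clear -jj jJ jJ' Jr; lia.
      move/hasP: lx' => [k /(nthP 0%N)[i]]; rewrite sx' => iD <- /orP[/eqP hk|/eqP hk];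
        move: (nthx i iD) (hx i iD) (hx' i iD) hk;
          move: (nth 0%N x i) (nth 0%N x' i) => c c'; clear -jj jJ jJ' Jr; lia.
    subst j'; have -> // : x = x'.
    by apply: (@seq_eqP D) => // i iD; have /addnI := nthx i iD.
  move=> e /allpairsPdep[j [[x z] [/= jJ vj ->]]].
  move: jJ vj; rewrite mem_iota add0n chP mem_filter => /andP[_ jJ] /and4P[cv _ xr zH].
  rewrite vedge ?zH ?andbT //; last by apply: inner_pts xr; lia.
  by move: cv; rewrite /cutb /gsrc /gtgt /= ltnn.
have jr : (2 * j <= r)%N by lia.
pose c := ch j ++ nseq (M - size (ch j)) ([::], 0%N).
have cM : size c = M by rewrite size_cat size_nseq subnKC.
have c_mem x z : x \in pts (r - 2 * j) D -> ((x, z) \in c) = ((x, z) \in ch j).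
  move=> /pts_nthP[sx _]; rewrite mem_cat mem_nseq; case: eqVneq => [[x0 _]|_]; last by rewrite andbF orbF.
  by move: D0; rewrite -sx x0.
have cpos : c \in words (positions r H) M.
  rewrite -cM; apply: mem_words; apply/allP => -[x z]; rewrite mem_cat inE => /orP[|].
    rewrite chP => /and4P[_ _ xr zH]; apply/orP; right; apply/allpairsP; exists (x, z).
    rewrite mem_iota zH; split=> //; move: xr => /pts_nthP[sx hx].
    by apply/pts_nthP; split=> // i iD; exact: leq_trans (hx i iD) (leq_subr _ _).
  by rewrite mem_nseq => /andP[_ ->].
have tr x z : x \in pts (r - 2 * j) D -> lateral (r - 2 * j) x -> (z <= H)%N ->
    Sj j (x, z) = trace_of c (x, z).
  move=> xr lx; elim: z => [|z IH] zH.
    by have [h0 _] := cS _ (inner_pts jr xr); exact: h0.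
  have iotaS : iota 0 z.+1 = iota 0 z ++ [:: z] by rewrite -addn1 iotaD.
  have -> : trace_of c (x, z.+1) = trace_of c (x, z) (+) ((x, z) \in c).
    rewrite /trace_of; set y := (x, z).1; set y' := (x, z).2.
    by rewrite -[(x, z.+1).2]/z.+1 iotaS count_cat /= addn0 oddD oddb addNb.
  rewrite -(IH (ltnW zH)) c_mem // chP lx xr zH !andbT.
  by case: (Sj j _); case: (Sj j _).
have pinS : pinned (r - 2 * j) H (trace_of c) (Sj j).
  by split=> // x xr; exact: cS _ (inner_pts jr xr).
exists (j, c) => /=.
  rewrite mem_filter /=; apply/andP; split; last first.
    by apply/allpairsP; exists (j, c); rewrite mem_iota.
  apply/asboolP; exists (Sj j); split=> //; apply: le_trans nS; rewrite ler_nat /ncut -!size_filter.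
  rewrite -(size_map (inner_edge j)); apply: uniq_leq_size.
    by rewrite map_inj_uniq ?filter_uniq ?uniq_edges //; exact: inner_edge_inj.
  move=> e /mapP[e' + ->]; rewrite !mem_filter => /andP[ce eE].
  by rewrite (cutb_inner S j eE) ce (inner_edge_mem jr eE).
apply: le_trans (mincut_le gsrc gtgt a b _ pinS _ pinS) _.
rewrite /flow /mincut -/(optcut r 0 H w) -/S /cost.
rewrite -[leLHS](big_filter) -[leRHS]big_filter.
have -> : \sum_(e <- [seq e <- edges (r - 2 * j) 0 H | cutb (Sj j) e]) tau a b (w \o inner_edge j) e =
    \sum_(e <- map (inner_edge j) [seq e <- edges (r - 2 * j) 0 H | cutb (Sj j) e]) tau a b w e.
  by rewrite big_map.
apply: ler_sum_subset; last by move=> e; exact: tau_ge0.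
  by rewrite map_inj_uniq ?filter_uniq ?uniq_edges //; exact: inner_edge_inj.
move=> e /mapP[e' + ->]; rewrite !mem_filter => /andP[ce eE].
by rewrite (cutb_inner S j eE) ce (inner_edge_mem jr eE).
Qed.

End Trace.

Section MeanTiles.
Variables (R : realType) (D : nat) (a b p : R).
Hypotheses (a0 : 0 < a) (ab : a < b) (D0 : (0 < D)%N) (p0 : 0 < p) (p1 : p <= 1).
Variables (NB Z H : nat) (Lg : seq gedge) (w0 : gedge -> bool).
Hypotheses (uLg : uniq Lg) (subLg : {subset edges D NB 0 Z <= Lg}) (H0 : (0 < H)%N) (HZ : (H <= Z)%N).

Local Notation gtgt := (gtgt D).
Local Notation edges := (edges D).
Local Notation cutb := (cutb gsrc gtgt).
Local Notation ncut := (ncut gsrc gtgt).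
Local Notation flow := (flow D a b).
Local Notation optcut := (optcut D a b).
Local Notation pinned := (pinned D).
Local Notation pflow := (pflow D a b).
Local Notation tile_edge := (tile_edge D).
Local Notation E F := (avs p Lg F w0).
Let K : R := b / a.
Let B : R := b - a.
Let p0' : 0 <= p. Proof. exact: ltW. Qed.

Lemma edges_wide N N' u v : (N <= N')%N -> {subset edges N u v <= edges N' u v}.
Proof.
move=> NN [[i x] z]; rewrite !mem_edges !mem_hcols.
have pN : x \in pts N D -> x \in pts N' D.
  by move=> /pts_nthP[sx h]; apply/pts_nthP; split=> // k kD; exact: leq_trans (h k kD) NN.
move=> /orP[/andP[/and3P[-> /pN -> xi] ->]|/and3P[-> /pN -> ->]]; last by rewrite orbT.
by rewrite (leq_trans xi NN).
Qed.

Lemma edges_box N : (N <= NB)%N -> {subset edges N 0 H <= Lg}.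
Proof.
move=> NN e eE; apply: subLg; apply: (edges_sub (leqnn 0) HZ).
exact: edges_wide eE.
Qed.

Lemma mean_embedding N (f : gedge -> gedge) (F : (gedge -> bool) -> R) :
  (N <= NB)%N -> {in edges N 0 H &, injective f} -> depends (edges N 0 H) F ->
  (forall e, e \in edges N 0 H -> f e \in edges NB 0 H) ->
  E (fun w => F (w \o f)) = E F.
Proof.
move=> NN finj dF fE; apply: (@avs_relabel_sub _ _ _ _ _ (edges N 0 H)) => //.
- exact: uniq_edges.
- exact: edges_box.
- by move=> e /mapP[e' /fE e'E ->]; exact: (edges_box (leqnn _)).
Qed.

Lemma mean_tile T s t (F : (gedge -> bool) -> R) : (0 < s)%N -> (T * s <= NB)%N ->
  t \in pts T D -> depends (edges s 0 H) F ->
  E (fun w => F (w \o tile_edge s t)) = E F.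
Proof.
move=> s0 TN tT dF.
have T0 : (0 < T)%N by case/pts_nthP: tT => _ /(_ 0%N D0); exact: leq_ltn_trans.
apply: (@mean_embedding s) => //.
- by apply: leq_trans TN; rewrite leq_pmull.
- exact: (tile_edge_inj s0).
- by move=> e; exact: (tile_edge_mem s0 TN tT).
Qed.

Lemma trace_mean r J M (lam : R) : (0 < J)%N -> (2 * J <= r)%N -> (r <= NB)%N ->
  K * r%:R ^+ D < (J * M.+1)%:R -> 0 < lam ->
  exists2 jc, jc \in traces D a b r H J M &
    E (pflow (r - 2 * jc.1) H (trace_of jc.2)) <= E (flow r 0 H) +
      ln (J * (r ^ D * H).+1 ^ M)%:R / lam + B ^+ 2 * (K * (K * r%:R ^+ D)) / p * lam.
Proof.
move=> J0 Jr rN hM lam0.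
have K0 : 0 <= K by rewrite divr_ge0 // ltW // (lt_trans a0).
have b0 : 0 <= b by rewrite ltW // (lt_trans a0).
have A0 : 0 <= r%:R ^+ D :> R by rewrite exprn_ge0.
pose Y jc := pflow (r - 2 * jc.1) H (trace_of jc.2).
have wit jc : jc \in traces D a b r H J M -> (jc.1 < J)%N /\
   exists S, pinned (r - 2 * jc.1) H (trace_of jc.2) S /\
          (ncut (edges (r - 2 * jc.1) 0 H) S)%:R <= K * r%:R ^+ D.
  rewrite mem_filter => /andP[/asboolP h /allpairsP[[j c] [/= + _ E]]].
  by rewrite mem_iota => /andP[_ jJ]; split=> //; rewrite E.
have hB jc u : jc \in traces D a b r H J M -> 0 <= Y jc u <= b * (K * r%:R ^+ D).
  move=> /wit[_ [S [pinS nS]]]; rewrite mincut_ge0 //=.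
  have h := mincut_le_ncut gsrc gtgt ab (edges (r - 2 * jc.1) 0 H) pinS u.
  by apply: le_trans h _; rewrite ler_wpM2l.
have hd jc u e : jc \in traces D a b r H J M -> dif e (Y jc) u <= 0.
  by move=> /wit[_ [S [pinS nS]]]; apply: (dif_mincut_le0 _ _ ab _ pinS); exact: uniq_edges.
have hv jc (u : gedge -> bool) : jc \in traces D a b r H J M ->
    \sum_(e <- Lg | u e) dif e (Y jc) u ^+ 2 <= B ^+ 2 * (K * (K * r%:R ^+ D)).
  move=> /wit[_ [S [pinS nS]]].
  apply: le_trans (sum_sqr_dif_mincut _ _ ab _ pinS u uLg) _; first exact: uniq_edges.
  rewrite ler_wpM2l ?sqr_ge0 //; apply: le_trans (ncut_opt_le _ _ a0 ab _ pinS u) _.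
  by rewrite ler_wpM2l.
have hX : E (fun u => expR (- lam * flow r 0 H u)) <=
    \sum_(jc <- traces D a b r H J M) E (fun u => expR (- lam * Y jc u)).
  apply: (@le_trans _ _ (E (fun w => \sum_(jc <- traces D a b r H J M)
      expR (- lam * Y jc (w \o inner_edge jc.1))))).
    apply: (le_avs p0' p1) => w.
    have [jc jcT le] := trace_exists a0 ab D0 w J0 Jr H0 hM.
    rewrite (big_rem jc) //= -[leLHS]addr0; apply: lerD.
      by rewrite ler_expR !mulNr lerN2 ler_pM2l.
    by apply: sumr_ge0 => i _; exact: expR_ge0.
  rewrite avs_sum big_seq [leRHS]big_seq; apply: ler_sum => jc /wit[jJ [S [pinS _]]].
  rewrite (@mean_embedding (r - 2 * jc.1) (inner_edge jc.1) (fun w => expR (- lam * Y jc w))) //.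
  - by apply: leq_trans (leq_subr _ _) rN.
  - by move=> e e' _ _; exact: inner_edge_inj.
  - by move=> w w' ww'; congr expR; congr (_ * _); apply: (mincut_depends gsrc gtgt a b pinS).
  - have jr : (2 * jc.1 <= r)%N by apply: leq_trans Jr; rewrite leq_mul2l (ltnW jJ).
    by move=> e eE; apply: (edges_wide rN); exact: (inner_edge_mem jr eE).
have [jc jcT le] := exists_mean_le p0' p1 p0 lam0 uLg hB hd hv hX.
exists jc => //; apply: le_trans le _; rewrite lerD2r lerD2l ler_wpM2r ?invr_ge0 ?(ltW lam0) //.
have s0 : (0 < size (traces D a b r H J M))%N by case: traces jcT.
rewrite ler_ln ?posrE ?ltr0n // ?ler_nat ?size_traces //.
exact: leq_trans s0 (size_traces _ _ _ _ _ _ _).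
Qed.

Lemma mean_flow_le_tiles N r J M (lam : R) : (0 < J)%N -> (2 * J <= r)%N -> (N + r <= NB)%N ->
  K * r%:R ^+ D < (J * M.+1)%:R -> 0 < lam ->
  exists s, [/\ (r < s + 2 * J)%N, (s <= r)%N &
    E (flow N 0 H) <= ((N %/ s).+1 ^ D)%:R * (E (flow r 0 H) +
      ln (J * (r ^ D * H).+1 ^ M)%:R / lam + B ^+ 2 * (K * (K * r%:R ^+ D)) / p * lam)].
Proof.
move=> J0 Jr rN hM lam0.
have [jc jcT le] := trace_mean J0 Jr (leq_trans (leq_addl _ _) rN) hM lam0.
move: jcT; rewrite mem_filter => /andP[/asboolP [S [pinS _]] /allpairsP[[j c] [/= + _ jcE]]].
rewrite mem_iota => /andP[_ jJ]; rewrite jcE /= in le pinS.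
exists (r - 2 * j)%N; split; [by clear -jJ Jr; lia|exact: leq_subr|].
set s := (r - 2 * j)%N in le pinS *.
have s0 : (0 < s)%N by rewrite /s; clear -jJ Jr; lia.
apply: le_trans (ler_wpM2l (ler0n _ _) le).
have NT : (N <= (N %/ s).+1 * s)%N by rewrite ltnW // ltn_ceil.
have TN : ((N %/ s).+1 * s <= NB)%N.
  rewrite mulSn; apply: leq_trans rN; have := leq_trunc_div N s; have : (s <= r)%N by exact: leq_subr.
  by clear; lia.
apply: (@le_trans _ _ (E (fun w => \sum_(t <- pts (N %/ s).+1 D) pflow s H (trace_of c) (w \o tile_edge s t)))).
  by apply: (le_avs p0' p1) => w; exact: (flow_le_tiles a0 ab _ s0 NT pinS).
rewrite avs_sum -(size_pts _ D) -sum1_size natr_sum mulr_suml.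
rewrite big_seq [leRHS]big_seq; apply: ler_sum => t tT.
rewrite (mean_tile s0 TN tT) ?mul1r //.
exact: (mincut_depends gsrc gtgt a b pinS).
Qed.

Section Bad.
Variables (N : nat) (th : R).
Hypotheses (N0 : (0 < N)%N) (th0 : 0 <= th) (hH : (ch D a b * N <= H)%N).
Local Notation colmass := (colmass D a b p N Lg Z w0 H).
Local Notation badmass := (badmass D a b p N Lg Z w0 H th).
Local Notation kappa := (kappa D a b p N Lg w0 H).
Let bad c := th < colmass c.

Lemma sum_colmass_le : \sum_(c <- cols D N) colmass c <= K * N%:R ^+ D.
Proof.
have kap0 e : 0 <= kappa e by exact: kappa_ge0.
have hH' : (ch D a b * N + 2 * 1 * 0 <= H)%N by rewrite muln0 addn0.
apply: le_trans (sum_kappa_le a0 ab p0' p1 Lg w0 N0 hH').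
have -> : \sum_(c <- cols D N) colmass c =
    \sum_(e <- [seq e <- [seq ((c, z) : gedge) | c <- cols D N, z <- iota 0 Z.+1] | e \in edges N 0 H]) kappa e.
  apply: esym; rewrite big_filter big_mkcond big_allpairs_dep /=.
  apply: eq_bigr => c _; apply: eq_bigr => z _.
  by case: ifPn => // h; rewrite kappa_notin.
apply: ler_sum_subset => //; last by move=> e; rewrite mem_filter => /andP[].
rewrite filter_uniq //; apply: allpairs_uniq; rewrite ?uniq_cols ?iota_uniq //.
by move=> [? ?] [? ?] _ _ [-> ->].
Qed.

Lemma colmass_ge0 c : 0 <= colmass c.
Proof. by apply: sumr_ge0 => z _; exact: kappa_ge0. Qed.

Lemma count_bad_le : (count bad (cols D N))%:R * th <= K * N%:R ^+ D.
Proof.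
apply: le_trans sum_colmass_le; rewrite natr_count mulr_suml.
rewrite [leLHS]big_mkcond; apply: ler_sum => c _; case: ifP => [/ltW|_].
  by rewrite mul1r.
exact: colmass_ge0.
Qed.

Lemma badmass_eq0 : K * N%:R ^+ D <= th -> badmass = 0.
Proof.
move=> hth; rewrite /badmass big_seq_cond big1 // => e /andP[eE].
rewrite ltNge => /negP[]; apply: le_trans hth; apply: le_trans sum_colmass_le.
rewrite (bigD1_seq e.1) ?uniq_cols ?(edge_col eE) //= lerDl.
by apply: sumr_ge0 => c _; exact: colmass_ge0.
Qed.

Lemma badmass_le_mean r : (0 < r)%N -> (N <= NB)%N ->
  a * badmass <= E (flow N 0 H) -
    (((N %/ r) ^ D)%:R - (count bad (cols D N))%:R) * E (flow r 0 H).
Proof.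
move=> r0 NN; rewrite lerBrDl.
have TN : (N %/ r * r <= N)%N by exact: leq_trunc_div.
have Xr0 : 0 <= E (flow r 0 H) by apply: (avs_ge0 p0' p1) => w; exact: mincut_ge0.
apply: (@le_trans _ _ (E (fun w => \sum_(t <- pts (N %/ r) D | good_tile D N r bad t)
    flow r 0 H (w \o tile_edge r t) +
  a * (count (fun e => cutb (optcut N 0 H w) e && bad e.1) (edges N 0 H))%:R))); last first.
  by apply: (le_avs p0' p1) => w; exact: (flow_ge_tiles _ _ _ bad w r0 TN H0).
rewrite avsD avsZ; apply: lerD.
  rewrite avs_sum big_seq_cond.
  rewrite (eq_bigr (fun=> E (flow r 0 H))); last first.
    move=> t /andP[tT _]; apply: (mean_tile r0 (leq_trans TN NN) tT).
    by apply: mincut_depends; exact: crossing_flat H0.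
  rewrite -big_seq_cond big_const_seq iter_addr_0 -(mulr_natl (E (flow r 0 H))) ler_wpM2r //.
  rewrite lerBlDr -natrD ler_nat; exact: good_tiles_count.
rewrite ler_pM2l // /badmass /kappa -avs_sum.
apply: (le_avs p0' p1) => w; rewrite natr_count [leRHS]big_mkcond [leLHS]big_mkcond.
rewrite [leLHS]big_seq [leRHS]big_seq; apply: ler_sum => e eE.
by rewrite eE /= /bad /colmass; case: ifP => _; rewrite ?andbT ?andbF //; case: cutb.
Qed.

(* Superadditivity bounds the mean flow from below by the flows of the good
   tiles plus the mass of the bad columns; gluing reflected tiles bounds it from
   above by the flows of nearly as many tiles. *)
Lemma badmass_le r J M (lam : R) : (0 < J)%N -> (2 * J <= r)%N -> (N + r <= NB)%N ->
  K * r%:R ^+ D < (J * M.+1)%:R -> 0 < lam ->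
  exists s, [/\ (r < s + 2 * J)%N, (s <= r)%N &
    a * badmass <=
      (((N %/ s).+1 ^ D)%:R - ((N %/ r) ^ D)%:R + (count bad (cols D N))%:R) * (b * r%:R ^+ D) +
      ((N %/ s).+1 ^ D)%:R *
        (ln (J * (r ^ D * H).+1 ^ M)%:R / lam + B ^+ 2 * (K * (K * r%:R ^+ D)) / p * lam)].
Proof.
move=> J0 Jr rN hM lam0.
have r0 : (0 < r)%N by clear -J0 Jr; lia.
have [s [rs sr le]] := mean_flow_le_tiles J0 Jr rN hM lam0.
exists s; split=> //.
have NN : (N <= NB)%N by apply: leq_trans rN; exact: leq_addr.
have low := badmass_le_mean r0 NN.
have Xr : E (flow r 0 H) <= b * r%:R ^+ D.
  rewrite -[leRHS](avsC p Lg _ w0); apply: (le_avs p0' p1) => w.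
  have := mincut_le_ncut gsrc gtgt ab (edges r 0 H) (@crossing_flat D r 0 H H0) w.
  by rewrite ncut_flat // natrX.
have c0 : 0 <= ((N %/ s).+1 ^ D)%:R - ((N %/ r) ^ D)%:R + (count bad (cols D N))%:R :> R.
  rewrite addr_ge0 ?ler0n // subr_ge0 ler_nat leq_exp2r //.
  have : (N %/ r <= N %/ s)%N by apply: leq_div2l => //; clear -rs Jr; lia.
  by move=> h; apply: leq_trans h (leqnSn _).
have := ler_wpM2l c0 Xr; lra.
Qed.

End Bad.
End MeanTiles.

(** * Choice of scales *)

Section Scales.
Variable R : realType.

Lemma scale_exists (P n : nat) : (0 < P)%N -> (0 < n)%N ->
  exists k, [/\ (0 < k)%N, (k ^ P <= n)%N & (n < k.+1 ^ P)%N].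
Proof.
move=> P0 n0; have ex : exists k, (k ^ P <= n)%N by exists 1%N; rewrite exp1n.
have ub k : (k ^ P <= n)%N -> (k <= n)%N.
  apply: leq_trans; case: k => // k; exact: (leq_pexp2l (isT : 0 < k.+1)%N P0).
have [k kn kmax] := ex_maxnP ex ub.
exists k; split=> //; first by apply: kmax; rewrite exp1n.
by rewrite ltnNge; apply/negP => /kmax; rewrite ltnn.
Qed.

Lemma ln_sqr_le (k : nat) : (0 < k)%N -> ln (k.+1%:R : R) ^+ 2 <= 8 * k%:R.
Proof.
move=> k0; have x0 : 0 < k.+1%:R :> R by rewrite ltr0n.
have [s s0 sE] := @root_exists R 2 k.+1%:R isT (ltW x0).
have {}s0 : 0 < s by rewrite lt_def s0 andbT; apply: contraTneq x0 => h; rewrite -sE h expr0n ltxx.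
have h1 : ln (k.+1%:R : R) = 2 * ln s by rewrite -sE lnXn // mulr_natl.
have h2 : ln s <= s by apply: le_trans (ln_le_subr1 s0) _; rewrite lerBlDr lerDl.
have h3 : 0 <= ln (k.+1%:R : R) by rewrite ln_ge0 // ler1n.
have h4 : ln (k.+1%:R : R) ^+ 2 <= (2 * s) ^+ 2.
  by rewrite lerXn2r ?nnegrE ?mulr_ge0 ?(ltW s0) // h1 ler_pM2l.
apply: le_trans h4 _; rewrite exprMn sE -natr1.
have : 1 <= k%:R :> R by rewrite ler1n.
lra.
Qed.

Lemma ln_scale (P n k : nat) : (0 < k)%N -> (2 <= n)%N -> (n < k.+1 ^ P)%N ->
  ln (n%:R : R) <= P%:R * ln (k.+1%:R : R) /\ ln (n%:R : R) ^+ 2 <= 8 * P%:R ^+ 2 * k%:R.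
Proof.
move=> k0 n2 nk; have n1 : (0 < n)%N by exact: ltnW.
have h1 : ln (n%:R : R) <= P%:R * ln (k.+1%:R : R).
  have h0 : ln (n%:R : R) <= ln ((k.+1 ^ P)%:R : R).
    by rewrite ler_ln ?posrE ?ltr0n ?expn_gt0 // ?ler_nat ?(ltnW nk).
  by apply: le_trans h0 _; rewrite natrX lnXn ?ltr0n // mulr_natl.
split=> //; have l0 : 0 <= ln (n%:R : R) by rewrite ln_ge0 // ler1n.
apply: (@le_trans _ _ ((P%:R * ln (k.+1%:R : R)) ^+ 2)).
  by rewrite lerXn2r ?nnegrE ?mulr_ge0 ?ler0n ?ln_ge0 ?ler1n.
have := ler_wpM2l (sqr_ge0 (P%:R : R)) (ln_sqr_le k0); rewrite exprMn; lra.
Qed.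

Lemma expr1D_le (D k : nat) : (0 < k)%N -> (1 + 9 / k%:R) ^+ D <= 1 + 10 ^+ D / k%:R :> R.
Proof.
move=> k0; have kR : 1 <= k%:R :> R by rewrite ler1n.
have kp : 0 < k%:R :> R by rewrite ltr0n.
suff : (1 + 9 / k%:R) ^+ D <= 1 + (10 ^+ D - 1) / k%:R :> R.
  move/le_trans; apply; rewrite lerD2l ler_wpM2r ?invr_ge0 ?ler0n // lerBlDr lerDl.
  by [].
have x0 : 0 <= k%:R^-1 :> R by rewrite invr_ge0 ler0n.
have x1 : k%:R^-1 <= 1 :> R by rewrite invf_le1.
elim: D => [|D IH]; first by rewrite !expr0 subrr mul0r addr0.
rewrite exprS; have c0 : 0 <= 1 + 9 / k%:R :> R by rewrite addr_ge0 ?mulr_ge0 ?ler0n.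
apply: le_trans (ler_wpM2l c0 IH) _; rewrite [10 ^+ D.+1]exprS.
have : 1 <= 10 ^+ D :> R by rewrite exprn_ege1 // ler1n.
set x := k%:R^-1 in x0 x1 *; set y := 10 ^+ D => y1.
have : 0 <= (y - 1) * x * (1 - x) by rewrite !mulr_ge0 ?subr_ge0.
lra.
Qed.

End Scales.

Section Numbers.
Variable R : realType.

Lemma tile_upper (D N k s : nat) : (0 < k)%N -> (k ^ 4 <= N)%N ->
  (4 * k ^ 3 < s + 2 * k ^ 2)%N -> (s <= 4 * k ^ 3)%N ->
  ((N %/ s).+1 ^ D)%:R * (4 * k ^ 3)%:R ^+ D <= N%:R ^+ D * (1 + 10 ^+ D / k%:R) :> R.
Proof.
move=> k0 kN rs sr; set r := (4 * k ^ 3)%N in rs sr *.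
have x0 : 0 < k%:R :> R by rewrite ltr0n.
apply: (@le_trans _ _ (N%:R ^+ D * (1 + 9 / k%:R) ^+ D)); last first.
  by rewrite ler_wpM2l ?exprn_ge0 ?ler0n // expr1D_le.
have -> : ((N %/ s).+1 ^ D)%:R * r%:R ^+ D = ((N %/ s).+1 * r)%:R ^+ D :> R.
  by rewrite natrM exprMn natrX.
rewrite -exprMn lerXn2r ?nnegrE ?ler0n //.
rewrite -(ler_pM2r x0) -mulrA mulrDl mul1r divfK ?gt_eqF //.
rewrite -natrM -[9]/(9%:R) -natrD -natrM ler_nat.
have k2 : (0 < k ^ 2)%N by rewrite expn_gt0 k0.
have k3E : (k ^ 3 = k * k ^ 2)%N by rewrite expnS.
have k4E : (k ^ 4 = k * (k * k ^ 2))%N by rewrite !expnS.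
have h1 : ((N %/ s).+1 * s <= N + s)%N by rewrite mulSn addnC leq_add2r leq_trunc_div.
have h2 : (r * k <= s * (k + 1))%N.
  rewrite /r k3E in rs sr *; move: (k ^ 2)%N k2 rs sr => y y0 rs sr; clear -rs sr y0 k0; nia.
set T := (N %/ s).+1 in h1 *.
have h3 : (T * r * k <= (N + s) * (k + 1))%N.
  rewrite -mulnA; apply: (@leq_trans (T * (s * (k + 1)))); first by rewrite leq_mul2l h2 orbT.
  by rewrite mulnA leq_mul2r h1 orbT.
apply: leq_trans h3 _.
have h4 : (s * k <= 4 * N)%N.
  apply: (@leq_trans (4 * k ^ 3 * k)); first by rewrite leq_mul2r sr orbT.
  by rewrite -mulnA leq_mul2l /= -expnSr.
rewrite mulnDl mulnDr muln1; move: h4 k0; clear; nia.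
Qed.

Lemma tile_lower (D N k : nat) : (0 < k)%N -> (k ^ 4 <= N)%N -> (0 < N)%N ->
  N%:R ^+ D * (1 - 4 * D%:R / k%:R) <= ((N %/ (4 * k ^ 3)) ^ D)%:R * (4 * k ^ 3)%:R ^+ D :> R.
Proof.
move=> k0 kN N0; set r := (4 * k ^ 3)%N.
have x0 : 0 < k%:R :> R by rewrite ltr0n.
have r0 : (0 < r)%N by rewrite muln_gt0 expn_gt0 k0.
have -> : ((N %/ r) ^ D)%:R * r%:R ^+ D = (N %/ r * r)%:R ^+ D :> R.
  by rewrite natrM exprMn natrX.
have TN : ((N %/ r * r)%:R : R) <= N%:R by rewrite ler_nat leq_trunc_div.
have := @subXX_le R D N%:R (N %/ r * r)%:R (ler0n _ _) TN.
have hr : (N%:R - (N %/ r * r)%:R) * k%:R <= 4 * N%:R :> R.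
  rewrite -natrB ?leq_trunc_div // -!natrM ler_nat.
  have -> : (N - N %/ r * r = N %% r)%N by rewrite {1}(divn_eq N r) addnC addnK.
  apply: (@leq_trans (r * k)); first by rewrite leq_mul2r (ltnW (ltn_pmod _ r0)) orbT.
  by rewrite /r -mulnA leq_mul2l /= -expnSr.
have h : D%:R * (N%:R - (N %/ r * r)%:R) * N%:R ^+ D.-1 <= N%:R ^+ D * (4 * D%:R / k%:R) :> R.
  rewrite -(ler_pM2r x0); have -> : N%:R ^+ D * (4 * D%:R / k%:R) * k%:R = N%:R ^+ D * (4 * D%:R) :> R.
    by field; rewrite gt_eqF.
  case: (D) => [|d]; first by rewrite !mul0r !mulr0.
  rewrite exprS /=.
  have := ler_wpM2l (ler0n R d.+1) hr.
  have e0 : 0 <= N%:R ^+ d :> R by rewrite exprn_ge0 ?ler0n.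
  move/(ler_wpM2r e0); lra.
rewrite natrM; lra.
Qed.

End Numbers.

Section Main.
Variables (R : realType) (D : nat) (a b p : R).
Hypotheses (a0 : 0 < a) (ab : a < b) (D0 : (0 < D)%N) (p0 : 0 < p) (p1 : p <= 1).
Let K : R := b / a.
Let B : R := b - a.
Let h := ch D a b.
Let P := (3 * D + 4)%N.
Let K0 : 0 < K. Proof. by rewrite divr_gt0 // (lt_trans a0). Qed.
Let b0 : 0 < b. Proof. exact: lt_trans ab. Qed.

Section Fixed.
Variables (n k H : nat).
Hypotheses (n2 : (2 <= n)%N) (k0 : (0 < k)%N) (kn : (k ^ P <= n)%N) (hH : (h * n.+1 + n <= H)%N).

Let m := ((H - h * n.+1) %/ (2 * k))%N.
Let Lg := edges D (n.+1 + 4 * k ^ 3) 0 (H + m).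
Let A : R := n.+1%:R ^+ D.
Let l : R := ln n%:R.

Lemma two_k_le : (2 * k <= n)%N.
Proof.
have [k1|k1] := leqP k 1; first by apply: leq_trans n2; rewrite -[leqRHS](muln1 2) leq_mul2l.
apply: leq_trans kn; apply: (@leq_trans (k ^ 2)%N); first by rewrite -mulnn leq_mul2r k1 orbT.
by rewrite leq_exp2l // /P addnC.
Qed.

Lemma m_gt0 : (0 < m)%N.
Proof.
rewrite divn_gt0 ?muln_gt0 ?k0 //; apply: leq_trans two_k_le _.
by rewrite leq_subRL ?(leq_trans _ hH) ?leq_addr.
Qed.

Lemma m_upper : (2 * k * m <= H - h * n.+1)%N.
Proof. by rewrite mulnC leq_trunc_div. Qed.

Lemma m_lower : (H - h * n.+1 <= 4 * k * m)%N.
Proof.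
have : (H - h * n.+1 < m.+1 * (2 * k))%N by rewrite ltn_ceil // muln_gt0 k0.
by have := m_gt0; clear; nia.
Qed.

Lemma n_le_km : (n <= 4 * k * m)%N.
Proof.
by apply: leq_trans m_lower; rewrite leq_subRL ?(leq_trans _ hH) ?leq_addr.
Qed.

Lemma k_pow e : (e <= P)%N -> (k ^ e <= n)%N.
Proof.
move=> eP; apply: leq_trans kn; case: (leqP k 1) => k1; last by rewrite leq_exp2l.
by have -> : k = 1%N; [apply/eqP; rewrite eqn_leq k1 k0|rewrite !exp1n].
Qed.

Lemma m_pow : (k ^ (3 * D + 3) <= 4 * m)%N.
Proof.
rewrite -(leq_pmul2l k0) -expnS; apply: (@leq_trans n); first by apply: k_pow; rewrite /P -addnS.
by apply: leq_trans n_le_km _; rewrite mulnCA mulnA.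
Qed.

Lemma l_gt0 : 0 < l.
Proof. by rewrite ln_gt0 // ltr1n. Qed.

Lemma l_ge : ln 2 <= l.
Proof. by rewrite ler_ln ?posrE ?ltr0n // ?ler_nat // ltnW. Qed.

Definition c_log : R :=
  ln (2 * 4 ^+ D * (4 * K + h%:R) * 2 ^+ D + 1) / ln 2 + (D + 2)%:R.

Lemma ln2_gt0 : 0 < ln 2 :> R. Proof. by rewrite ln_gt0 // ltr1n. Qed.

Lemma K4h_ge0 : 0 <= 4 * K + h%:R.
Proof. by move: K (ltW K0) => x x0; rewrite addr_ge0 ?ler0n // mulr_ge0 ?ler0n. Qed.

Lemma const_ge0 : 0 <= 2 * 4 ^+ D * (4 * K + h%:R) * 2 ^+ D.
Proof. by rewrite !mulr_ge0 ?K4h_ge0 ?exprn_ge0 ?ler0n. Qed.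

Lemma c_log_ge0 : 0 <= c_log.
Proof.
rewrite addr_ge0 ?ler0n // divr_ge0 ?(ltW ln2_gt0) // ln_ge0 // lerDr.
exact: const_ge0.
Qed.

(* When columns can be bad at all, H is polynomial in n. *)
Lemma log_size : m%:R / k%:R ^+ 2 < K * A ->
  ln (((4 * k ^ 3) ^ D * H).+1)%:R <= c_log * l.
Proof.
move=> hm; have kR : 0 < k%:R :> R by rewrite ltr0n.
have nR : 1 <= n%:R :> R by rewrite ler1n ltnW.
have N2 : n.+1%:R <= 2 * n%:R :> R by rewrite -natrM ler_nat; clear -n2; lia.
have A1 : 1 <= A by rewrite exprn_ege1 // ler1n.
have AN : n.+1%:R <= A by rewrite -[leLHS]expr1 ler_weXn2l // ler1n.
have hm' : m%:R <= K * A * k%:R ^+ 2 by rewrite -ler_pdivrMr ?exprn_gt0 // ltW.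
have k3 : k%:R ^+ 3 <= n%:R :> R by rewrite -natrX ler_nat k_pow // /P addnC.
have HR : H%:R <= (4 * K + h%:R) * (n%:R * A).
  have : (H <= 4 * k * m + h * n.+1)%N by rewrite addnC -leq_subLR m_lower.
  rewrite -(ler_nat R) natrD !natrM => h1; apply: le_trans h1 _; rewrite [leRHS]mulrDl; apply: lerD.
    apply: (@le_trans _ _ (4 * k%:R * (K * A * k%:R ^+ 2))).
      by rewrite ler_wpM2l ?mulr_ge0 ?ler0n.
    have -> : 4 * k%:R * (K * A * k%:R ^+ 2) = 4 * K * (k%:R ^+ 3 * A) by ring.
    apply: ler_wpM2l; first by move: K (ltW K0) => x x0; rewrite mulr_ge0 ?ler0n.
    by rewrite ler_wpM2r // (le_trans ler01).
  rewrite ler_wpM2l ?ler0n //; apply: le_trans AN _.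
  by rewrite ler_peMl // (le_trans ler01).
have An : A <= 2 ^+ D * n%:R ^+ D.
  by rewrite -exprMn lerXn2r ?nnegrE ?mulr_ge0 ?ler0n.
have rD : ((4 * k ^ 3) ^ D)%:R <= 4 ^+ D * n%:R :> R.
  rewrite expnMn natrM natrX ler_wpM2l ?exprn_ge0 ?ler0n // ler_nat -expnM k_pow //.
  by rewrite /P leq_addr.
pose c := 2 * 4 ^+ D * (4 * K + h%:R) * 2 ^+ D.
have c0 : 0 <= c by exact: const_ge0.
have X1 : (((4 * k ^ 3) ^ D * H).+1)%:R <= (c + 1) * n%:R ^+ (D + 2).
  rewrite -natr1 natrM [leRHS]mulrDl mul1r; apply: lerD; last by rewrite exprn_ege1.
  apply: (@le_trans _ _ (4 ^+ D * n%:R * ((4 * K + h%:R) * (n%:R * (2 ^+ D * n%:R ^+ D))))).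
    rewrite ler_pM ?ler0n //; apply: le_trans HR _.
    by rewrite ler_wpM2l ?K4h_ge0 // ler_wpM2l ?ler0n.
  have -> : c * n%:R ^+ (D + 2) =
     2 * (4 ^+ D * n%:R * ((4 * K + h%:R) * (n%:R * (2 ^+ D * n%:R ^+ D)))).
    by rewrite exprD /c; ring.
  rewrite ler_peMl //.
    by rewrite !mulr_ge0 ?K4h_ge0 ?exprn_ge0 ?ler0n.
  by rewrite ler1n.
have n0 : 0 < n%:R :> R by exact: lt_le_trans ltr01 nR.
have c1 : 0 < c + 1 by rewrite ltr_wpDl.
have lX : ln (((4 * k ^ 3) ^ D * H).+1)%:R <= ln ((c + 1) * n%:R ^+ (D + 2)).
  by rewrite ler_ln ?posrE ?ltr0n // mulr_gt0 ?exprn_gt0.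
apply: le_trans lX _; rewrite lnM ?posrE ?exprn_gt0 // lnXn // /c_log [leRHS]mulrDl -/c -/l.
apply: lerD; last by rewrite mulr_natl.
rewrite mulrAC ler_pdivlMr ?ln2_gt0 // ler_wpM2l ?l_ge //.
by rewrite ln_ge0 // lerDr.
Qed.

Definition c_err : R := (K + 1) * c_log + B ^+ 2 * K ^+ 2 / p / ln 2.

Definition c_bad : R :=
  (b * (10 ^+ D + 4 * D%:R + 4 ^+ D.+1 * K) / ln 2 + (1 + 10 ^+ D) * c_err) / a.

Lemma c_err_ge0 : 0 <= c_err.
Proof.
have K10 : 0 <= K + 1 by rewrite addr_ge0 // ltW.
apply: addr_ge0; first exact: mulr_ge0 K10 c_log_ge0.
apply: divr_ge0 (ltW ln2_gt0); apply: divr_ge0 (ltW p0).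
exact: mulr_ge0 (sqr_ge0 _) (sqr_ge0 _).
Qed.

Lemma badmass_small (w0 : gedge -> bool) :
  badmass D a b p n.+1 Lg (H + m) w0 H (m%:R / k%:R ^+ 2) <= c_bad * (A * (l / k%:R)).
Proof.
have kR : 0 < k%:R :> R by rewrite ltr0n.
have A0 : 0 < A by rewrite exprn_gt0 ?ltr0n.
have l0 := l_gt0; have l2 := l_ge; have ln20 := ln2_gt0.
have th0 : 0 <= m%:R / k%:R ^+ 2 :> R by rewrite divr_ge0 ?exprn_ge0 ?ler0n.
have hH' : (ch D a b * n.+1 <= H)%N by apply: leq_trans hH; exact: leq_addr.
have H0 : (0 < H)%N by apply: leq_trans hH; rewrite ltn_addl // (ltn_trans _ n2).
have HZ : (H <= H + m)%N by exact: leq_addr.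
have uLg : uniq Lg by exact: uniq_edges.
have subLg : {subset edges D (n.+1 + 4 * k ^ 3) 0 (H + m) <= Lg} by [].
have cbad0 : 0 <= c_bad * (A * (l / k%:R)).
  have e1 : 0 <= A * (l / k%:R) by rewrite mulr_ge0 ?divr_ge0 ?(ltW A0) ?(ltW l0) ?(ltW kR).
  apply: mulr_ge0 e1; rewrite divr_ge0 ?(ltW a0) // addr_ge0 //.
    apply: divr_ge0 (ltW ln20); apply: mulr_ge0 (ltW b0) _.
    by move: K (ltW K0) => x x0; rewrite !addr_ge0 ?mulr_ge0 ?exprn_ge0 ?ler0n.
  by apply: mulr_ge0 c_err_ge0; rewrite addr_ge0 ?exprn_ge0 ?ler0n.
have [hth|hth] := leP (K * A) (m%:R / k%:R ^+ 2).
  by rewrite (badmass_eq0 a0 ab p0 p1 _ _ _ (ltn0Sn n) hH' hth).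
have k40 : (k ^ 4 <= n.+1)%N by apply: leq_trans (leqnSn _); rewrite k_pow // /P leq_addl.
set r := (4 * k ^ 3)%N; set J := (k ^ 2)%N.
have J0 : (0 < J)%N by rewrite expn_gt0 k0.
have JR : 0 < J%:R :> R by rewrite ltr0n.
have Jr : (2 * J <= r)%N.
  by rewrite /J /r expnS; move: (k ^ 2)%N k0; clear; nia.
have rD0 : 0 < r%:R ^+ D :> R by rewrite exprn_gt0 // ltr0n muln_gt0 expn_gt0 k0.
pose M := Num.truncn (K * r%:R ^+ D / J%:R).
have KrJ0 : 0 <= K * r%:R ^+ D / J%:R by rewrite divr_ge0 ?ler0n // mulr_ge0 ?(ltW K0) ?(ltW rD0).
have hM : K * r%:R ^+ D < (J * M.+1)%:R.
  by rewrite natrM -ltr_pdivrMl // mulrC truncnS_gt.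
have Mle : M%:R <= K * r%:R ^+ D / J%:R by rewrite truncn_le.
have lam0 : 0 < k%:R^-1 :> R by rewrite invr_gt0.
have [s [rs sr le]] := badmass_le a0 ab D0 p0 p1 w0 uLg subLg H0 HZ (m%:R / k%:R ^+ 2) J0 Jr
   (leqnn (n.+1 + r)) hM lam0.
have up := @tile_upper R D n.+1 k s k0 k40 rs sr.
have low := @tile_lower R D n.+1 k k0 k40 (ltn0Sn n).
have := count_bad_le a0 ab p0 p1 (H + m) Lg w0 (m%:R / k%:R ^+ 2) (ltn0Sn n) hH'.
set nb := count _ _ in le *; move=> cnt.
have nbr : nb%:R * r%:R ^+ D <= 4 ^+ D.+1 * K * A / k%:R.
  have mp : k%:R ^+ (3 * D + 3) <= 4 * m%:R :> R by rewrite -natrX -natrM ler_nat m_pow.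
  have mR : 0 < m%:R :> R by rewrite ltr0n m_gt0.
  have k2R : 0 < k%:R ^+ 2 :> R by rewrite exprn_gt0.
  have cnt' : nb%:R * m%:R <= K * A * k%:R ^+ 2 by rewrite -ler_pdivrMr // -mulrA.
  rewrite ler_pdivlMr // -(ler_pM2r mR).
  have -> : r%:R ^+ D = 4 ^+ D * k%:R ^+ (3 * D) :> R by rewrite natrM natrX exprMn -exprM.
  have e0 : 0 <= 4 ^+ D * k%:R ^+ (3 * D) * k%:R :> R by rewrite !mulr_ge0 ?exprn_ge0 ?ler0n.
  have h1 := ler_wpM2r e0 cnt'.
  have e1 : 0 <= 4 ^+ D * (K * A).
    by rewrite mulr_ge0 ?exprn_ge0 // mulr_ge0 ?(ltW K0) ?(ltW A0).
  have h2 := ler_wpM2l e1 mp; rewrite exprD in h2.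
  rewrite exprS; lra.
clear cnt hM; set T1 := ((n.+1 %/ s).+1 ^ D)%:R in le up.
set T0 := ((n.+1 %/ r) ^ D)%:R in le low.
set X := ln _ in le.
have lX := log_size hth; rewrite -/r in lX.
have X1 : (J <= (r ^ D * H).+1)%N.
  apply: leq_trans (leqnSn _); apply: (@leq_trans r).
    by apply: leq_trans Jr; rewrite leq_pmull.
  rewrite -[leqLHS]muln1 leq_mul // -[leqLHS]expn1 leq_pexp2l //.
  by rewrite muln_gt0 expn_gt0 k0.
have Xle : X <= (M%:R + 1) * (c_log * l).
  have Xp : 0 < (r ^ D * H).+1%:R :> R by rewrite ltr0n.
  have lX0 : 0 <= ln (r ^ D * H).+1%:R :> R by rewrite ln_ge0 // ler1n.
  rewrite /X natrM natrX lnM ?posrE ?exprn_gt0 // lnXn // mulrDl mul1r addrC.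
  apply: lerD; first by rewrite -[leLHS]mulr_natl ler_wpM2l ?ler0n.
  by apply: le_trans lX; rewrite ler_ln ?posrE // ler_nat.
have M1 : M%:R + 1 <= (K + 1) * (r%:R ^+ D / k%:R ^+ 2).
  rewrite mulrDl mul1r; apply: lerD.
    by apply: le_trans Mle _; rewrite /J natrX mulrA.
  rewrite ler_pdivlMr ?exprn_gt0 // mul1r -!natrX ler_nat -/J.
  apply: (@leq_trans r); first by apply: leq_trans Jr; rewrite leq_pmull.
  by rewrite -[leqLHS]expn1 leq_pexp2l // muln_gt0 expn_gt0 k0.
have err : X / k%:R^-1 + (b - a) ^+ 2 * (b / a * (b / a * r%:R ^+ D)) / p * k%:R^-1 <=
    r%:R ^+ D * (c_err * (l / k%:R)).
  rewrite -/B -/K invrK /c_err mulrDl mulrDr; apply: lerD.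
    have e0 : 0 <= c_log * l by rewrite mulr_ge0 ?c_log_ge0 ?(ltW l0).
    apply: (@le_trans _ _ ((K + 1) * (r%:R ^+ D / k%:R ^+ 2) * (c_log * l) * k%:R)).
      by rewrite ler_pM2r // (le_trans Xle (ler_wpM2r e0 M1)).
    by rewrite le_eqVlt; apply/orP; left; apply/eqP; field; rewrite gt_eqF.
  have e1 : 0 <= B ^+ 2 * K ^+ 2 / p * r%:R ^+ D / k%:R.
    apply: divr_ge0 (ltW kR); apply: mulr_ge0 (ltW rD0); apply: divr_ge0 (ltW p0).
    exact: mulr_ge0 (sqr_ge0 _) (sqr_ge0 _).
  have e2 : 1 <= l / ln 2 by rewrite ler_pdivlMr // mul1r.
  have := ler_wpM2l e1 e2; rewrite mulr1; set y := (X in _ <= X); set x := (X in X <= _).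
  have -> : B ^+ 2 * (K * (K * r%:R ^+ D)) / p * k%:R^-1 = x by rewrite /x; ring.
  by move/le_trans; apply; rewrite le_eqVlt; apply/orP; left; apply/eqP; rewrite /y; ring.
have c0 : 0 <= l / k%:R by rewrite divr_ge0 ?(ltW l0) ?(ltW kR).
have T10 : 0 <= T1 by exact: ler0n.
have part1 : (T1 - T0 + nb%:R) * (b * r%:R ^+ D) <=
    b * (A * ((10 ^+ D + 4 * D%:R + 4 ^+ D.+1 * K) / k%:R)).
  rewrite mulrCA ler_pM2l //.
  rewrite -/A in up low nbr.
  have := up; have := low; rewrite -/r; rewrite !mulrDl mulNr; lra.
have part2 : T1 * (X / k%:R^-1 + (b - a) ^+ 2 * (b / a * (b / a * r%:R ^+ D)) / p * k%:R^-1) <=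
    A * ((1 + 10 ^+ D) * (c_err * (l / k%:R))).
  apply: le_trans (ler_wpM2l T10 err) _; rewrite [leLHS]mulrA [leRHS]mulrA ler_wpM2r //.
    by rewrite mulr_ge0 ?c_err_ge0.
  apply: le_trans up _; rewrite ler_wpM2l ?(ltW A0) // lerD2l ler_pdivrMr //.
  by rewrite ler_peMr ?exprn_ge0 ?ler0n // ler1n.
have part3 : b * (A * ((10 ^+ D + 4 * D%:R + 4 ^+ D.+1 * K) / k%:R)) <=
    b * (A * ((10 ^+ D + 4 * D%:R + 4 ^+ D.+1 * K) / k%:R)) * (l / ln 2).
  rewrite ler_peMr //; last by rewrite ler_pdivlMr // mul1r.
  apply: mulr_ge0 (ltW b0) _; apply: mulr_ge0 (ltW A0) _; apply: divr_ge0 (ltW kR).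
  by move: K (ltW K0) => x x0; rewrite !addr_ge0 ?mulr_ge0 ?exprn_ge0 ?ler0n.
rewrite -(ler_pM2l a0); apply: le_trans le _.
apply: le_trans (lerD (le_trans part1 part3) part2) _.
rewrite /c_bad le_eqVlt; apply/orP; left; apply/eqP.
by field; rewrite !gt_eqF.
Qed.

End Fixed.
End Main.

Section Final.
Variables (R : realType) (D : nat) (a b p : R).
Hypotheses (a0 : 0 < a) (ab : a < b) (D0 : (0 < D)%N) (p1 : p <= 1).

Lemma var_sub (I : eqType) (L Lg : seq I) (F : (I -> bool) -> R) w :
  depends L F -> {subset L <= Lg} -> var p Lg F w = var p L F w.
Proof.
move=> dF LL; rewrite /var (avs_sub p dF LL) (@avs_sub _ _ p L) //.
by move=> v v' vv'; rewrite (dF v v').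
Qed.

Lemma var_flow_pos : 0 < p -> exists C : R, 0 <= C /\
  forall (n H : nat) (w0 : gedge -> bool), (2 <= n)%N -> (ch D a b * n.+1 + n <= H)%N ->
    var p (edges D n.+1 0 H) (flow D a b n.+1 0 H) w0 <= C * (n%:R ^+ D / ln n%:R).
Proof.
move=> p0; pose K : R := b / a; pose B : R := b - a; pose P := (3 * D + 4)%N.
have K0 : 0 < K by rewrite divr_gt0 // (lt_trans a0).
have ln20 : 0 < ln 2 :> R by exact: ln2_gt0.
pose c9 : R := 8 * P%:R ^+ 2.
have c90 : 0 <= c9 by rewrite mulr_ge0 ?exprn_ge0 ?ler0n.
pose cb := `|c_bad D a b p|.
pose C0 : R := 2 * (B ^+ 2 / p * K * (2 * P%:R) + (8 * B ^+ 2 * K * (c9 / ln 2) + B ^+ 2 * (cb * c9)))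
  + 32 * (B ^+ 2 * K) * (c9 / ln 2).
exists (2 ^+ D * `|C0|); split; first by rewrite mulr_ge0 ?exprn_ge0 ?ler0n.
move=> n H w0 n2 hH; have n0 : (0 < n)%N by exact: ltnW.
have P0 : (0 < P)%N by rewrite /P addn_gt0 orbT.
have [k [k0 kn nk]] := scale_exists P0 n0.
have [l1 l2] := ln_scale R k0 n2 nk.
pose m := ((H - ch D a b * n.+1) %/ (2 * k))%N.
pose Lg := edges D (n.+1 + 4 * k ^ 3) 0 (H + m).
pose A : R := n.+1%:R ^+ D; set l := ln n%:R in l1 l2 *.
have l0 : 0 < l by exact: l_gt0.
have lge : ln 2 <= l by exact: l_ge.
have A0 : 0 < A by rewrite exprn_gt0 ?ltr0n.
have kR : 0 < k%:R :> R by rewrite ltr0n.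
have H0 : (0 < H)%N by apply: leq_trans hH; rewrite ltn_addl.
have m0 : (0 < m)%N by exact: (@m_gt0 R D a b n k H n2 k0 kn hH).
have mR : 0 < m%:R :> R by rewrite ltr0n.
have subL : {subset edges D n.+1 0 H <= Lg}.
  move=> e /(edges_sub (leqnn 0) (leq_addr m H)); apply: edges_wide; exact: leq_addr.
rewrite -(@var_sub _ _ Lg (flow D a b n.+1 0 H) w0 (@flow_depends R D a b n.+1 0 H H0) subL).
have hHm : (ch D a b * n.+1 + 2 * k * m <= H)%N.
  have := @m_upper R D a b n k H; rewrite -/m => h.
  by rewrite -leq_subRL ?h // (leq_trans _ hH) ?leq_addr.
have subLg : {subset edges D n.+1 0 (H + m) <= Lg}.
  by move=> e; apply: edges_wide; exact: leq_addr.
have th0 : 0 <= m%:R / k%:R ^+ 2 :> R by rewrite divr_ge0 ?exprn_ge0 ?ler0n.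
have Lam0 : 0 < ln k.+1%:R / 2 :> R by rewrite divr_gt0 // ln_gt0 // ltr1n ltnS.
have := var_flow_le a0 ab D0 (ltW p0) p1 w0 (ltn0Sn n) (uniq_edges D _ _ _) subLg p0 m0 k0 hHm
   (leqnn (H + m)) th0 Lam0.
have bm := @badmass_small R D a b p a0 ab D0 p0 p1 n k H n2 k0 kn hH w0.
rewrite -/m -/Lg -/K -/B -/A -/l in bm *; set bmass := badmass _ _ _ _ _ _ _ _ _ _ in bm *.
move/le_trans; apply.
have B20 : 0 <= B ^+ 2 by exact: sqr_ge0.
have klr : k%:R^-1 <= c9 / ln 2 / l.
  have h1 : l * ln 2 <= c9 * k%:R by apply: le_trans l2; rewrite expr2 ler_pM2l.
  have -> : c9 / ln 2 / l = c9 * k%:R / (l * ln 2) / k%:R.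
    by field; rewrite !gt_eqF.
  rewrite -[leLHS]mul1r ler_pM2r ?invr_gt0 // ler_pdivlMr ?mul1r //.
  exact: mulr_gt0.
have lkr : l / k%:R <= c9 / l.
  have -> : c9 / l = c9 * k%:R / l / k%:R by field; rewrite !gt_eqF.
  by rewrite ler_pM2r ?invr_gt0 // ler_pdivlMr // -expr2.
have KA0 : 0 <= K * A by rewrite mulr_ge0 ?(ltW K0) ?(ltW A0).
have t1 : B ^+ 2 / p * (K * A) / (ln k.+1%:R / 2) <= B ^+ 2 / p * K * (2 * P%:R) * (A / l).
  have -> : B ^+ 2 / p * K * (2 * P%:R) * (A / l) = B ^+ 2 / p * (K * A) * (2 * P%:R / l) by ring.
  apply: ler_wpM2l; first by rewrite mulr_ge0 // divr_ge0 // ltW.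
  rewrite -[leLHS]mul1r ler_pdivrMr // mulrAC ler_pdivlMr // mul1r; apply: le_trans l1 _.
  by rewrite le_eqVlt; apply/orP; left; apply/eqP; field.
have t2 : 4 * B ^+ 2 * expR (2 * (ln k.+1%:R / 2)) * (m%:R / k%:R ^+ 2 / m%:R) * (K * A) <=
    8 * B ^+ 2 * K * (c9 / ln 2) * (A / l).
  have -> : 2 * (ln k.+1%:R / 2) = ln k.+1%:R :> R by field.
  rewrite lnK ?posrE ?ltr0n //.
  have -> : 8 * B ^+ 2 * K * (c9 / ln 2) * (A / l) = 4 * B ^+ 2 * (2 * (c9 / ln 2 / l)) * (K * A) by ring.
  have h : k.+1%:R * (m%:R / k%:R ^+ 2 / m%:R) <= 2 * (c9 / ln 2 / l).
    apply: (@le_trans _ _ (2 * k%:R^-1)); last by rewrite ler_wpM2l ?ler0n.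
    have -> : k.+1%:R * (m%:R / k%:R ^+ 2 / m%:R) = k.+1%:R / k%:R * k%:R^-1 :> R.
      by field; rewrite !gt_eqF.
    rewrite ler_wpM2r ?invr_ge0 ?ler0n // ler_pdivrMr // -natr1.
    have : 1 <= k%:R :> R by rewrite ler1n.
    lra.
  rewrite -[4 * B ^+ 2 * k.+1%:R * _]mulrA ler_wpM2r //; apply: ler_wpM2l h.
  by rewrite mulr_ge0 ?ler0n.
have t3 : B ^+ 2 * bmass <= B ^+ 2 * (cb * c9) * (A / l).
  rewrite -mulrA ler_wpM2l //; apply: le_trans bm _.
  apply: (@le_trans _ _ (cb * (A * (l / k%:R)))).
    by rewrite ler_wpM2r ?ler_norm // mulr_ge0 ?divr_ge0 ?(ltW A0) ?(ltW l0) ?(ltW kR).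
  have -> : cb * c9 * (A / l) = cb * (A * (c9 / l)) by ring.
  by rewrite ler_wpM2l ?normr_ge0 // ler_wpM2l ?(ltW A0).
have t4 : 32 * (B ^+ 2 * (K * A)) / k%:R <= 32 * (B ^+ 2 * K) * (c9 / ln 2) * (A / l).
  have -> : 32 * (B ^+ 2 * K) * (c9 / ln 2) * (A / l) = 32 * (B ^+ 2 * (K * A)) * (c9 / ln 2 / l) by ring.
  by rewrite ler_wpM2l // mulr_ge0 ?ler0n // mulr_ge0.
apply: (@le_trans _ _ (C0 * (A / l))).
  have -> : C0 * (A / l) = 2 * (B ^+ 2 / p * K * (2 * P%:R) * (A / l) +
      (8 * B ^+ 2 * K * (c9 / ln 2) * (A / l) + B ^+ 2 * (cb * c9) * (A / l))) +
      32 * (B ^+ 2 * K) * (c9 / ln 2) * (A / l) by rewrite /C0; ring.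
  apply: lerD; last exact: t4.
  rewrite ler_wpM2l ?ler0n //.
  by apply: lerD; first exact: t1; apply: lerD; [exact: t2|exact: t3].
have Al : 0 <= A / l by rewrite divr_ge0 ?(ltW A0) ?(ltW l0).
apply: (@le_trans _ _ (`|C0| * (A / l))); first exact: (ler_wpM2r Al (ler_norm C0)).
have -> : 2 ^+ D * `|C0| * (n%:R ^+ D / l) = `|C0| * (2 ^+ D * n%:R ^+ D / l) by ring.
rewrite ler_wpM2l ?normr_ge0 // ler_pM2r ?invr_gt0 // -exprMn lerXn2r ?nnegrE ?mulr_ge0 ?ler0n //.
by rewrite -natrM ler_nat; clear -n2; lia.
Qed.

Theorem var_flow_bound : 0 <= p -> exists C : R, 0 <= C /\
  forall (n H : nat) (w0 : gedge -> bool), (2 <= n)%N -> (ch D a b * n.+1 + n <= H)%N ->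
    var p (edges D n.+1 0 H) (flow D a b n.+1 0 H) w0 <= C * (n%:R ^+ D / ln n%:R).
Proof.
rewrite le_eqVlt => /orP[/eqP pE|]; last exact: var_flow_pos.
exists 0; split=> // n H w0 _ _; rewrite mul0r.
have p00 : 0 <= p by rewrite -pE.
apply: le_trans (efron_stein p00 p1 _ _ (uniq_edges D _ _ _)) _.
by rewrite -pE !mul0r.
Qed.

End Final.

Local Open Scope classical_set_scope.
Local Open Scope ring_scope.

(** * From the lattice to independent bits *)

Section IntegralModification.
Context {disp : measure_display} {T : measurableType disp} {R : realType}.
Variable mu : {measure set T -> \bar R}.
Local Open Scope ereal_scope.
Import HBNNSimple.

Lemma ge0_integral_mono (f g : T -> \bar R) : (forall x, 0 <= f x) ->
  (forall x, f x <= g x) -> \int[mu]_x f x <= \int[mu]_x g x.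
Proof.
move=> f0 fg; have g0 x : 0 <= g x by exact: le_trans (f0 x) (fg x).
rewrite !ge0_integralTE //; apply: ereal_sup_le => _ [h /= hf <-].
by exists h => //= x; exact: le_trans (hf x) (fg x).
Qed.

(* The maximal flow is only controlled off a null set, on which it may fail to
   be measurable. *)
Lemma ge0_integral_modif (N : set T) (f g : T -> \bar R) :
  measurable N -> mu N = 0 -> measurable_fun setT g ->
  (forall x, 0 <= f x) -> (forall x, 0 <= g x) -> (forall x, ~ N x -> f x = g x) ->
  \int[mu]_x f x = \int[mu]_x g x.
Proof.
move=> mN N0 mg f0 g0 fg.
pose g1 x := if x \in N then 0 else g x; pose g2 x := if x \in N then +oo else g x.
have mN' : measurable_fun setT (fun x => x \in N).
  by apply: (measurable_fun_bool true); rewrite setTI (_ : _ @^-1` _ = N) //; apply/seteqP; split=> x /= => [/set_mem|/mem_set].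
have mg1 : measurable_fun setT g1 by exact: measurable_fun_ifT.
have mg2 : measurable_fun setT g2 by exact: measurable_fun_ifT.
have ae h : (forall x, ~ N x -> h x = g x) -> ae_eq mu setT h g.
  move=> hg; exists N; split=> // x /= /not_implyP[_ hgx].
  by apply: contrapT => /hg.
have g1E x : ~ N x -> g1 x = g x by move=> Nx; rewrite /g1 ifF //; apply/negbTE/negP => /set_mem.
have g2E x : ~ N x -> g2 x = g x by move=> Nx; rewrite /g2 ifF //; apply/negbTE/negP => /set_mem.
have g10 x : 0 <= g1 x by rewrite /g1; case: ifP.
have g20 x : 0 <= g2 x by rewrite /g2; case: ifP => // _; exact: leey.
have i1 : \int[mu]_x g1 x = \int[mu]_x g x.
  by apply: ge0_ae_eq_integral => //; exact: ae.
have i2 : \int[mu]_x g2 x = \int[mu]_x g x.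
  by apply: ge0_ae_eq_integral => //; exact: ae.
apply/eqP; rewrite eq_le -{1}i2 -i1; apply/andP; split; apply: ge0_integral_mono => // x.
  have [Nx|Nx] := pselect (N x); first by rewrite /g2 mem_set ?leey.
  by rewrite g2E // fg.
have [Nx|Nx] := pselect (N x); first by rewrite /g1 mem_set.
by rewrite g1E // fg.
Qed.

Lemma integral_modif (N : set T) (f g : T -> \bar R) :
  measurable N -> mu N = 0 -> measurable_fun setT g ->
  (forall x, ~ N x -> f x = g x) -> \int[mu]_x f x = \int[mu]_x g x.
Proof.
move=> mN N0 mg fg; rewrite integralE [RHS]integralE; congr (_ - _).
  apply: (ge0_integral_modif mN N0) => //; first exact: measurable_funepos.
  by move=> x /fg; rewrite !funeposE => ->.
apply: (ge0_integral_modif mN N0) => //; first exact: measurable_funeneg.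
by move=> x /fg; rewrite !funenegE => ->.
Qed.

End IntegralModification.

Section Independent.
Context (R : realType) (disp : measure_display) (Omega : measurableType disp)
  (P : probability Omega R) (I : choiceType) (X : I -> {RV P >-> R})
  (G : probability R R) (a : R).
Hypothesis iidX : iid_with_law X G.

Let p : R := fine (G [set a]).
Let bits (w : Omega) : I -> bool := fun i => X i w == a.

Let A (s : I -> bool) i : set R := if s i then [set a] else ~` [set a].
Let B (J : {fset I}) s : set Omega := \bigcap_(i in [set` J]) (X i @^-1` A s i).

Let mA s i : measurable (A s i).
Proof. by rewrite /A; case: ifP => _; [|apply: measurableC]; exact: measurable_set1. Qed.

Let mB J s : measurable (B J s).
Proof.
apply: fin_bigcap_measurable => // i _.
by rewrite -[X in measurable X]setTI; apply: measurable_funP.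
Qed.

Let p_fin : G [set a] \is a fin_num.
Proof. exact: fin_num_measure. Qed.

Let PA s i : P (X i @^-1` A s i) = (if s i then p else 1 - p)%:E.
Proof.
case: iidX => _ lawX; transitivity (distribution P (X i) (A s i)); first by [].
rewrite lawX // /A; case: ifP => _; first by rewrite /p fineK.
by rewrite probability_setC // EFinB /p fineK.
Qed.

Let pr (J : {fset I}) (s : I -> bool) : R := \prod_(i <- J) (if s i then p else 1 - p).

Let PB J s : P (B J s) = (pr J s)%:E.
Proof.
case: (iidX) => indX _; rewrite /B indX; last exact: mA.
rewrite -prodEFin; apply: eq_bigr => i _; exact: PA.
Qed.

Let prU J s e c : e \notin J ->
  pr (e |` J)%fset (upd s e c) = (if c then p else 1 - p) * pr J s.
Proof.
move=> eJ; rewrite /pr big_fsetU1 //= /upd eqxx; congr (_ * _).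
apply: eq_big_seq => i iJ; case: eqP => // ie.
by move: eJ; rewrite -ie iJ.
Qed.

Let BU J s e c w : e \notin J -> B (e |` J)%fset (upd s e c) w <-> B J s w /\ bits w e = c.
Proof.
move=> eJ; have Ae : A (upd s e c) e (X e w) <-> bits w e = c.
  rewrite /A /upd eqxx /bits; case: c => /=; first by split=> /eqP.
  by split=> [h|/negbT/eqP h]; first exact/negbTE/eqP.
have Ai i : i \in J -> A (upd s e c) i = A s i.
  by move=> iJ; rewrite /A /upd; case: eqP => // ie; move: eJ; rewrite -ie iJ.
split=> [h|[h hc] i /=].
  split; last by apply/Ae; apply: h; rewrite /= !inE eqxx.
  by move=> i /= iJ; rewrite /preimage /= -(Ai i) //; apply: h; rewrite /= !inE iJ orbT.
rewrite !inE => /orP[/eqP ->|iJ]; first exact/Ae.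
by rewrite /preimage /= (Ai i) //; apply: h.
Qed.

Lemma integral_bits_event (L : seq I) (F : (I -> bool) -> R) (J : {fset I}) s w0 :
  depends L F -> uniq L -> {in L, forall i, i \notin J} ->
  P.-integrable setT (EFin \o (fun w => F (bits w) * \1_(B J s) w)) /\
  (\int[P]_w (F (bits w) * \1_(B J s) w)%:E = (avs p L F w0 * pr J s)%:E)%E.
Proof.
elim: L F J s => [|e L IH] F J s dF.
  move=> _ _; have Fc w : F (bits w) = F w0 by exact: dF.
  have iB : P.-integrable setT (fun x => (\1_(B J s) x)%:E) by apply: integrable_indic.
  split.
    apply: (eq_integrable _ (fun w => ((F w0)%:E * (\1_(B J s) w)%:E)%E)) => //.
      by move=> w _ /=; rewrite Fc EFinM.
    exact: integrableZl.
  under eq_integral do rewrite Fc EFinM.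
  by rewrite integralZl // integral_indic // setIT EFinM -PB.
move=> /= /andP[eL uL] LJ.
have eJ : e \notin J by apply: LJ; rewrite mem_head.
pose F_ c v := F (upd v e c).
have dF_ c : depends L (F_ c).
  move=> v v' vv'; apply: dF => i; rewrite inE /upd.
  by case: eqP => //= _ /vv'.
have LJ' : {in L, forall i, i \notin (e |` J)%fset}.
  move=> i iL; rewrite !inE negb_or LJ ?inE ?iL ?orbT // andbT.
  by apply: contraNneq eL => <-.
have [i1 e1] := IH (F_ true) (e |` J)%fset (upd s e true) (dF_ _) uL LJ'.
have [i0 e0] := IH (F_ false) (e |` J)%fset (upd s e false) (dF_ _) uL LJ'.
set f1 := (fun w : Omega => F_ true (bits w) * \1_(B (e |` J)%fset (upd s e true)) w) in i1.
set f0 := (fun w : Omega => F_ false (bits w) * \1_(B (e |` J)%fset (upd s e false)) w) in i0.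
have split_e w : F (bits w) * \1_(B J s) w = f1 w + f0 w.
  rewrite /f1 /f0 !indicE.
  have bw c : (w \in B (e |` J)%fset (upd s e c)) = (w \in B J s) && (bits w e == c).
    apply/idP/andP => [/set_mem /(BU _ _ _ eJ)[h1 ->]|[/set_mem h1 /eqP h2]].
      by split=> //; exact/mem_set.
    by apply/mem_set; apply/(BU _ _ _ eJ).
  have bF c : bits w e = c -> F_ c (bits w) = F (bits w).
    by move=> <-; rewrite /F_ upd_id.
  rewrite !bw; case: (bits w e) (bF (bits w e)) => /(_ erefl) ->;
    by rewrite ?andbT ?andbF ?mulr0 ?addr0 ?add0r.
split.
  apply: (eq_integrable _ ((EFin \o f1) \+ (EFin \o f0))%E) => //.
    by move=> w _ /=; rewrite split_e EFinD.
  exact: integrableD.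
under eq_integral do rewrite split_e EFinD.
rewrite (integralD_EFin _ i1 i0) // [X in (X + _)%E]e1 [X in (_ + X)%E]e0 -EFinD; congr EFin.
rewrite !prU // /av avsD !avsZ; ring.
Qed.

Lemma expectation_bits (L : seq I) (F : (I -> bool) -> R) w0 :
  depends L F -> uniq L ->
  measurable_fun setT (fun w => F (bits w)) /\ (\int[P]_w (F (bits w))%:E = (avs p L F w0)%:E)%E.
Proof.
move=> dF uL; have [|i0 e0] := @integral_bits_event L F fset0 (fun=> true) w0 dF uL; first by [].
have E w : F (bits w) * \1_(B fset0 (fun=> true)) w = F (bits w).
  by rewrite indicE mem_set ?mulr1 // => i.
split; last first.
  under eq_integral do rewrite -E.
  by rewrite e0 /pr big_seq_fset0 mulr1.
have /integrableP[/measurable_EFinP + _] := i0.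
by rewrite (_ : (fun w => _) = fun w => F (bits w)) //; apply/funext => w.
Qed.
End Independent.

Lemma iid_two_values (R : realType) (disp : measure_display) (Omega : measurableType disp)
    (P : probability Omega R) (I : countType) (X : I -> {RV P >-> R})
    (G : probability R R) (a b : R) :
  iid_with_law X G -> G [set a; b] = 1%E ->
  exists N, [/\ measurable N, P N = 0%E & forall w, ~ N w -> forall i, X i w = a \/ X i w = b].
Proof.
move=> [_ lawX] Gab.
have mab : measurable [set a; b] by apply: measurableU; exact: measurable_set1.
pose F k : set Omega := if (choice.unpickle k : option I) is Some i then X i @^-1` ~` [set a; b] else set0.
have mF k : measurable (F k).
  rewrite /F; case: (choice.unpickle k : option I) => // i; rewrite -[X in measurable X]setTI.
  by apply: measurable_funP => //; exact: measurableC.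
exists (\bigcup_k F k); split; first exact: bigcup_measurable.
  apply/negligibleP; first exact: bigcup_measurable.
  apply: negligible_bigcup => k; apply/negligibleP => //.
  rewrite /F; case: (choice.unpickle k : option I) => [i|]; last exact: measure0.
  transitivity (distribution P (X i) (~` [set a; b])); first by [].
  by rewrite lawX ?probability_setC ?Gab ?subee //; exact: measurableC.
move=> w Nw i; apply: contrapT => h; apply: Nw; exists (choice.pickle i) => //.
by rewrite /F choice.pickleK.
Qed.

Lemma variance_bits (R : realType) (disp : measure_display) (Omega : measurableType disp)
    (P : probability Omega R) (I : choiceType) (X : I -> {RV P >-> R})
    (G : probability R R) (a : R) (L : seq I) (F : (I -> bool) -> R) (N : set Omega)
    (Y : Omega -> R) w0 :
  iid_with_law X G -> depends L F -> uniq L -> measurable N -> P N = 0%E ->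
  (forall w, ~ N w -> Y w = F (fun i => X i w == a)) ->
  ('V_P[Y] = (var (fine (G [set a])) L F w0)%:E)%E.
Proof.
move=> iidX dF uL mN N0 YF; pose p := fine (G [set a]).
rewrite /variance unlock unlock.
have [mF eF] := expectation_bits a iidX w0 dF uL.
have -> : (\int[P]_w (Y w)%:E = (avs p L F w0)%:E)%E.
  rewrite -eF; apply: (integral_modif mN N0); first exact/measurable_EFinP.
  by move=> w /YF ->.
set c := avs p L F w0.
pose F2 v := (F v - c) ^+ 2.
have dF2 : depends L F2 by move=> v v' vv'; rewrite /F2 (dF _ _ vv').
have [mF2 eF2] := expectation_bits a iidX w0 dF2 uL.
transitivity (\int[P]_w (F2 (fun i => X i w == a))%:E)%E.
  apply: (integral_modif mN N0); first exact/measurable_EFinP.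
  by move=> w /YF Yw; congr EFin; rewrite /F2 -Yw expr2.
rewrite eF2; congr EFin; rewrite /var -/p.
have -> : F2 = fun v => F v ^+ 2 + ((- (2 * c)) * F v + c ^+ 2).
  by apply/funext => v; rewrite /F2; ring.
by rewrite !avsD avsZ avsC -/c; ring.
Qed.

Section Embedding.
Variable D : nat.
Local Notation V := (vertex D.+1).
Local Notation E := (edge D.+1).
Implicit Types (g : gvertex) (e : gedge) (n H : nat) (v : V).

Definition lattice_vertex g : V := \row_i (if (i : nat) == D then g.2 else nth 0%N g.1 i)%:Z.

Definition lattice_edge e : E := (lattice_vertex (gsrc e), inord e.1.1).

Definition grid_vertex v : gvertex :=
  (mkseq (fun i => `|v 0%R (inord i)|%N) D, `|v 0%R ord_max|%N).

Lemma grid_vertexK n H v : cylinder n H v -> lattice_vertex (grid_vertex v) = v.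
Proof.
move=> cv; apply/rowP => i; rewrite mxE /=.
have vi : (`|v 0%R i|%N)%:Z = v 0 i by rewrite gez0_abs //; case/andP: (cv i).
case: eqP => iD; first by rewrite (_ : ord_max = i) //; apply/val_inj.
rewrite nth_mkseq; first by rewrite inord_val.
by have := ltn_ord i; rewrite ltnS leq_eqVlt => /orP[/eqP|].
Qed.

Lemma lattice_vertexK n g : g.1 \in pts n D -> grid_vertex (lattice_vertex g) = g.
Proof.
case: g => x z; rewrite mem_pts => /andP[/eqP sx _]; rewrite /grid_vertex mxE /= eqxx; congr pair.
apply: (@eq_from_nth _ 0%N) => [|i]; rewrite size_mkseq ?sx // => iD.
by rewrite nth_mkseq // mxE inordK ?(ltn_eqF iD) // ltnS ltnW.
Qed.

Lemma grid_vertex_cylinder n H v : cylinder n H v ->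
  (grid_vertex v).1 \in pts n.+1 D /\ ((grid_vertex v).2 <= H)%N.
Proof.
move=> cv; split; last first.
  have /andP[v0] := cv ord_max; rewrite eqxx /= => vH.
  by rewrite -lez_nat gez0_abs.
rewrite mem_pts size_mkseq eqxx /=; apply/allP => c /mapP[i]; rewrite mem_iota => /= iD ->.
have /andP[v0] := cv (inord i); rewrite inordK ?ltnS ?(ltnW iD) // (ltn_eqF iD) => vn.
by rewrite -lez_nat gez0_abs.
Qed.

Lemma lattice_vertex_cylinder n H g : g.1 \in pts n.+1 D -> (g.2 <= H)%N ->
  cylinder n H (lattice_vertex g).
Proof.
case: g => x z; rewrite mem_pts => /andP[/eqP sx /allP xn] zH i; rewrite mxE /=.
case: eqP => iD; first by rewrite lez_nat zH.
rewrite lez_nat -ltnS; apply: xn; rewrite mem_nth // sx.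
by have := ltn_ord i; rewrite ltnS leq_eqVlt => /orP[/eqP|].
Qed.

Lemma lattice_edge_joins n H e : e \in edges D n.+1 0 H ->
  edge_joins (lattice_edge e) (lattice_vertex (gsrc e)) (lattice_vertex (gtgt D e)).
Proof.
case: e => [[i x] z] eL; left; split=> //; apply/rowP => j; rewrite !mxE eqxx /=.
have jD := ltn_ord j; rewrite ltnS in jD.
move: eL; rewrite mem_edges mem_hcols => /orP[/andP[/and3P[iD xN xi] _]|/and3P[/eqP -> xN _]].
  rewrite /gtgt /= iD /= -val_eqE /= inordK ?ltnS ?(ltnW iD) //.
  case: eqP => [jE|jE]; first by rewrite jE (gtn_eqF iD) addr0.
  by rewrite nth_incr_nth PoszD [RHS]addrC eq_sym; congr (_ + _); case: (_ == _).
rewrite /gtgt /= ltnn -val_eqE /= inordK //.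
by case: eqP => _; rewrite ?addr0 // -addn1 PoszD.
Qed.

Lemma lattice_edge_inj n H : {in edges D n.+1 0 H &, injective lattice_edge}.
Proof.
move=> [[i x] z] [[j y] z'] eL eL' [/(congr1 grid_vertex)].
rewrite !(@lattice_vertexK n.+1); try by have [] := edges_pts eL; have [] := edges_pts eL'.
move=> [-> ->] /(congr1 val) /=.
have iD k x' z'' : ((k, x'), z'') \in edges D n.+1 0 H -> (k < D.+1)%N.
  by rewrite mem_edges mem_hcols => /orP[/andP[/and3P[/ltnW]]|/and3P[/eqP ->]].
by rewrite !inordK ?(iD _ _ _ eL) ?(iD _ _ _ eL') // => ->.
Qed.

Lemma lattice_edge_surj n H u v : cylinder n H u -> cylinder n H v -> neighbours u v ->
  exists2 e, e \in edges D n.+1 0 H & edge_joins (lattice_edge e) u v.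
Proof.
move=> cu cv /neighboursP[[x0 i] [h _]].
have [cx cx1] : cylinder n H x0 /\ cylinder n H (x0 + delta_mx 0 i).
  by case: h => /= -[-> ->] in cu cv *.
have [px zH] := grid_vertex_cylinder cx.
set g := grid_vertex x0 in px zH.
have eE : lattice_edge (((i : nat), g.1), g.2) = (x0, i).
  have -> : lattice_edge (((i : nat), g.1), g.2) = (lattice_vertex g, i).
    by rewrite /lattice_edge /gsrc /= inord_val.
  by rewrite (grid_vertexK cx).
exists ((((i : nat), g.1), g.2) : gedge); last by rewrite eE.
have xi : x0 0 i = (nth 0%N (rcons g.1 g.2) i)%:Z.
  have := grid_vertexK cx => /rowP/(_ i) <-; rewrite -/g mxE nth_rcons.
  move: px; rewrite mem_pts => /andP[/eqP -> _]; have := ltn_ord i; rewrite ltnS leq_eqVlt.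
  by case: eqP => [->|_ /= ->]; rewrite ?ltnn.
have := cx1 i; rewrite !mxE !eqxx xi => /andP[_].
move: px; rewrite mem_edges mem_hcols => px.
have sg : size g.1 = D by move: px; rewrite mem_pts => /andP[/eqP].
rewrite nth_rcons sg px -[X in _ + X%:R]/1%N -PoszD lez_nat addn1.
case: eqP => [->|/eqP iD]; first by rewrite ltnn => ->.
by have := ltn_ord i; rewrite ltnS leq_eqVlt (negbTE iD) /= => -> xn; rewrite ltnS xn zH.
Qed.

Lemma cutb_joins n H (S : gvertex -> bool) e u v : e \in edges D n.+1 0 H ->
  edge_joins (lattice_edge e) u v ->
  cutb gsrc (gtgt D) S e = (S (grid_vertex u) != S (grid_vertex v)).
Proof.
move=> eL; have [ps pt] := edges_pts eL.
rewrite /cutb -{1}(lattice_vertexK ps) -{1}(lattice_vertexK pt).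
have [[_ ->]|[_ h]] := lattice_edge_joins eL; last first.
  move: h; rewrite -[LHS]addr0 => /addrI/esym/rowP/(_ (lattice_edge e).2).
  by rewrite !mxE !eqxx.
by case=> [[-> ->]|[-> ->]] //; rewrite eq_sym.
Qed.

Lemma path_uses_cut n H (S : gvertex -> bool) x p :
  path (@neighbours D.+1) x p -> (forall y, y \in x :: p -> cylinder n H y) ->
  S (grid_vertex x) -> ~~ S (grid_vertex (last x p)) ->
  exists2 e, (e \in edges D n.+1 0 H) && cutb gsrc (gtgt D) S e & path_uses x p (lattice_edge e).
Proof.
elim: p x => [|y p IH] x /=; first by move=> _ _ ->.
move=> /andP[xy yp] cyl Sx Sl.
have [Sy|Sy] := boolP (S (grid_vertex y)); last first.
  have [||e eL eJ] := @lattice_edge_surj n H x y _ _ xy.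
  - by apply: cyl; rewrite !inE eqxx.
  - by apply: cyl; rewrite !inE eqxx orbT.
  exists e; first by rewrite eL (cutb_joins S eL eJ) Sx (negbTE Sy).
  by exists 0%N.
have [|e eL [k kp eJ]] := IH y yp _ Sy Sl.
  by move=> z zp; apply: cyl; rewrite inE zp orbT.
exists e => //; exists k.+1 => //=.
rewrite (set_nth_default y) //; first by rewrite [nth x p k](set_nth_default y).
exact: leqW.
Qed.

Definition avoids (F : set E) (x : V) p : Prop := forall e : E, path_uses x p e -> ~ F e.

Definition reachable n H (F : set E) v : Prop :=
  exists x p, [/\ path (@neighbours D.+1) x p, Defs.bottom n H x,
    (forall y, y \in x :: p -> cylinder n H y), last x p = v & avoids F x p].

Lemma reachable_step n H (F : set E) u v (e : E) : reachable n H F u -> cylinder n H v ->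
  neighbours u v -> edge_joins e u v -> ~ F e -> reachable n H F v.
Proof.
move=> [x [p [pp bx cyl <- av]]] cv uv euv Fe.
exists x, (rcons p v); split=> //.
- by rewrite rcons_path pp.
- by move=> y; rewrite -rcons_cons mem_rcons inE => /orP[/eqP ->|/cyl].
- exact: last_rcons.
move=> e' [k]; rewrite size_rcons ltnS leq_eqVlt => /orP[/eqP ->|kp].
  rewrite -rcons_cons !nth_rcons /= ltnS leqnn ltnn eqxx -(last_nth x) => e'uv.
  have /neighboursP[e0 [_ e0u]] := uv.
  by rewrite -(e0u _ e'uv) (e0u _ euv).
rewrite -rcons_cons !nth_rcons kp /= ltnS (ltnW kp) => e'uv.
by apply: av; exists k.
Qed.

End Embedding.

Section MaxFlow.
Variables (R : realType) (D : nat) (a b : R) (n H : nat) (t : edge D.+1 -> R).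
Hypotheses (a0 : 0 < a) (ab : a < b) (H0 : (0 < H)%N) (tab : forall e, t e = a \/ t e = b).

Let w e := t (lattice_edge D e) == a.
Local Notation L := (edges D n.+1 0 H).
Local Notation cutb := (cutb gsrc (gtgt D)).
Local Notation cost := (cost gsrc (gtgt D) a b L w).

Let tau_w e : tau a b w e = t (lattice_edge D e).
Proof.
rewrite /tau /w; case: (tab (lattice_edge D e)) => ->; rewrite ?eqxx //.
by rewrite gt_eqF.
Qed.

Let t0 e : 0 <= t e.
Proof. by case: (tab e) => ->; rewrite ltW // (lt_trans a0). Qed.

Let boundary (S : gvertex -> bool) : seq (edge D.+1) :=
  [seq lattice_edge D e | e <- L & cutb S e].

Let uniq_boundary S : uniq (boundary S).
Proof.
rewrite map_inj_in_uniq ?filter_uniq ?uniq_edges // => e e'.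
by rewrite !mem_filter => /andP[_ eL] /andP[_ eL']; exact: lattice_edge_inj eL eL'.
Qed.

Let sum_boundary S : (\sum_(e \in [set` boundary S]) (t e)%:E = (cost S)%:E)%E.
Proof.
rewrite -fsbig_seq ?uniq_boundary // sumEFin big_map big_filter; congr EFin.
by apply: eq_bigr => e _; rewrite tau_w.
Qed.

Let capacity_boundary S : capacity t [set` boundary S] = (cost S)%:E.
Proof.
rewrite /capacity esum_fset; first exact: sum_boundary.
  exact: finite_seq.
by move=> e _; rewrite lee_fin.
Qed.

Let crossing_cutset S : crossing D n.+1 0 H S -> cutset n H [set` boundary S].
Proof.
move=> cS x p [pp [cx bx] [cl tl] cyl].
have [px zx] := grid_vertex_cylinder cx.
have [pl zl] := grid_vertex_cylinder cl.
have z0 : (grid_vertex x).2 = 0%N by rewrite /= bx.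
have zH : (grid_vertex (last x p)).2 = H by rewrite /= tl.
have [|| e eL eU] := @path_uses_cut D n H S x p pp cyl.
- by move: (cS _ px).1; rewrite -z0 -surjective_pairing.
- by move: (cS _ pl).2; rewrite -zH -surjective_pairing => ->.
exists (lattice_edge D e) => //=; apply: map_f.
by rewrite mem_filter andbC.
Qed.

Let cutset_capacity F : cutset n H F -> ((flow D a b n.+1 0 H w)%:E <= capacity t F)%E.
Proof.
move=> cF; pose S g := `[< reachable n H F (lattice_vertex D g) >].
have cS : crossing D n.+1 0 H S.
  move=> x xN; split.
    have cx := @lattice_vertex_cylinder D n H (x, 0%N) xN (leq0n _).
    apply/asboolP; exists (lattice_vertex D (x, 0%N)), [::]; split=> //.
    - by split=> // i iD; rewrite mxE iD eqxx.
    - by move=> y; rewrite inE => /eqP ->.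
    - by move=> e [].
  apply/negbTE/negP => /asboolP[y [p [pp by_ cyl lE av]]].
  have [|e Fe pe] := cF y p; last exact: av pe Fe.
  split=> //; rewrite lE; split; first exact: lattice_vertex_cylinder.
  by move=> i iD; rewrite mxE iD eqxx.
apply: (@le_trans _ _ (cost S)%:E); first by rewrite lee_fin; exact: flow_le.
apply: esum_ge; exists [set` boundary S]; last by rewrite sum_boundary.
split; first exact: finite_seq.
move=> _ /mapP[e + ->]; rewrite mem_filter => /andP[ce eL].
have eJ := lattice_edge_joins eL.
have [ps pt] := edges_pts eL.
have [zs zt] : ((gsrc e).2 <= H)%N /\ ((gtgt D e).2 <= H)%N.
  case: e eL {ce eJ ps pt} => [[i x] z]; rewrite mem_edges mem_hcols /gsrc /gtgt /=.
  move=> /orP[/andP[/and3P[iD _ _]]|/and3P[/eqP -> _]]; first by rewrite iD.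
  by rewrite ltnn => /= zH; split=> //; exact: ltnW.
have cs := lattice_vertex_cylinder ps zs; have ct := lattice_vertex_cylinder pt zt.
have nst : neighbours (lattice_vertex D (gsrc e)) (lattice_vertex D (gtgt D e)).
  by case: eJ => -[-> ->]; rewrite ?(neighbours_sym (_ + _)) neighbours_delta.
apply: contrapT => Fe; move: ce; rewrite /cutb.
have [/asboolP rs|/asboolP rs] := boolP (S (gsrc e)).
  by rewrite (_ : S (gtgt D e)) //; apply/asboolP; exact: reachable_step rs ct nst eJ Fe.
have [/asboolP rt _|//] := boolP (S (gtgt D e)).
apply: rs; apply: reachable_step rt cs _ _ Fe; first by rewrite neighbours_sym.
by case: eJ => h; [right|left].
Qed.

Lemma max_flow_eq : max_flow n H t = flow D a b n.+1 0 H w.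
Proof.
have fE : (ereal_inf [set capacity t F | F in @cutset D.+1 n H] = (flow D a b n.+1 0 H w)%:E)%E.
  apply/eqP; rewrite eq_le; apply/andP; split.
    have cO := @optcut_crossing R D a b n.+1 0 H w H0.
    apply: ge_ereal_inf; exists (cost (optcut D a b n.+1 0 H w))%:E => //.
    by exists [set` boundary (optcut D a b n.+1 0 H w)]; [exact: crossing_cutset|exact: capacity_boundary].
  by apply: le_ereal_inf_tmp => _ [F cF <-]; exact: cutset_capacity.
by rewrite /max_flow fE.
Qed.

End MaxFlow.

Lemma var_relabel (R : realType) (I I' : eqType) (p : R) (f : I -> I') (s : seq I)
    (F : (I -> bool) -> R) w :
  uniq s -> {in s &, injective f} -> depends s F ->
  var p (map f s) (fun v => F (v \o f)) w = var p s F (w \o f).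
Proof.
move=> us finj dF; rewrite /var avs_relabel //; congr (_ - _).
by apply: (@avs_relabel _ _ _ p f s (fun v => F v ^+ 2)) => // v v' vv'; rewrite (dF v v').
Qed.

Lemma variance_max_flow (R : realType) (D : nat) (a b : R) (G : probability R R)
    (disp : measure_display) (Omega : measurableType disp) (P : probability Omega R)
    (t : edge D.+1 -> {RV P >-> R}) (n H : nat) :
  0 < a -> a < b -> G [set a; b] = 1%E -> iid_with_law t G -> (0 < H)%N ->
  ('V_P[fun w : Omega => max_flow n H (fun e : edge D.+1 => t e w)] =
   (var (fine (G [set a])) (edges D n.+1 0 H) (flow D a b n.+1 0 H) (fun=> true))%:E)%E.
Proof.
move=> a0 ab Gab iidt H0.
have [N [mN N0 tN]] := iid_two_values iidt Gab.
have dF := @flow_depends R D a b n.+1 0 H H0.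
pose F' (v : edge D.+1 -> bool) := flow D a b n.+1 0 H (v \o lattice_edge D).
pose L' := map (lattice_edge D) (edges D n.+1 0 H).
have dF' : depends L' F'.
  by move=> v v' vv'; apply: dF => e eL; apply: vv'; exact: map_f.
have uL' : uniq L'.
  by rewrite map_inj_in_uniq ?uniq_edges //; exact: lattice_edge_inj.
rewrite (@variance_bits _ _ _ _ _ _ _ a L' F' N _ (fun=> true) iidt dF' uL' mN N0).
  by rewrite var_relabel //; [exact: uniq_edges|exact: lattice_edge_inj].
by move=> w Nw; rewrite (max_flow_eq n a0 ab H0 (tN w Nw)).
Qed.

Theorem theorem1p1 (R : realType) (d : nat) (a b : R) (G : probability R R) :
  (2 <= d)%N -> 0 < a -> a < b -> G [set a; b] = 1%E ->
  exists C h0 : R, [/\ 0 < C, 0 < h0 &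
    forall (disp : measure_display) (Omega : measurableType disp)
      (P : probability Omega R) (t : edge d -> {RV P >-> R}),
      iid_with_law t G ->
      forall n H : nat, (1 <= n)%N -> h0 * n%:R <= H%:R ->
        ('V_P[fun w : Omega => max_flow n H (fun e : edge d => t e w)] <=
         if n == 1%N then +oo else (C * (n%:R ^+ d.-1 / ln n%:R))%:E)%E].
Proof.
case: d => // -[//|D] _ a0 ab Gab.
have p0 : 0 <= fine (G [set a]) by rewrite fine_ge0.
have p1 : fine (G [set a]) <= 1.
  by rewrite -lee_fin fineK ?fin_num_measure // probability_le1.
have [C [C0 hC]] := @var_flow_bound R D.+1 a b _ a0 ab isT p1 p0.
exists (C + 1), (2 * ch D.+1 a b + 1)%:R; split; rewrite ?ltr_wpDl ?ltr0n ?addn1 //.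
move=> disp Omega P t iidt n H n1; rewrite -natrM ler_nat => hH.
case: eqVneq => [_|n2]; first exact: leey.
have n2' : (2 <= n)%N by rewrite ltn_neqAle eq_sym n2.
have hH' : (ch D.+1 a b * n.+1 + n <= H)%N.
  by apply: leq_trans hH; move: (ch _ _ _) => c; clear -n1; nia.
have H0 : (0 < H)%N by apply: leq_trans hH'; rewrite ltn_addl.
rewrite (variance_max_flow n a0 ab Gab iidt H0) lee_fin.
apply: le_trans (hC n H _ n2' hH') _.
by rewrite ler_wpM2r ?lerDl // divr_ge0 ?exprn_ge0 ?ler0n ?ln_ge0 ?ler1n.
Qed.
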